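(* Let $d>n$ be positive integers, let $\mathcal{X}\subseteq\mathbb{R}^d$ be open, let $h:\mathcal{X}\to\mathbb{R}^n$ be a function and let $a:\mathcal{X}\to[0,\infty)$. For $\varepsilon>0$ put $\mathcal{M}=\{x\in\mathcal{X}: h(x)=0\}$ and $\mathcal{M}^\varepsilon=\{x\in\mathcal{X}:\|h(x)\|\le\varepsilon\}$. Suppose that: (i) $h$ is a twice continuously differentiable submersion (so that $\mathcal{M}$ is a twice continuously differentiable submanifold of $\mathcal{X}$, equipped with its Riemannian measure $\lambda_{\mathcal{M}}$); (ii) $a$ is continuous, $\lambda_{\mathcal{M}}\{\mathrm{supp}(a)\cap\mathcal{M}\}>0$, and $0<\int_{\mathcal{M}^\varepsilon}a(x)\,dx<\infty$ for all $\varepsilon>0$; (iii) the collection of probability measures $\{P_\varepsilon:\varepsilon>0\}$ on $\mathcal{X}$ is tight, where $P_\varepsilon$ is the probability measure with Lebesgue density $a(x)\mathbb{I}_{\mathcal{M}^\varepsilon}(x)/\int_{\mathcal{M}^\varepsilon}a(w)\,dw$. Then, as $\varepsilon\downarrow0$, $P_\varepsilon$ converges weakly to the probability measure $P_0$ which is supported on $\mathcal{M}$ and has the following density with respect to $\lambda_{\mathcal{M}}$: $$f(x)=\frac{a(x)\det\left(\nabla h(x)\nabla h(x)^\top\right)^{-1/2}}{\int_{\mathcal{M}}a(w)\det\left(\nabla h(w)\nabla h(w)^\top\right)^{-1/2}\lambda_{\mathcal{M}}(dw)},\qquad x\in\mathcal{M}.$$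
   Context: $\|\cdot\|$ is the Euclidean ($\ell_2$) norm, $\mathbb{I}_A$ is the indicator function of the set $A$, and $\nabla h(x)$ is the $n\times d$ Jacobian matrix of $h$ at $x$. A submersion is a differentiable map whose differential is surjective at every point of its domain. $\lambda_{\mathcal{M}}$ is the Riemannian measure on $\mathcal{M}$ induced by the Euclidean metric of the ambient space. The function $a$ (the ''ambient density'') need not be integrable over $\mathcal{X}$. Here $\mathrm{supp}(a)=\{x\in\mathcal{X}:a(x)>0\}$. Tightness of $\{P_\varepsilon\}$ on $\mathcal{X}$ means: for every $\eta>0$ there is a compact $K\subset\mathcal{X}$ with $P_\varepsilon(K)\ge1-\eta$ for all $\varepsilon>0$. *)

(* Defs.v *)
From HB Require Import structures.
From mathcomp Require Import all_boot all_order all_algebra.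
From mathcomp Require Import all_classical all_reals all_analysis.
From mathcomp Require Import measurable_realfun.

Set Implicit Arguments.
Unset Strict Implicit.
Unset Printing Implicit Defensive.

Import Order.TTheory GRing.Theory Num.Theory.
Import numFieldNormedType.Exports.

Local Open Scope classical_set_scope.
Local Open Scope ring_scope.

Section borel_matrix.
Variables (R : realType) (m n : nat).

HB.instance Definition _ := @isMeasurable.Build
  (sigma_display (@open 'M[R]_(m, n))) 'M[R]_(m, n) <<s @open 'M[R]_(m, n) >>
  (@sigma_algebra0 _ setT _) (@sigma_algebraC _ _)
  (@sigma_algebra_bigcup _ setT _).

Lemma measurable_open_mx (A : set 'M[R]_(m, n)) : open A -> measurable A.
Proof. exact: sub_sigma_algebra. Qed.

End borel_matrix.

Section lebesgue_rV.
Variable R : realType.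

(* (t, v) |-> (t, v_0, ..., v_(n-1)), along which Lebesgue measure on R^(n+1) is
   the image of the product of those on R and R^n. *)
Definition rV_cons n (p : R * 'rV[R]_n) : 'rV[R]_n.+1 :=
  row_mx (p.1)%:M p.2 : 'rV[R]_(1 + n).

Lemma rV_cons0 n (p : R * 'rV[R]_n) : rV_cons p 0 0 = p.1.
Proof.
have -> : 0 = lshift n (0 : 'I_1) :> 'I_(1 + n) by exact: val_inj.
by rewrite [LHS]row_mxEl mxE eqxx.
Qed.

Lemma rV_consS n (p : R * 'rV[R]_n) (i : 'I_n) : rV_cons p 0 (lift 0 i) = p.2 0 i.
Proof.
have -> : lift 0 i = rshift 1 i :> 'I_(1 + n) by exact: val_inj.
exact: row_mxEr.
Qed.

Lemma ball_rV_cons n (p q : R * 'rV[R]_n) (e : R) : 0 < e ->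
  ball p.1 e q.1 -> ball p.2 e q.2 -> ball (rV_cons p) e (rV_cons q).
Proof.
move=> e0 b1 [_ b2]; split => // i j; rewrite (ord1 i).
case: (unliftP 0 j) => [k|] ->; first by rewrite !rV_consS; exact: b2.
by rewrite !rV_cons0.
Qed.

Lemma ratr_approx (x e : R) : 0 < e -> exists q : rat, `|x - ratr q| < e.
Proof.
move=> e0; have xe : x - e < x + e by rewrite ltrD2l gtrN.
have [q] := rat_in_itvoo xe.
by rewrite in_itv/= => qi; exists q; rewrite distrC ltr_distl.
Qed.

Lemma measurable_rV_cons n : measurable_fun setT (@rV_cons n).
Proof.
apply: (@measurability _ _ _ _ _ _ (@open 'rV[R]_n.+1)) => // _ [U oU <-].
rewrite setTI.
pose box (k : rat * {ffun 'I_n -> rat} * nat) : set (R * 'rV[R]_n) :=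
  ball (ratr k.1.1 : R) k.2.+1%:R^-1 `*`
  ball (\row_i ratr (k.1.2 i) : 'rV[R]_n) k.2.+1%:R^-1.
pose D := [set k | box k `<=` @rV_cons n @^-1` U].
suff -> : @rV_cons n @^-1` U = \bigcup_(k in D) box k.
  rewrite bigcup_mkcond; apply: countable_bigcupT_measurable.
    exact: countableP.
  move=> k; case: ifPn => // _; apply: measurableX.
    by apply: open_measurable; exact: ball_open.
  by apply: measurable_open_mx; exact: ball_open.
apply/seteqP; split => [p Up|p [k Dk] /Dk//].
have /nbhs_ballP[e /= e0 eU] : nbhs (rV_cons p) U.
  by move: oU; rewrite openE => /(_ _ Up).
have [k ke] : exists k : nat, k.+1%:R^-1 < e / 2.
  have e20 : 0 < e / 2 by rewrite divr_gt0.
  have [k /= ] := near_infty_natSinv_lt (PosNum e20).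
  by move=> _ /(_ k (leqnn k)) /= ke; exists k.
have k0 : 0 < k.+1%:R^-1 :> R by rewrite invr_gt0.
have [q qp] := ratr_approx p.1 k0.
have [w wp] : exists w : {ffun 'I_n -> rat},
    forall i, `|p.2 0 i - ratr (w i)| < k.+1%:R^-1 :> R.
  have /choice[w wp] := fun i => ratr_approx (p.2 0 i) k0.
  by exists [ffun i => w i] => i; rewrite ffunE.
have box2 : box (q, w, k) p.
  split => /=; first by rewrite /ball/= distrC.
  by split => // i j; rewrite (ord1 i) mxE /ball/= distrC.
exists (q, w, k) => // r [/= r1 r2]; apply: eU; case: box2 => /= p1 p2.
have lee : k.+1%:R^-1 + k.+1%:R^-1 <= e.
  by rewrite [leRHS]splitr lerD// ltW.
apply: ball_rV_cons => //; apply: le_ball lee _ _; apply: ball_triangle.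
- exact: ball_sym p1.
- exact: r1.
- exact: ball_sym p2.
- exact: r2.
Qed.

Definition rV_uncons n (x : 'rV[R]_n.+1) : R * 'rV[R]_n :=
  (x 0 0, \row_i x 0 (lift 0 i)).

Lemma rV_consK n : cancel (@rV_cons n) (@rV_uncons n).
Proof.
move=> [t v]; rewrite /rV_uncons rV_cons0; congr pair.
by apply/rowP => i; rewrite mxE rV_consS.
Qed.

Lemma measurable_coord_rV n (i : 'I_n) :
  measurable_fun setT (fun x : 'rV[R]_n => x 0 i).
Proof.
apply: (@measurability _ _ _ _ _ _ (@RGenOpens.G R)).
  exact: RGenOpens.measurableE.
move=> _ [_ [a [b ->]] <-]; rewrite setTI; apply: measurable_open_mx.
have oU : open (`]a, b[%classic : set R) by exact: interval_open.
by apply: open_comp => // x _; exact: coord_continuous.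
Qed.

Lemma measurable_rV_uncons n : measurable_fun setT (@rV_uncons n).
Proof.
apply/measurable_fun_pair; first exact: measurable_coord_rV.
apply: (@measurability _ _ _ _ _ _ (@open 'rV[R]_n)) => // _ [U oU <-].
rewrite setTI; apply: measurable_open_mx; apply: open_comp => // x _.
move=> /= V /nbhs_ballP[e /= e0 eV]; apply/nbhs_ballP; exists e => //= y [_ xy].
by apply: eV; split => // i j; rewrite !mxE; exact: xy.
Qed.

Section step.
Variables (n : nat) (mu : {sigma_finite_measure set 'rV[R]_n -> \bar R}).

Definition lebesgue_step : set 'rV[R]_n.+1 -> \bar R :=
  pushforward (lebesgue_measure \x mu)%E (@rV_cons n).

Let mcons (A : set 'rV[R]_n.+1) :
  measurable A -> measurable (@rV_cons n @^-1` A).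
Proof.
by move=> mA; rewrite -[X in measurable X]setTI; exact: measurable_rV_cons.
Qed.

Let step0 : lebesgue_step set0 = 0%E.
Proof. by rewrite /lebesgue_step /pushforward preimage_set0 measure0. Qed.

Let step_ge0 A : (0 <= lebesgue_step A)%E.
Proof. exact: (@measure_ge0 _ _ _ (lebesgue_measure \x mu)%E). Qed.

Let step_additive : semi_sigma_additive lebesgue_step.
Proof.
move=> F mF tF mUF; rewrite /lebesgue_step /pushforward preimage_bigcup.
apply: measure_semi_sigma_additive.
- by move=> i; exact: mcons.
- apply/trivIsetP => /= i j _ _ ij; rewrite -preimage_setI.
  by move/trivIsetP : tF => /(_ _ _ _ _ ij) ->//; rewrite preimage_set0.
- by rewrite -preimage_bigcup; exact: mcons.
Qed.

HB.instance Definition _ := isMeasure.Build _ _ _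
  lebesgue_step step0 step_ge0 step_additive.

Let step_sigma_finite : sigma_finite setT lebesgue_step.
Proof.
have /sigma_finiteP[F [FT ndF Foo]] := sigma_finiteT (@lebesgue_measure R).
have /sigma_finiteP[G [GT ndG Goo]] := sigma_finiteT mu.
exists (fun i => @rV_uncons n @^-1` (F i `*` G i)).
  apply/esym; rewrite -subTset => x _.
  have [i _ Fi] : (\bigcup_i F i) (rV_uncons x).1 by rewrite -FT.
  have [j _ Gj] : (\bigcup_i G i) (rV_uncons x).2 by rewrite -GT.
  exists (maxn i j) => //; split.
    by move: Fi; apply/subsetPset/ndF; rewrite leq_maxl.
  by move: Gj; apply/subsetPset/ndG; rewrite leq_maxr.
move=> i; have [mF Fi] := Foo i; have [mG Gi] := Goo i; split.
  rewrite -[X in measurable X]setTI; apply: measurable_rV_uncons => //.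
  exact: measurableX.
rewrite /lebesgue_step /pushforward -comp_preimage.
have -> : @rV_uncons n \o @rV_cons n = id.
  by apply/funext => p /=; rewrite rV_consK.
rewrite preimage_id product_measure1E//.
by rewrite lte_mul_pinfty// ge0_fin_numE.
Qed.

HB.instance Definition _ := Measure_isSigmaFinite.Build _ _ _
  lebesgue_step step_sigma_finite.

End step.

Fixpoint lebesgue_rV n : {sigma_finite_measure set 'rV[R]_n -> \bar R} :=
  if n is m.+1 then lebesgue_step (lebesgue_rV m) else \d_(0 : 'rV[R]_0).

Lemma lebesgue_rV_box n (A : 'I_n -> set R) :
  (forall i, measurable (A i)) ->
  lebesgue_rV n [set x | forall i, A i (x 0 i)] =
  (\prod_(i < n) lebesgue_measure (A i))%E.
Proof.
elim: n A => [|n IHn] A mA.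
  by rewrite big_ord0 /= diracE mem_set// => -[].
have mB : measurable [set x : 'rV[R]_n | forall i, A (lift 0 i) (x 0 i)].
  have -> : [set x : 'rV[R]_n | forall i, A (lift 0 i) (x 0 i)] =
      \bigcap_(i in [set: 'I_n]) ((fun x : 'rV[R]_n => x 0 i) @^-1` A (lift 0 i)).
    by apply/seteqP; split => x /= xA i; [move=> _; exact: xA|exact: xA].
  apply: fin_bigcap_measurable => // i _.
  rewrite -[X in measurable X]setTI.
  exact: measurable_coord_rV.
rewrite big_ord_recl -IHn//= -product_measure1E//; last exact: mA.
rewrite /lebesgue_step /pushforward; congr (_ _).
apply/seteqP; split => -[t v] /=.
  move=> H; split => [|i]; first by have := H 0; rewrite rV_cons0.
  by have := H (lift 0 i); rewrite rV_consS.
by move=> [At Av] i; case: (unliftP 0 i) => [j|] ->; rewrite ?rV_consS ?rV_cons0.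
Qed.

End lebesgue_rV.

Section calculus.
Variable R : realType.

Definition enorm n (x : 'rV[R]_n) : R := Num.sqrt (\sum_(i < n) x 0 i ^+ 2).

(* The library acts on row vectors, ['d f x v = v *m 'J f x]; the transpose is
   the usual Jacobian, with one row per component of f. *)
Definition nabla p q (f : 'rV[R]_p -> 'rV[R]_q) (x : 'rV[R]_p) : 'M[R]_(q, p) :=
  ('J f x)^T.

Definition C1_on p q (X : set 'rV[R]_p) (f : 'rV[R]_p -> 'rV[R]_q) : Prop :=
  (forall x, X x -> differentiable f x) /\
  (forall v, {within X, continuous (fun x => 'd f x v)}).

Definition C2_on p q (X : set 'rV[R]_p) (f : 'rV[R]_p -> 'rV[R]_q) : Prop :=
  C1_on X f /\ (forall v, C1_on X (fun x => 'd f x v)).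

Definition submersion_on p q (X : set 'rV[R]_p) (f : 'rV[R]_p -> 'rV[R]_q) :=
  forall x, X x -> differentiable f x /\ (forall y, exists v, 'd f x v = y).

Definition zero_set p q (X : set 'rV[R]_p) (h : 'rV[R]_p -> 'rV[R]_q) :=
  [set x | X x /\ h x = 0].

Definition tube p q (X : set 'rV[R]_p) (h : 'rV[R]_p -> 'rV[R]_q) (e : R) :=
  [set x | X x /\ enorm (h x) <= e].

End calculus.

Section riemannian_measure.
Variables (R : realType) (k d : nat).
Implicit Types (M : set 'rV[R]_d) (U : set 'rV[R]_k) (phi : 'rV[R]_k -> 'rV[R]_d).

(* A C^2 immersion that is a homeomorphism of U onto a relatively open subset
   of M: its last clause says that phi is open as a map from U to M. *)
Definition local_parametrization M U phi : Prop :=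
  [/\ open U, C2_on U phi, set_inj U phi,
      (forall u, U u -> injective ('d phi u)) &
      (forall W, open W -> W `<=` U ->
         exists2 V, open V & phi @` W = M `&` V)].

(* The matrix in phi of the metric induced on M by the Euclidean metric. *)
Definition metric_tensor phi (u : 'rV[R]_k) : 'M[R]_k :=
  (nabla phi u)^T *m nabla phi u.

(* The Riemannian measure of the k-dimensional submanifold M, viewed as a Borel
   measure on the ambient space that vanishes off M: in every local
   parametrization it is sqrt (det g) du. Countably many parametrizations cover
   M, so there is exactly one such measure. *)
Definition is_riemannian_measure M
    (lam : {measure set 'rV[R]_d -> \bar R}) : Prop :=
  lam (~` M) = 0%E /\
  forall U phi, local_parametrization M U phi ->
    forall A, measurable A -> A `<=` phi @` U ->
      lam A = (\int[lebesgue_rV R k]_(u in U `&` phi @^-1` A)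
                 (Num.sqrt (\det (metric_tensor phi u)))%:E)%E.

End riemannian_measure.

Section probability_on.
Variables (R : realType) (d : nat).
Implicit Types (X D : set 'rV[R]_d) (P : R -> probability 'rV[R]_d R).

Definition has_density_on D (mu : {measure set 'rV[R]_d -> \bar R})
    (f : 'rV[R]_d -> R) (Q : probability 'rV[R]_d R) : Prop :=
  forall A, measurable A -> Q A = (\int[mu]_(x in A `&` D) (f x)%:E)%E.

Definition tight_on X P : Prop :=
  forall eta : R, 0 < eta -> exists K : set 'rV[R]_d,
    [/\ compact K, K `<=` X & forall e : R, 0 < e -> ((1 - eta)%:E <= P e K)%E].

Definition weakly_converges_on X P (Q : probability 'rV[R]_d R) : Prop :=
  forall g : 'rV[R]_d -> R,
    {within X, continuous g} -> (exists c, forall x, X x -> `|g x| <= c) ->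
    \int[P e]_(x in X) g x @[e --> 0^'+] --> \int[Q]_(x in X) g x.

End probability_on.

(* Main.v *)
(* Around each point of M the submersion theorem, applied in coordinates
   x = x0 + u K + w S with u along the kernel of the differential of h and w
   transversal to it, presents M as a graph w = z u. For fixed u, the substitution
   w = z u + e w' turns the slice of the e-tube into the set |h| <= e, which after
   division by e^n converges to a linear image of the unit ball. Its volume and
   the area element of the graph combine, by a determinant identity, into
   det (nabla h nabla h^T)^(-1/2) d lam, so dominated convergence gives
   e^-n int_{M^e} F -> vol(B_n) int_M F det (nabla h nabla h^T)^(-1/2) d lam
   for F continuous with small support, hence, by a partition of unity, for F
   cut off near a compact subset of X. Tightness bounds the cut off mass of a
   uniformly in e, so the limit also holds for F = a g with 0 <= g <= 1; the
   quotient of the limits for a g and for a is the integral of g under P_0. *)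
From HB Require Import structures.
Require Import Defs.
From mathcomp Require Import all_boot all_order all_algebra finmap.
From mathcomp Require Import all_classical all_reals all_analysis.
From mathcomp Require Import measurable_realfun ring lra.

Set Implicit Arguments.
Unset Strict Implicit.
Unset Printing Implicit Defensive.

Import Order.TTheory GRing.Theory Num.Theory.
Import numFieldNormedType.Exports.

Local Open Scope classical_set_scope.
Local Open Scope ring_scope.

(** The coordinates [(u, w)] are affine, and for fixed [u] so is the substitution [w = z u + e w'].
    Lebesgue measure is therefore only ever transported by invertible matrices, and the nonlinearity
    of [h] enters through the pointwise limit of [h / e] along a slice. That limit decides
    membership in the tube except on the unit sphere, which for this reason must be shown to be
    null. The measure [lam] is known only through C^2 parametrizations, so the graph has to be
    proved C^2 before any integral over M can be computed. Finiteness of the integral over M of [a]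
    times its weight is not given: it follows from tightness, since with half of the mass on a
    compact set it is at most twice that of a compact cut-off. Restricting to [0 <= g <= 1] gives
    [(1 - g) (1 - chi) >= 0], which bounds the mass that [a g] loses under a cut-off by the mass
    that [a] loses; the inequality is used in additive form, safe for infinite values. Dominated
    convergence concerns sequences, so [e] tends to 0 along arbitrary positive sequences until the
    very end. *)

Section measurability.
Context {R : realType}.

(** Measurable sets of row vectors are generated by open sets, not by coordinates; the measurability
    of [rV_cons] bridges the two, one coordinate at a time. *)
Lemma measurable_fun_rV d (T : measurableType d) n (f : T -> 'rV[R]_n) :
  (forall i, measurable_fun setT (fun x => f x 0 i)) -> measurable_fun setT f.
Proof.
elim: n f => [|n IHn] f mf.
  move=> _ A mA; have [A0|A0] := pselect (A 0).
    rewrite (_ : _ `&` _ = setT)//; apply/seteqP; split => [x []//|x Dx]; split=> //=.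
    by rewrite (_ : f x = 0)//; apply/rowP => -[].
  rewrite (_ : _ `&` _ = set0)//; apply/seteqP; split => // x [_] /=.
  by rewrite (_ : f x = 0)//; apply/rowP => -[].
have -> : f = @rV_cons R n \o (fun x => (f x 0 0, \row_i f x 0 (lift 0 i))).
  apply/funext => x /=; apply/rowP => i; case: (unliftP 0 i) => [j|] ->.
    by rewrite rV_consS mxE.
  by rewrite rV_cons0.
apply: (@measurableT_comp _ _ _ _ _ _ (@rV_cons R n)).
  exact: measurable_rV_cons.
apply/measurable_fun_pairP; split; first exact: mf.
by apply: IHn => i; apply: eq_measurable_fun (mf (lift 0 i)) => x _; rewrite /= mxE.
Qed.

Lemma open_continuous_preimage (T U : topologicalType) (X : set T) (f : T -> U)
    (A : set U) :
  open X -> (forall x, X x -> {for x, continuous f}) -> open A ->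
  open (X `&` f @^-1` A).
Proof.
move=> oX cf oA; rewrite openE => x [Xx /= fx]; apply: filterI.
  by move: oX; rewrite openE; exact.
by apply: cf => //; move: oA; rewrite openE; exact.
Qed.

Lemma continuous_measurable_rV n (X : set 'rV[R]_n) (f : 'rV[R]_n -> R) :
  open X -> (forall x, X x -> {for x, continuous f}) -> measurable_fun X f.
Proof.
move=> oX cf; apply: (@measurability _ _ _ _ X f (@RGenOpens.G R)).
  exact: RGenOpens.measurableE.
move=> _ [_ [a [b ->]] <-]; apply: measurable_open_mx.
by apply: open_continuous_preimage => //; exact: interval_open.
Qed.

Lemma continuous_measurable_rV_rV n m (X : set 'rV[R]_n) (f : 'rV[R]_n -> 'rV[R]_m) :
  open X -> (forall x, X x -> {for x, continuous f}) -> measurable_fun X f.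
Proof.
move=> oX cf; apply: (@measurability _ _ _ _ X f (@open 'rV[R]_m)) => //.
move=> _ [A oA <-]; apply: measurable_open_mx.
exact: open_continuous_preimage.
Qed.

Lemma compact_measurable_rV n (K : set 'rV[R]_n) : compact K -> measurable K.
Proof.
move=> cK; rewrite -[K]setCK; apply: measurableC; apply: measurable_open_mx.
by apply: closed_openC; apply: compact_closed => //; exact: norm_hausdorff.
Qed.

Lemma measurable_affine n m (T : 'M[R]_(n, m)) b :
  measurable_fun setT (fun x : 'rV[R]_n => x *m T + b).
Proof.
apply: measurable_fun_rV => i.
have -> : (fun x : 'rV[R]_n => (x *m T + b) 0 i) =
    (fun x => (\sum_j x 0 j * T j i) + b 0 i).
  by apply/funext => x; rewrite !mxE.
apply: measurable_funD => //; apply: measurable_sum => j.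
by apply: measurable_funM => //; exact: measurable_coord_rV.
Qed.

Lemma measurable_row_mx n m :
  measurable_fun setT (fun p : 'rV[R]_n * 'rV[R]_m => row_mx p.1 p.2).
Proof.
apply: measurable_fun_rV => i; case: (split_ordP i) => j ->.
  apply: (eq_measurable_fun (fun p : 'rV[R]_n * 'rV[R]_m => p.1 0 j)).
    by move=> p _; rewrite row_mxEl.
  by apply: (measurableT_comp (measurable_coord_rV _)); exact: measurable_fst.
apply: (eq_measurable_fun (fun p : 'rV[R]_n * 'rV[R]_m => p.2 0 j)).
  by move=> p _; rewrite row_mxEr.
by apply: (measurableT_comp (measurable_coord_rV _)); exact: measurable_snd.
Qed.

Lemma measurable_preimageT d1 d2 (T1 : measurableType d1) (T2 : measurableType d2)
    (f : T1 -> T2) A :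
  measurable_fun setT f -> measurable A -> measurable (f @^-1` A).
Proof. by move=> mf mA; rewrite -[X in measurable X]setTI; exact: mf. Qed.

End measurability.

(** * Image measures, and Lebesgue measure on the line under affine maps *)

Section change_of_variables.
Context {R : realType}.

(** The image of [mu] under [phi] is [c] times [mu]; both sides are the integral of [f] against this
    measure. *)
Lemma ge0_integral_preimage_scale d (T : measurableType d)
    (mu : {measure set T -> \bar R}) (phi : T -> T) (c : R) (f : T -> \bar R) :
  measurable_fun setT phi -> 0 <= c ->
  (forall A, measurable A -> mu (phi @^-1` A) = (c%:E * mu A)%E) ->
  measurable_fun setT f -> (forall x, 0 <= f x)%E ->
  (\int[mu]_x f (phi x) = c%:E * \int[mu]_x f x)%E.
Proof.
move=> mphi c0 muphi mf f0.
rewrite -[c in RHS]/((NngNum c0)%:num) -ge0_integral_mscale//.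
rewrite -[LHS]/(\int[mu]_(x in phi @^-1` setT) (f \o phi) x)%E.
rewrite -ge0_integral_pushforward//.
by apply: eq_measure_integral => A mA _; exact: muphi.
Qed.

(** By uniqueness of Lebesgue measure: [|a|] times its image under [t |-> t * a + b] gives each
    interval []x, y]] its length. *)
Lemma lebesgue_measure_affine (a b : R) (A : set R) : a != 0 -> measurable A ->
  lebesgue_measure ((fun t => t * a + b) @^-1` A) =
  ((`|a|^-1)%:E * lebesgue_measure A)%E.
Proof.
move=> a0 mA.
pose phi (t : R) := t * a + b.
have mphi : measurable_fun (setT : set R) phi.
  by apply: measurable_funD => //; apply: measurable_funM.
have na0 : 0 < `|a| by rewrite normr_gt0.
have mphi' : @measurable_fun _ _ (measurableTypeR R) (measurableTypeR R) setT
  phi by exact: mphi.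
pose nu : {measure set (measurableTypeR R) -> \bar R} :=
  measure_function_pushforward__canonical__measure_function_Measure
    (@lebesgue_measure R) mphi'.
pose mu := mscale (NngNum (ltW na0)) nu.
suff -> : lebesgue_measure A = mu A.
  change (lebesgue_measure (phi @^-1` A) = (`|a|^-1%:E *
    (`|a|%:E * lebesgue_measure (phi @^-1` A)))%E).
  by rewrite muleA -EFinM mulVf ?mul1e// gt_eqF.
apply: lebesgue_measure_unique => // _ [[x y] _ <-].
change (lebesgue_measure `]x, y] = (`|a|%:E *
  lebesgue_measure (phi @^-1` `]x, y]))%E).
have [a_gt0|a_lt0] : 0 < a \/ a < 0 by move: a0; rewrite neq_lt => /orP[]; [right|left].
  have -> : phi @^-1` `]x, y] = `](x - b) / a, (y - b) / a]%classic.
    apply/seteqP; split => t /=; rewrite /phi !in_itv/= ltr_pdivrMr// ler_pdivlMr//.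
      by rewrite ltrBlDr lerBrDr.
    by rewrite ltrBlDr lerBrDr.
  rewrite !lebesgue_measure_itv /= !lte_fin gtr0_norm//.
  rewrite ltr_pM2r ?invr_gt0// ltrD2r.
  case: ifP => xy; last by rewrite mule0.
  by rewrite -!EFinD -EFinM; congr (_%:E); field; rewrite gt_eqF.
(* For negative [a] the ends are exchanged and the other one becomes closed; the length is
   unaffected. *)
have -> : phi @^-1` `]x, y] = `[(y - b) / a, (x - b) / a[%classic.
  apply/seteqP; split => t /=; rewrite /phi !in_itv/= ltr_ndivlMr// ler_ndivrMr//.
    by rewrite ltrBlDr lerBrDr andbC.
  by rewrite ltrBlDr lerBrDr andbC.
rewrite !lebesgue_measure_itv /= !lte_fin ltr0_norm//.
rewrite ltr_nM2r ?invr_lt0// ltrD2r.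
case: ifP => xy; last by rewrite mule0.
by rewrite -!EFinD -EFinM; congr (_%:E); field; rewrite lt_eqF.
Qed.

End change_of_variables.

(** * Lebesgue measure on row vectors: Fubini and invertible affine maps *)

Section affine_rV.
Context {R : realType}.

Lemma lebesgue_rVS1 n (A : set 'rV[R]_n.+1) :
  (lebesgue_rV R n.+1 A =
   \int[lebesgue_measure]_t lebesgue_rV R n [set v | A (rV_cons (t, v))])%E.
Proof.
apply: eq_integral => t _; congr (lebesgue_rV R n _).
by apply/seteqP; split => v /=; rewrite /xsection/= inE.
Qed.

(** Uniqueness of the product measure allows the first coordinate to be integrated innermost, the
    order that [affine_scales_lblock] needs. *)
Lemma lebesgue_rVS2 n (A : set 'rV[R]_n.+1) : measurable A ->
  (lebesgue_rV R n.+1 A =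
   \int[lebesgue_rV R n]_v lebesgue_measure [set t | A (rV_cons (t, v))])%E.
Proof.
move=> mA.
have mA' : measurable (@rV_cons R n @^-1` A).
  exact: measurable_preimageT (@measurable_rV_cons R n) mA.
transitivity (((@lebesgue_measure R) \x^ (lebesgue_rV R n))%E (@rV_cons R n @^-1` A)).
  apply: (@product_measure_unique _ _ _ _ _ _ _
    ((@lebesgue_measure R) \x^ (lebesgue_rV R n))%E) => // B C mB mC.
  exact: product_measure2E.
apply: eq_integral => v _; congr (lebesgue_measure _).
by apply/seteqP; split => t /=; rewrite /ysection/= inE.
Qed.

Lemma measurable_lebesgue_rV_section n (A : set 'rV[R]_n.+1) : measurable A ->
  measurable_fun setT (fun t => lebesgue_rV R n [set v | A (rV_cons (t, v))]).
Proof.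
move=> mA.
have mA' : measurable (@rV_cons R n @^-1` A).
  exact: measurable_preimageT (@measurable_rV_cons R n) mA.
apply: eq_measurable_fun (measurable_fun_xsection (lebesgue_rV R n) mA') => t _ /=.
congr (lebesgue_rV R n _).
by apply/seteqP; split => v /=; rewrite /xsection/= inE.
Qed.

Lemma measurable_lebesgue_section_rV n (A : set 'rV[R]_n.+1) : measurable A ->
  measurable_fun setT (fun v => lebesgue_measure [set t | A (rV_cons (t, v))]).
Proof.
move=> mA.
have mA' : measurable (@rV_cons R n @^-1` A).
  exact: measurable_preimageT (@measurable_rV_cons R n) mA.
apply: eq_measurable_fun (measurable_fun_ysection (@lebesgue_measure R) mA') => v _ /=.
congr (lebesgue_measure _).
by apply/seteqP; split => t /=; rewrite /ysection/= inE.
Qed.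

Lemma measurable_rV_cons_section1 n t (A : set 'rV[R]_n.+1) : measurable A ->
  measurable [set v | A (rV_cons (t, v))].
Proof.
move=> mA; have mA' : measurable (@rV_cons R n @^-1` A).
  exact: measurable_preimageT (@measurable_rV_cons R n) mA.
rewrite (_ : [set v | _] = xsection (@rV_cons R n @^-1` A) t).
  exact: measurable_xsection.
by apply/seteqP; split => v /=; rewrite /xsection/= inE.
Qed.

Lemma measurable_rV_cons_section2 n v (A : set 'rV[R]_n.+1) : measurable A ->
  measurable [set t | A (rV_cons (t, v))].
Proof.
move=> mA; have mA' : measurable (@rV_cons R n @^-1` A).
  exact: measurable_preimageT (@measurable_rV_cons R n) mA.
rewrite (_ : [set t | _] = ysection (@rV_cons R n @^-1` A) v).
  exact: measurable_ysection.
by apply/seteqP; split => t /=; rewrite /ysection/= inE.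
Qed.

(** The translation is quantified inside so that induction on the dimension applies: fixing one
    coordinate of a linear map leaves an affine map of the others, whose translation depends on that
    coordinate. *)
Definition affine_scales n (T : 'M[R]_n) := forall b A, measurable A ->
  lebesgue_rV R n [set x | A (x *m T + b)] =
  ((`|\det T|^-1)%:E * lebesgue_rV R n A)%E.

Lemma affine_scalesM n (S T : 'M[R]_n) :
  affine_scales S -> affine_scales T -> affine_scales (S *m T).
Proof.
move=> hS hT b A mA.
have mA' : measurable [set y : 'rV[R]_n | A (y *m T + b)].
  exact: measurable_preimageT (measurable_affine T b) mA.
rewrite (_ : [set x | _] =
    [set x | [set y : 'rV[R]_n | A (y *m T + b)] (x *m S + 0)]).
  by rewrite hS// hT// muleA -EFinM -invfM -normrM -det_mulmx.
by apply/seteqP; split => x /=; rewrite addr0 mulmxA.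
Qed.

Lemma integral_affine_scales n (T : 'M[R]_n) b (f : 'rV[R]_n -> \bar R) :
  affine_scales T -> measurable_fun setT f -> (forall x, 0 <= f x)%E ->
  (\int[lebesgue_rV R n]_x f (x *m T + b)%R =
   (`|\det T|^-1)%:E * \int[lebesgue_rV R n]_x f x)%E.
Proof.
move=> hT mf f0.
apply: (@ge0_integral_preimage_scale _ _ _ _ (fun x => x *m T + b)) => //.
- exact: measurable_affine.
- by move=> A mA; exact: hT.
Qed.

Lemma rV_cons_row_mx n (t : R) (v : 'rV[R]_n) :
  rV_cons (t, v) = row_mx t%:M v :> 'rV[R]_(1 + n).
Proof. by []. Qed.

Lemma rV_cons_affine n (a : R) (b : 'rV[R]_n) (c : 'cV[R]_n) (D : 'M[R]_n) t v
    (w : 'rV[R]_n.+1) :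
  rV_cons (t, v) *m block_mx a%:M b c D + w =
  rV_cons (t * a + ((v *m c) 0 0 + w 0 0),
           v *m D + (t *: b + \row_i w 0 (lift 0 i))) :> 'rV[R]_(1 + n).
Proof.
pose w' := \row_i w 0 (lift 0 i).
have wE : w = rV_cons (w 0 0, w').
  apply/rowP => i; case: (unliftP 0 i) => [j|] ->; first by rewrite rV_consS mxE.
  by rewrite rV_cons0.
rewrite [X in _ + X = _]wE !rV_cons_row_mx.
rewrite (@mul_row_block R 1 1 n 1 n) (@add_row_mx _ 1 1 n).
congr row_mx.
  by apply/matrixP => i j; rewrite !ord1 !mxE !big_ord1 !mxE eqxx !mulr1n addrA.
by rewrite mul_scalar_mx -/w' [t *: b + _ in LHS]addrC -addrA.
Qed.

(** For a fixed first coordinate [t] the row [b] merely translates the others by [t *: b]; the inner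
    integral scales by [D], the outer one by [a]. *)
Lemma affine_scales_ublock n (a : R) (b : 'rV[R]_n) (D : 'M[R]_n) :
  a != 0 -> affine_scales D ->
  affine_scales (block_mx a%:M b 0 D : 'M[R]_(1 + n)).
Proof.
move=> a0 hD w A mA.
rewrite [LHS]lebesgue_rVS1.
pose g (t : R) := lebesgue_rV R n [set v | A (rV_cons (t, v))].
transitivity (\int[@lebesgue_measure R]_t
    ((`|\det D|^-1)%:E * g ((t : R) * a + w 0 0)%R))%E.
  apply: eq_integral => t _; rewrite /g -(hD (t *: b + \row_i w 0 (lift 0 i))).
    congr (lebesgue_rV R n _); apply/seteqP; split => v /=;
    by rewrite rV_cons_affine mulmx0 mxE add0r.
  exact: measurable_rV_cons_section1.
have mg : measurable_fun setT g by exact: measurable_lebesgue_rV_section.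
have maff : measurable_fun (setT : set R) (fun t : R => t * a + w 0 0).
  by apply: measurable_funD => //; apply: measurable_funM.
rewrite ge0_integralZl_EFin//; last exact: (measurableT_comp mg maff).
have -> : (\int[@lebesgue_measure R]_t g ((t : R) * a + w 0 0)%R =
    (`|a|^-1)%:E * \int[@lebesgue_measure R]_t g t)%E.
  refine (@ge0_integral_preimage_scale _ _ _ (@lebesgue_measure R)
    (fun t : R => t * a + w 0 0) _ g maff _ _ mg _) => //.
  by move=> B mB; exact: lebesgue_measure_affine.
rewrite -[X in ((_)%:E * (_ * X))%E]lebesgue_rVS1 muleA -EFinM.
by rewrite det_ublock det_scalar1 normrM invfM mulrC.
Qed.

(** For fixed [v] the first coordinate is only translated, by [v *m c]. The hypothesis on the
    identity absorbs the translation of [v] itself. *)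
Lemma affine_scales_lblock n (c : 'cV[R]_n) : affine_scales (1%:M : 'M[R]_n) ->
  affine_scales (block_mx 1%:M 0 c 1%:M : 'M[R]_(1 + n)).
Proof.
move=> h1 w A mA.
have mB : measurable [set x : 'rV[R]_n.+1 |
    A (x *m (block_mx 1%:M 0 c 1%:M : 'M[R]_(1 + n)) + w)].
  exact: measurable_preimageT (measurable_affine _ w) mA.
rewrite [LHS]lebesgue_rVS2//.
pose w' : 'rV[R]_n := \row_i w 0 (lift 0 i).
pose g (v : 'rV[R]_n) := lebesgue_measure [set t | A (rV_cons (t, v))].
transitivity (\int[lebesgue_rV R n]_v g (v *m 1%:M + w')%R)%E.
  apply: eq_integral => v _; rewrite /g.
  have mC : measurable [set t | A (rV_cons (t, v *m 1%:M + w'))].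
    exact: measurable_rV_cons_section2.
  have := lebesgue_measure_affine ((v *m c) 0 0 + w 0 0) (oner_neq0 R) mC.
  rewrite normr1 invr1 mul1e => <-.
  congr (lebesgue_measure _).
  by apply/seteqP; split => t /=; rewrite rV_cons_affine scaler0 add0r.
rewrite integral_affine_scales//; last exact: measurable_lebesgue_section_rV.
by rewrite -[X in (_ * X)%E]lebesgue_rVS2// det_lblock !det1 mulr1.
Qed.

(** Block elimination: once the pivot is nonzero the matrix is a shear times an upper block
    triangular matrix, whose lower corner has size [n] and falls under the induction hypothesis. *)
Lemma affine_scales_unit n (T : 'M[R]_n) : T \in unitmx -> affine_scales T.
Proof.
elim: n T => [|n IHn] T uT.
  move=> b A mA; rewrite det_mx00 normr1 invr1 mul1e.
  congr (lebesgue_rV R 0 _); apply/seteqP; split => x /=;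
  by rewrite (_ : _ + b = x)//; apply/rowP => -[].
have h1 : affine_scales (1%:M : 'M[R]_n) by apply: IHn; exact: unitmx1.
have ulE (N : 'M[R]_(1 + n)) : ulsubmx N = (N 0 0)%:M.
  apply/matrixP => i j; rewrite !ord1 !mxE eqxx mulr1n.
  by congr (N _ _); exact: val_inj.
(* Adding to the first column a combination [c] of the others makes the pivot
   nonzero without permuting coordinates. *)
pose T' : 'M[R]_(1 + n) := T.
have [c Tc0] : exists c : 'cV[R]_n, (T' *m block_mx 1%:M 0 c 1%:M) 0 0 != 0.
  have E (c : 'cV[R]_n) : (T' *m block_mx 1%:M 0 c 1%:M) 0 0 =
      T' 0 0 + (ursubmx T' *m c) 0 0.
    rewrite -{1}[T']submxK mulmx_block.
    have -> : 0 = lshift n 0 :> 'I_(1 + n) by exact: val_inj.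
    by rewrite block_mxEul mulmx1 [LHS]mxE !mxE; congr (T' _ _ + _); exact: val_inj.
  have [T00|T00] := eqVneq (T' 0 0) 0; last first.
    by exists 0; rewrite E mulmx0 mxE addr0.
  (* This choice makes the pivot the sum of the squares of the rest of the first row, so it vanishes
     only if the whole row does, against [\det T' != 0]. *)
  exists (ursubmx T')^T; rewrite E T00 add0r; apply/negP => /eqP T0.
  have ur0 : ursubmx T' = 0.
    apply/rowP => j; move: T0; rewrite mxE.
    under eq_bigr do rewrite [_^T _ _]mxE -expr2.
    move=> /eqP; rewrite psumr_eq0; last by move=> i _; exact: sqr_ge0.
    by move=> /allP/(_ j (mem_index_enum _)); rewrite sqrf_eq0 => /eqP ->; rewrite mxE.
  have : \det T' != 0 by rewrite -unitfE -unitmxE.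
  rewrite -[T']submxK ur0 det_lblock.
  have -> : ulsubmx T' = 0.
    by rewrite ulE T00 raddf0.
  by rewrite det_mx11 mxE mul0r eqxx.
set M := T' *m _ in Tc0.
have TE : T' = M *m block_mx 1%:M 0 (- c) 1%:M.
  rewrite /M -mulmxA mulmx_block !mulmx1 !mul1mx !mul0mx !mulmx0 !addr0 !add0r.
  by rewrite subrr -scalar_mx_block mulmx1.
pose a := M 0 0.
have ulM : ulsubmx M = a%:M by exact: ulE.
(* The Schur complement of the pivot. *)
pose D := drsubmx M - a^-1 *: (dlsubmx M *m ursubmx M).
have ME : M = block_mx 1%:M 0 (a^-1 *: dlsubmx M) 1%:M *m
              block_mx a%:M (ursubmx M) 0 D.
  rewrite mulmx_block !mul1mx !mul0mx ?mulmx0 !addr0 -scalemxAl mul_mx_scalar.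
  rewrite scalerA mulVf// scale1r -scalemxAl /D addrC subrK -ulM.
  by rewrite submxK.
have uD : D \in unitmx.
  have : \det M != 0.
    rewrite /M det_mulmx det_lblock !det1 !mulr1 -unitfE -unitmxE.
    exact: uT.
  rewrite ME det_mulmx det_lblock det_ublock !det1 !mul1r det_scalar1 mulf_eq0.
  by rewrite negb_or unitmxE unitfE => /andP[].
rewrite -[T]/T' TE ME.
apply: affine_scalesM; last exact: affine_scales_lblock.
apply: affine_scalesM; first exact: affine_scales_lblock.
by apply: affine_scales_ublock => //; exact: IHn.
Qed.

Lemma lebesgue_rV_affine n (T : 'M[R]_n) b A : T \in unitmx -> measurable A ->
  lebesgue_rV R n [set x | A (x *m T + b)] =
  ((`|\det T|^-1)%:E * lebesgue_rV R n A)%E.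
Proof. by move=> uT mA; exact: affine_scales_unit. Qed.

Lemma integral_rV_affine n (T : 'M[R]_n) b (f : 'rV[R]_n -> \bar R) :
  T \in unitmx -> measurable_fun setT f -> (forall x, 0 <= f x)%E ->
  (\int[lebesgue_rV R n]_x f x =
   `|\det T|%:E * \int[lebesgue_rV R n]_x f (x *m T + b)%R)%E.
Proof.
move=> uT mf f0; rewrite integral_affine_scales//; last exact: affine_scales_unit.
rewrite muleA -EFinM divff ?mul1e// normr_eq0 -unitfE -unitmxE//.
Qed.

Lemma integral_rVS n (f : 'rV[R]_n.+1 -> \bar R) :
  measurable_fun setT f -> (forall x, 0 <= f x)%E ->
  (\int[lebesgue_rV R n.+1]_x f x =
   \int[@lebesgue_measure R]_t \int[lebesgue_rV R n]_v f (rV_cons (t : R, v)))%E.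
Proof.
move=> mf f0.
have mcons : @measurable_fun _ _ (measurableTypeR R * 'rV[R]_n)%type _ setT
  (@rV_cons R n) by exact: measurable_rV_cons.
rewrite [LHS](ge0_integral_pushforward mcons
  (lebesgue_measure \x lebesgue_rV R n)%E measurableT mf)//.
by rewrite [LHS]fubini_tonelli1//; [exact: (measurableT_comp mf mcons)|move=> p; exact: f0].
Qed.

Lemma row_mx_rV_cons k n t (u : 'rV[R]_k) (z : 'rV[R]_n) :
  row_mx (rV_cons (t, u)) z = rV_cons (t, row_mx u z).
Proof.
rewrite !rV_cons_row_mx; apply/esym; rewrite (@row_mxA _ 1 1 k n).
exact: castmx_id.
Qed.

(** The measure is built coordinate by coordinate, so the first [k] can be peeled off inductively;
    for [k = 0] the first factor is the Dirac mass at the only point. *)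
Lemma lebesgue_rV_add k n (A : set 'rV[R]_(k + n)) : measurable A ->
  (lebesgue_rV R (k + n) A =
   (lebesgue_rV R k \x lebesgue_rV R n) [set p | A (row_mx p.1 p.2)])%E.
Proof.
elim: k A => [|k IHk] A mA.
  transitivity (\int[\d_(0%R : 'rV[R]_0)]_x (cst (lebesgue_rV R n A)) x)%E.
    by rewrite integral_cst//= diracE mem_set// mule1.
  apply: eq_integral => x _ /=; congr (lebesgue_rV R n _).
  apply/seteqP; split => z /=; rewrite /xsection/= inE/=;
  rewrite (_ : row_mx x z = z)//; apply/rowP => i;
  have -> : i = rshift 0 i :> 'I_(0 + n) by exact: val_inj.
    by rewrite row_mxEr; congr (z _ _); exact: val_inj.
  by rewrite row_mxEr; congr (z _ _); exact: val_inj.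
pose S := (fun p : 'rV[R]_k.+1 * 'rV[R]_n => row_mx p.1 p.2) @^-1` A.
have mS : measurable S by apply: measurable_preimageT mA; exact: measurable_row_mx.
pose f (y : 'rV[R]_k.+1) := lebesgue_rV R n (xsection S y).
have mf : measurable_fun setT f by exact: measurable_fun_xsection.
transitivity (\int[lebesgue_rV R k.+1]_y f y)%E => //.
rewrite integral_rVS// [LHS]lebesgue_rVS1; apply: eq_integral => t _.
rewrite IHk; last exact: (@measurable_rV_cons_section1 (k + n)).
apply: eq_integral => u _; rewrite /f /=.
congr (lebesgue_rV R n _).
by apply/seteqP; split => z; rewrite /xsection/= !inE /S/= row_mx_rV_cons.
Qed.

Lemma integral_rV_add k n (f : 'rV[R]_(k + n) -> \bar R) :
  measurable_fun setT f -> (forall x, 0 <= f x)%E ->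
  (\int[lebesgue_rV R (k + n)]_x f x =
   \int[lebesgue_rV R k]_u \int[lebesgue_rV R n]_z f (row_mx u z))%E.
Proof.
move=> mf f0.
have mphi := @measurable_row_mx R k n.
transitivity (\int[lebesgue_rV R k \x lebesgue_rV R n]_p f (row_mx p.1 p.2))%E.
  have <- := ge0_integral_pushforward mphi (lebesgue_rV R k \x lebesgue_rV R n)%E
    measurableT mf (fun x _ => f0 x).
  by apply: eq_measure_integral => A mA _; exact: lebesgue_rV_add.
by rewrite fubini_tonelli1//; exact: (measurableT_comp mf mphi).
Qed.

End affine_rV.

(** * Volumes of Euclidean balls, where [enorm] is compared with the sup norm carried by row
    vectors *)

Section euclidean_ball.
Context {R : realType}.

Lemma norm_rV_le n (x : 'rV[R]_n) (e : R) : 0 <= e ->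
  (forall i, `|x 0 i| <= e) -> `|x| <= e.
Proof.
move=> e0 xe; rewrite /Num.norm/= mx_normrE; apply: bigmax_le => // -[i j] _.
by rewrite (ord1 i).
Qed.

Lemma norm_coord_le n (x : 'rV[R]_n) i : `|x 0 i| <= `|x|.
Proof.
rewrite [X in _ <= X]/Num.norm/= mx_normrE.
exact: (@le_bigmax _ _ _ 0 (fun ij : 'I_1 * 'I_n => `|x ij.1 ij.2|) (0, i)).
Qed.

Lemma enorm_ge0 n (x : 'rV[R]_n) : 0 <= enorm x.
Proof. exact: sqrtr_ge0. Qed.

Lemma enormZ n (t : R) (x : 'rV[R]_n) : enorm (t *: x) = `|t| * enorm x.
Proof.
rewrite /enorm; under eq_bigr do rewrite mxE exprMn.
by rewrite -mulr_sumr sqrtrM ?sqr_ge0// sqrtr_sqr.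
Qed.

Lemma norm_coord_le_enorm n (x : 'rV[R]_n) i : `|x 0 i| <= enorm x.
Proof.
rewrite -sqrtr_sqr ler_sqrt; last by apply: sumr_ge0 => j _; exact: sqr_ge0.
by rewrite (bigD1 i)//= lerDl sumr_ge0// => j _; exact: sqr_ge0.
Qed.

Lemma norm_le_enorm n (x : 'rV[R]_n) : `|x| <= enorm x.
Proof.
by apply: norm_rV_le; [exact: enorm_ge0|move=> i; exact: norm_coord_le_enorm].
Qed.

Lemma continuous_coord_rV n (i : 'I_n) : continuous (fun x : 'rV[R]_n => x 0 i).
Proof. by move=> x; exact: coord_continuous. Qed.

Lemma continuous_sum_fun (T : topologicalType) I (r : seq I) (P : pred I)
    (F : I -> T -> R) (x : T) :
  (forall i, P i -> {for x, continuous (F i)}) ->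
  {for x, continuous (fun y => \sum_(i <- r | P i) F i y)}.
Proof.
move=> cF; elim: r => [|i r IHr].
  rewrite (_ : (fun y => _) = cst 0); first exact: cst_continuous.
  by apply/funext => y; rewrite big_nil.
rewrite (_ : (fun y => _) = (fun y => (if P i then F i y else 0) +
    \sum_(i <- r | P i) F i y)); last first.
  by apply/funext => y; rewrite big_cons; case: ifP; rewrite ?add0r.
apply: (@continuousD _ _ _ (fun y => if P i then F i y else 0)) => //.
by case Pi: (P i); [exact: cF|exact: cst_continuous].
Qed.

Lemma continuous_enorm n : continuous (@enorm R n).
Proof.
move=> x; apply: (continuous_comp _ (@sqrt_continuous R _)).
apply: continuous_sum_fun => i _.
by apply: (@continuousM _ _ (fun y : 'rV[R]_n => y 0 i) (fun y : 'rV[R]_n => y 0 i));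
   exact: continuous_coord_rV.
Qed.

Lemma measurable_enorm n : measurable_fun setT (@enorm R n).
Proof.
apply: continuous_measurable_rV; first exact: openT.
by move=> x _; exact: continuous_enorm.
Qed.

Definition unit_ball n := [set w : 'rV[R]_n | enorm w <= 1].

Lemma measurable_enorm_le n (r : R) : measurable [set w : 'rV[R]_n | enorm w <= r].
Proof.
rewrite (_ : [set w | _] = @enorm R n @^-1` `]-oo, r]).
  exact: measurable_preimageT (@measurable_enorm n) _.
by apply/seteqP; split => w /=; rewrite in_itv.
Qed.

Lemma measurable_unit_ball n : measurable (@unit_ball n).
Proof. exact: measurable_enorm_le. Qed.

Lemma lebesgue_rV_cube n (r : R) : 0 <= r ->
  lebesgue_rV R n [set w | forall i, w 0 i \in `[- r, r]] = ((r *+ 2) ^+ n)%:E.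
Proof.
move=> r0; rewrite (lebesgue_rV_box (A := fun=> `[- r, r]%classic))//.
rewrite (eq_bigr (fun=> (r *+ 2)%:E)).
  elim: n => [|n IHn]; first by rewrite big_ord0 expr0.
  by rewrite big_ord_recl IHn -EFinM exprS.
move=> i _; rewrite lebesgue_measure_itv/= lte_fin.
case: ltP => [_|]; first by rewrite -EFinD opprK -mulr2n.
move=> h; have -> : r = 0 by lra.
by rewrite mul0rn.
Qed.

Lemma measurable_cube n (r : R) : measurable [set w : 'rV[R]_n | forall i, w 0 i \in `[- r, r]].
Proof.
rewrite (_ : [set w | _] =
  \bigcap_(i in [set: 'I_n]) ((fun x : 'rV[R]_n => x 0 i) @^-1` `[- r, r])).
  apply: fin_bigcap_measurable => // i _.
  exact: measurable_preimageT (measurable_coord_rV _) _.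
by apply/seteqP; split => x /= xA i; [move=> _; exact: xA|exact: xA].
Qed.

Lemma lebesgue_unit_ball_fin n : (lebesgue_rV R n (@unit_ball n) < +oo)%E.
Proof.
apply: (@le_lt_trans _ _ (((1 *+ 2 : R) ^+ n)%:E)); last exact: ltry.
rewrite -lebesgue_rV_cube//; apply: le_measure; rewrite ?inE.
- exact: measurable_unit_ball.
- exact: measurable_cube.
- move=> w /= w1 i; rewrite in_itv/= -ler_norml.
  exact: le_trans (norm_coord_le_enorm _ _) w1.
Qed.

Lemma lebesgue_unit_ball_gt0 n : (0 < lebesgue_rV R n (@unit_ball n))%E.
Proof.
(* Half the side of a cube inside the ball: each of the [n] squares is at most [1 / (n + 1)]. Using
   [n.+1] covers [n = 0]. *)
have r0 : 0 < n.+1%:R^-1 :> R by rewrite invr_gt0.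
apply: (@lt_le_trans _ _ (((n.+1%:R^-1 *+ 2 : R) ^+ n)%:E)).
  by rewrite lte_fin exprn_gt0// mulr2n addr_gt0.
rewrite -(lebesgue_rV_cube n (ltW r0)); apply: le_measure; rewrite ?inE.
- exact: measurable_cube.
- exact: measurable_unit_ball.
- move=> w /= wr; rewrite /unit_ball/= /enorm -[leRHS]sqrtr1 ler_sqrt//.
  apply: (@le_trans _ _ (\sum_(i < n) n.+1%:R^-1)).
    apply: ler_sum => i _; have := wr i; rewrite in_itv/= -ler_norml => wir.
    rewrite -real_normK ?num_real// expr2 -[leRHS]mulr1 ler_pM// (le_trans wir)//.
    by rewrite invf_le1// ler1n.
  rewrite sumr_const card_ord -[_ *+ n]mulr_natl ler_pdivrMr// mul1r.
  by rewrite ler_nat.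
Qed.

Lemma lebesgue_enorm_le n (r : R) : 0 < r ->
  lebesgue_rV R n [set w | enorm w <= r] =
  ((r ^+ n)%:E * lebesgue_rV R n (@unit_ball n))%E.
Proof.
move=> r0.
have u : r^-1%:M \in @unitmx R n.
  by rewrite unitmxE det_scalar unitrX// unitfE invr_eq0 gt_eqF.
have := lebesgue_rV_affine 0 u (@measurable_unit_ball n).
rewrite det_scalar normrX normfV gtr0_norm// exprVn invrK => <-.
congr (lebesgue_rV R n _); apply/seteqP; split => w /=;
  rewrite addr0 mul_mx_scalar /unit_ball/= enormZ normfV gtr0_norm//;
  by rewrite ler_pdivrMl// mulr1.
Qed.

(** Bernoulli's inequality; it bounds the volume of the shell between the radii [1 - d] and 1. *)
Lemma one_sub_exprn_le (d : R) n : 0 <= d <= 1 -> 1 - (1 - d) ^+ n <= n%:R * d.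
Proof.
move=> /andP[d0 d1]; elim: n => [|n IHn]; first by rewrite expr0 subrr mul0r.
rewrite exprS -natr1.
have : 0 <= (1 - d) ^+ n <= 1.
  by rewrite exprn_ge0 ?exprn_ile1 ?subr_ge0//= lerBlDr lerDl.
move: IHn; set y := (1 - d) ^+ n => IHn /andP[y0 y1].
have dy : d * y <= d * 1 by rewrite ler_wpM2l.
nra.
Qed.

(** For [r < 1] the sphere and the ball of radius [r] are disjoint in the unit ball, so the sphere
    has measure at most [(1 - r ^ n)] times that of the ball; then [r] tends to 1. *)
Lemma lebesgue_unit_sphere n : lebesgue_rV R n [set w | enorm w = 1] = 0%E.
Proof.
have mS : measurable [set w : 'rV[R]_n | enorm w = 1].
  exact: (@measurable_preimageT _ _ _ _ (@enorm R n) [set 1] (@measurable_enorm n)).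
have mB := @measurable_unit_ball n.
have Boo := @lebesgue_unit_ball_fin n.
have c_fin : lebesgue_rV R n (@unit_ball n) \is a fin_num by rewrite ge0_fin_numE.
set c := lebesgue_rV R n (@unit_ball n) in Boo c_fin.
have key (r : R) : 0 < r < 1 ->
    (lebesgue_rV R n [set w | enorm w = 1%R] + (r ^+ n)%:E * c <= c)%E.
  move=> /andP[r0 r1]; rewrite -lebesgue_enorm_le// -measureU//.
  - apply: le_measure; rewrite ?inE//.
      by apply: measurableU => //; exact: measurable_enorm_le.
    move=> w /= [|] ; rewrite /unit_ball/=; first by move=> ->.
    by move=> /le_trans; apply; exact: ltW.
  - exact: measurable_enorm_le.
  - by apply/seteqP; split => // w /= [->]; rewrite leNgt r1.
have S_fin : lebesgue_rV R n [set w | enorm w = 1] \is a fin_num.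
  rewrite ge0_fin_numE//; apply: le_lt_trans Boo.
  by apply: le_measure; rewrite ?inE// => w /= w1; rewrite /unit_ball/= w1.
apply/eqP; rewrite eq_le measure_ge0 andbT.
move: key; rewrite -(fineK S_fin) -(fineK c_fin).
set s := fine _; set C := fine _ => key.
have C0 : 0 <= C by exact/fine_ge0/measure_ge0.
rewrite lee_fin; apply/ler_addgt0Pr => e e0; rewrite add0r.
(* The shell inside radius 1 of width [d] has volume at most [n d C], which this [d] keeps below
   [e]. The 1 keeps the denominator positive and the bound 1/2 keeps the radius [1 - d] in []0,
   1[]. *)
pose d := Num.min (1 / 2) (e / (n%:R * C + 1)).
have D0 : 0 < n%:R * C + 1 by rewrite ltr_wpDl// mulr_ge0.
have d0 : 0 < d by rewrite lt_min divr_gt0// divr_gt0.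
have d12 : d <= 1 / 2 by rewrite ge_min lexx.
have de : d * (n%:R * C + 1) <= e by rewrite -ler_pdivlMr// ge_min lexx orbT.
have r01 : 0 < 1 - d < 1 by apply/andP; split; lra.
have := key (1 - d) r01; rewrite -EFinM -EFinD lee_fin => h2.
have : 1 - (1 - d) ^+ n <= n%:R * d.
  by apply: one_sub_exprn_le; apply/andP; split; lra.
move: h2; set y := (1 - d) ^+ n => h2 h1.
have h3 : (1 - y) * C <= n%:R * d * C by rewrite ler_wpM2r.
nra.
Qed.

End euclidean_ball.

(** * Differentials in epsilon form, the mean value inequality and strict differentiability *)

Section differential.
Context {R : realType}.

Lemma diff_eps (V W : normedModType R) (f : V -> W) x : differentiable f x ->
  forall e : R, 0 < e ->
    \forall y \near x, `|f y - f x - 'd f x (y - x)| <= e * `|y - x|.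
Proof.
move=> /diff_locally/eqaddoP df e e0.
have H := df e e0.
rewrite (near_shift 0 x); apply: filterS H => v /=.
rewrite !subr0 /shift/=.
rewrite -[X in `|X|]/(f (v + x) - (f x + 'd f x v)).
by rewrite opprD addrA addrK.
Qed.

Lemma diff_of_eps (V W : normedModType R) (f : V -> W) (df : {linear V -> W}) x :
  continuous df ->
  (forall e : R, 0 < e ->
    \forall y \near x, `|f y - f x - df (y - x)| <= e * `|y - x|) ->
  differentiable f x /\ 'd f x = df :> (V -> W).
Proof.
move=> cdf H.
have E : f \o shift x = cst (f x) + df +o_ 0 id.
  apply/eqaddoP => e e0; have := H e e0.
  rewrite (near_shift 0 x) => {}H; apply: filterS H => v /=.
  rewrite !subr0 /shift/= addrK => h.
  rewrite -[X in `|X|]/(f (v + x) - (f x + df v)).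
  by rewrite opprD addrA.
have dE := diff_unique cdf E.
split => //; apply/diff_locallyP; split; first by rewrite dE.
by rewrite dE.
Qed.

Lemma near_eq_diff (V W : normedModType R) (f g : V -> W) x :
  (\forall y \near x, f y = g y) -> differentiable f x ->
  differentiable g x /\ 'd g x = 'd f x :> (V -> W).
Proof.
move=> fg df; apply: diff_of_eps; first exact: diff_continuous.
move=> e e0; have fgx := nbhs_singleton fg.
by apply: filterS2 fg (diff_eps df e0) => y <-; rewrite -fgx.
Qed.

(** A crude substitute for the operator norm: any constant bounding [v |-> v *m A] in the sup norm
    serves. *)
Definition mxsum m n (A : 'M[R]_(m, n)) : R := \sum_i \sum_j `|A i j|.

Lemma mxsum_ge0 m n (A : 'M[R]_(m, n)) : 0 <= mxsum A.
Proof. by apply: sumr_ge0 => i _; apply: sumr_ge0. Qed.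

Lemma norm_mulmx_le m n (v : 'rV[R]_m) (A : 'M[R]_(m, n)) :
  `|v *m A| <= mxsum A * `|v|.
Proof.
apply: norm_rV_le => [|j]; first by rewrite mulr_ge0 ?mxsum_ge0.
rewrite mxE (le_trans (ler_norm_sum _ _ _))// /mxsum mulr_suml ler_sum// => i _.
rewrite normrM mulrC; apply: ler_pM => //; last exact: norm_coord_le.
by rewrite (bigD1 j)//= lerDl sumr_ge0.
Qed.

Lemma mulmx_continuous m n (A : 'M[R]_(m, n)) :
  continuous (fun v : 'rV[R]_m => v *m A).
Proof.
apply/(@linear_bounded_continuous _ _ _ (mulmxr A)).
apply/linear_boundedP; near=> r => v /=; rewrite (le_trans (norm_mulmx_le _ _))// ler_wpM2r//.
Unshelve. all: by end_near. Qed.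

Lemma diff_coord (V : normedModType R) q (F : V -> 'rV[R]_q) x j :
  differentiable F x ->
  differentiable (fun y => F y 0 j) x /\
  forall v, 'd (fun y => F y 0 j) x v = 'd F x v 0 j.
Proof.
move=> dF.
have @l : {linear 'rV[R]_q -> R}.
  by exists (fun N : 'rV[R]_q => N 0 j); do 2![eexists]; do ?[constructor];
     rewrite ?mxE// => ? *; rewrite ?mxE//; move=> ?; rewrite !mxE.
have lc : continuous l by exact: coord_continuous.
have dl : differentiable l (F x) by exact/linear_differentiable.
rewrite (_ : (fun y => _) = l \o F)//; split.
  exact: differentiable_comp.
move=> v; rewrite diff_comp//.
exact: (congr1 (fun k : _ -> _ => k ('d F x v)) (diff_lin (F x) lc)).
Qed.

Lemma diff_of_jac m n (f : 'rV[R]_m -> 'rV[R]_n) x (A : 'M[R]_(m, n)) :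
  (forall e : R, 0 < e ->
    \forall y \near x, `|f y - f x - (y - x) *m A| <= e * `|y - x|) ->
  differentiable f x /\ forall v, 'd f x v = v *m A.
Proof.
move=> H; have [] := @diff_of_eps _ _ f (mulmxr A) x _ H.
  exact: mulmx_continuous.
by move=> df dE; split => // v; rewrite dE.
Qed.

Lemma diffJ m n (f : 'rV[R]_m -> 'rV[R]_n) x v : 'd f x v = v *m 'J f x.
Proof. by rewrite /jacobian mul_rV_lin1. Qed.

Lemma jacobianE m n (f : 'rV[R]_m -> 'rV[R]_n) x i j :
  'J f x i j = 'd f x (delta_mx 0 i) 0 j.
Proof. by rewrite diffJ -rowE [RHS]mxE. Qed.

(** A column contributes [m] terms, and [m.+1] avoids a zero divisor; entrywise continuity of a
    Jacobian becomes a bound on its action. *)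
Lemma norm_mulmx_le_unif m n (v : 'rV[R]_m) (A : 'M[R]_(m, n)) (e : R) :
  0 <= e -> (forall i j, `|A i j| <= e / (m.+1)%:R) -> `|v *m A| <= e * `|v|.
Proof.
move=> e0 Ae; apply: norm_rV_le => [|j]; first by rewrite mulr_ge0.
rewrite mxE (le_trans (ler_norm_sum _ _ _))//.
apply: (@le_trans _ _ (\sum_(i < m) (`|v| * (e / m.+1%:R)))).
  by apply: ler_sum => i _; rewrite normrM ler_pM//; exact: norm_coord_le.
rewrite sumr_const card_ord -mulrnAr mulrC ler_wpM2r// -[X in X <= _]mulr_natr.
rewrite mulrAC ler_pdivrMr// ler_wpM2l// ler_nat//.
Qed.

Lemma C1_on_diff p q (X : set 'rV[R]_p) (f : 'rV[R]_p -> 'rV[R]_q) x :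
  C1_on X f -> X x -> differentiable f x.
Proof. by move=> [df _] /df. Qed.

Lemma C1_on_continuous p q (X : set 'rV[R]_p) (f : 'rV[R]_p -> 'rV[R]_q) x v :
  open X -> C1_on X f -> X x -> {for x, continuous (fun x => 'd f x v)}.
Proof.
move=> oX [_ /(_ v)]; rewrite continuous_open_subspace// => H Xx.
by apply: H; rewrite inE.
Qed.

Lemma C1_on_jacobian_continuous p q (X : set 'rV[R]_p) (f : 'rV[R]_p -> 'rV[R]_q) x i j :
  open X -> C1_on X f -> X x -> {for x, continuous (fun x => 'J f x i j)}.
Proof.
move=> oX C1 Xx; rewrite (_ : (fun x => _) =
    (fun M : 'rV_q => M 0 j) \o (fun x => 'd f x (delta_mx 0 i))); last first.
  by apply/funext => y /=; rewrite jacobianE.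
by apply: continuous_comp; [exact: C1_on_continuous oX C1 Xx|exact: continuous_coord_rV].
Qed.

(** The scalar mean value theorem is applied to each coordinate of [f (c t) - t (x - y) A] on
    [[0, 1]]; for the sup norm every coordinate may have its own intermediate point. *)
Lemma segment_mean_value p q (f : 'rV[R]_p -> 'rV[R]_q) (A : 'M[R]_(p, q)) x y (e : R) :
  0 <= e ->
  (forall t : R, 0 <= t <= 1 ->
    differentiable f (y + t *: (x - y)) /\
    forall v, `|'d f (y + t *: (x - y)) v - v *m A| <= e * `|v|) ->
  `|f x - f y - (x - y) *m A| <= e * `|x - y|.
Proof.
move=> e0 H; apply: norm_rV_le => [|j]; first by rewrite mulr_ge0.
pose c (t : R) := y + t *: (x - y).
pose g (t : R) := f (c t) 0 j - t * ((x - y) *m A) 0 j.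
pose dg (t : R) : R := ('d f (c t) (x - y) - (x - y) *m A) 0 j.
have dgP (t : R) : 0 <= t <= 1 -> is_derive t 1 g (dg t).
  move=> /H[df _].
  have dc : is_diff t c (fun s => s *: (x - y)).
    have -> : c = cst y + (fun s : R => s *: (x - y)) by apply/funext.
    apply: is_diff_eq (is_diffD (is_diff_cst y t) (is_diff_scalel t (x - y))) _.
    by apply/funext => s /=; rewrite -[LHS]/(0 + _) add0r.
  have dfc : differentiable (f \o c) t by apply: differentiable_comp; [exact: ex_diff|].
  have [dG dGE] := diff_coord j dfc.
  have dg1 : is_derive t 1 (fun s => f (c s) 0 j) ('d f (c t) (x - y) 0 j).
    apply: DeriveDef; first exact: diff_derivable.
    have dcd : differentiable c t by exact: ex_diff.
    rewrite deriveE// dGE diff_comp//.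
    have dcE : 'd c t 1 = x - y.
      by rewrite -[RHS]scale1r; exact: (congr1 (fun k : _ -> _ => k 1) diff_val).
    by rewrite -dcE.
  pose k := ((x - y) *m A) 0 j.
  rewrite (_ : g = (fun s => f (c s) 0 j) - (k \*: (@id R))); last first.
    by apply/funext => s; rewrite /g mulrC.
  apply: is_derive_eq (is_deriveB dg1 (is_deriveZ k (is_derive_id t 1))) _.
  by rewrite /dg /k -[_ *: _]/(_ * _) mulr1 !mxE.
have cg : {within `[0, 1], continuous g}.
  apply: derivable_within_continuous => t; rewrite in_itv/= => /dgP dgt.
  exact: ex_derive.
have [t] := @MVT_segment R g dg 0 1 ler01 (fun t ht => dgP t (ltac:(
  by move: ht; rewrite in_itv/= => /andP[/ltW -> /ltW ->]))) cg.
rewrite in_itv/= subr0 mulr1 => t01 gE.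
have -> : (f x - f y - (x - y) *m A) 0 j = dg t.
  rewrite -gE /g /c scale1r scale0r addr0 mul1r mul0r subr0 [y + (x - y)]addrC subrK.
  by rewrite !mxE; ring.
by rewrite (le_trans (norm_coord_le _ _))//; have [_] := H t t01; apply.
Qed.

Lemma mxBE m n (A B : 'M[R]_(m, n)) i j : (A - B) i j = A i j - B i j.
Proof. by rewrite !mxE. Qed.

(** Strict differentiability: the Jacobian varies by at most [e] on a small ball, and balls are
    convex, so the mean value inequality along segments compares [f] with its differential at the
    centre. *)
Lemma C1_on_strict p q (X : set 'rV[R]_p) (f : 'rV[R]_p -> 'rV[R]_q) x0 (e : R) :
  open X -> C1_on X f -> X x0 -> 0 < e ->
  exists d : R, [/\ 0 < d, ball x0 d `<=` X,
    (forall x (v : 'rV[R]_p), ball x0 d x -> `|v *m 'J f x - v *m 'J f x0| <= e * `|v|) &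
    (forall x y, ball x0 d x -> ball x0 d y ->
      `|f x - f y - (x - y) *m 'J f x0| <= e * `|x - y|)].
Proof.
move=> oX C1 Xx0 e0.
have ep : 0 < e / p.+1%:R by rewrite divr_gt0.
have nX : \forall x \near x0, X x by move: oX; rewrite openE => /(_ _ Xx0).
pose Q (ij : 'I_p * 'I_q) x := `|'J f x ij.1 ij.2 - 'J f x0 ij.1 ij.2| <= e / p.+1%:R.
have nJ : \forall x \near x0, forall ij, Q ij x.
  apply: (@filter_forall _ _ Q (nbhs x0) (nbhs_filter x0)) => -[i j].
  have /cvgrPdist_le/(_ _ ep) := C1_on_jacobian_continuous (i := i) (j := j) oX C1 Xx0.
  apply: (@filterS _ (nbhs x0) (nbhs_filter x0)) => x /= H.
  by rewrite /Q distrC; exact: H.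
have /nbhs_ballP[d /= d0 dP] : nbhs x0 (X `&` [set x | forall ij, Q ij x]).
  by apply: (@filterI _ (nbhs x0) (nbhs_filter x0)).
have dX : ball x0 d `<=` X by move=> x /dP[].
have dJ x (v : 'rV[R]_p) : ball x0 d x -> `|v *m 'J f x - v *m 'J f x0| <= e * `|v|.
  move=> /dP[_ xJ]; rewrite -mulmxBr; apply: norm_mulmx_le_unif; first exact: ltW.
  by move=> i j; rewrite mxBE; exact: (xJ (i, j)).
exists d; split => // x y xd yd; apply: segment_mean_value; first exact: ltW.
move=> t /andP[t_ge0 t_le1].
have td : ball x0 d (y + t *: (x - y)).
  move: xd yd; rewrite -ball_normE /= => xd yd.
  have -> : x0 - (y + t *: (x - y)) = (1 - t) *: (x0 - y) + t *: (x0 - x).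
    by apply/rowP => i; rewrite !mxE; ring.
  rewrite (le_lt_trans (ler_normD _ _))// !normrZ ger0_norm ?subr_ge0// ger0_norm//.
  (* The strict inequality is carried by the term in [t], hence the separate case [t = 0]. *)
  have [->|t_neq0] := eqVneq t 0; first by rewrite subr0 mul1r mul0r addr0.
  have t_gt0 : 0 < t by rewrite lt0r t_neq0.
  have -> : d = (1 - t) * d + t * d by ring.
  apply: ler_ltD; first by rewrite ler_wpM2l ?subr_ge0// ltW.
  by rewrite ltr_pM2l.
split => [|v]; first exact: C1_on_diff C1 (dX _ td).
by rewrite diffJ; exact: dJ.
Qed.

End differential.

(** * Classes of functions closed under ring operations *)

Section ring_closed_class.
Context {R : realType} {T : Type}.
Implicit Types Q : (T -> R) -> Prop.

(* Continuity and C^1 regularity of determinants, products and adjugates of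
   matrices follow alike from closure under the ring operations. *)
Definition ring_closed Q := [/\ forall c, Q (fun=> c),
  forall f g, Q f -> Q g -> Q (fun x => f x + g x) &
  forall f g, Q f -> Q g -> Q (fun x => f x * g x)].

Lemma ring_closed_sum Q I (r : seq I) (P : pred I) (F : I -> T -> R) :
  ring_closed Q -> (forall i, Q (F i)) -> Q (fun x => \sum_(i <- r | P i) F i x).
Proof.
move=> [Qc QD _] QF; elim: r => [|i r IHr].
  by rewrite (_ : (fun x => _) = fun=> 0)//; apply/funext => x; rewrite big_nil.
rewrite (_ : (fun x => _) = fun x => (if P i then F i x else 0) +
    \sum_(i <- r | P i) F i x); last first.
  by apply/funext => x; rewrite big_cons; case: ifP; rewrite ?add0r.
by apply: (QD _ _ _ IHr); case: (P i).
Qed.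

Lemma ring_closed_prod Q I (r : seq I) (F : I -> T -> R) :
  ring_closed Q -> (forall i, Q (F i)) -> Q (fun x => \prod_(i <- r) F i x).
Proof.
move=> [Qc _ QM] QF; elim: r => [|i r IHr].
  by rewrite (_ : (fun x => _) = fun=> 1)//; apply/funext => x; rewrite big_nil.
rewrite (_ : (fun x => _) = fun x => F i x * \prod_(i <- r) F i x); last first.
  by apply/funext => x; rewrite big_cons.
exact: QM.
Qed.

Lemma ring_closed_det Q n (A : T -> 'M[R]_n) : ring_closed Q ->
  (forall i j, Q (fun x => A x i j)) -> Q (fun x => \det (A x)).
Proof.
move=> Qr QA; rewrite /determinant; apply: ring_closed_sum => // s.
have [Qc _ QM] := Qr; apply: QM => //.
by apply: ring_closed_prod.
Qed.

Lemma ring_closed_adj Q n (A : T -> 'M[R]_n) : ring_closed Q ->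
  (forall i j, Q (fun x => A x i j)) -> forall i j, Q (fun x => \adj (A x) i j).
Proof.
move=> Qr QA i j; have [Qc _ QM] := Qr.
rewrite (_ : (fun x => _) = fun x => (-1) ^+ (j + i) *
    \det (row' j (col' i (A x)))); last by apply/funext => x; rewrite mxE.
apply: QM => //; apply: ring_closed_det => // k l.
rewrite (_ : (fun x => _) = fun x => A x (lift j k) (lift i l)) //.
by apply/funext => x; rewrite !mxE.
Qed.

Lemma ring_closed_mulmx Q m n p (A : T -> 'M[R]_(m, n)) (B : T -> 'M[R]_(n, p)) :
  ring_closed Q -> (forall i j, Q (fun x => A x i j)) ->
  (forall i j, Q (fun x => B x i j)) -> forall i j, Q (fun x => (A x *m B x) i j).
Proof.
move=> Qr QA QB i j; have [_ _ QM] := Qr.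
rewrite (_ : (fun x => _) = fun x => \sum_k A x i k * B x k j).
  by apply: ring_closed_sum => // k; exact: QM.
by apply/funext => x; rewrite mxE.
Qed.

Lemma ring_closed_addmx Q m n (A B : T -> 'M[R]_(m, n)) :
  ring_closed Q -> (forall i j, Q (fun x => A x i j)) ->
  (forall i j, Q (fun x => B x i j)) -> forall i j, Q (fun x => (A x + B x) i j).
Proof.
move=> [_ QD _] QA QB i j.
rewrite (_ : (fun x => _) = fun x => A x i j + B x i j); first exact: QD.
by apply/funext => x; rewrite mxE.
Qed.

Lemma ring_closed_cst Q m n (A : 'M[R]_(m, n)) : ring_closed Q ->
  forall i j, Q (fun=> A i j).
Proof. by move=> [Qc _ _] i j; exact: Qc. Qed.

End ring_closed_class.

(** * Continuity and C^1 regularity of real functions on open sets *)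

Section regular_functions.
Context {R : realType}.

(** Continuity in the ambient topology at the points of [U]. For open [U] it agrees with continuity
    within [U] and avoids the subspace topology. *)
Definition cont_on (T : topologicalType) (U : set T) (f : T -> R) :=
  forall x, U x -> {for x, continuous f}.

Lemma cont_on_ring_closed (T : topologicalType) (U : set T) :
  ring_closed (@cont_on T U).
Proof.
split => [c x _|f g cf cg x Ux|f g cf cg x Ux]; first exact: cst_continuous.
  by apply: (@continuousD _ _ _ f g); [exact: cf|exact: cg].
by apply: (@continuousM _ _ f g); [exact: cf|exact: cg].
Qed.

Lemma near_eq_continuous (T S : topologicalType) (f g : T -> S) x :
  (\forall y \near x, f y = g y) -> {for x, continuous f} -> {for x, continuous g}.
Proof.
move=> fg cf; have fgx := nbhs_singleton fg.
rewrite /prop_for /continuous_at -fgx.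
apply: cvg_trans cf; apply: near_eq_cvg.
by apply: (@filterS _ (nbhs x) (nbhs_filter x) _ _ _ fg) => y ->.
Qed.

Lemma open_near (T : topologicalType) (U : set T) x : open U -> U x ->
  \forall y \near x, U y.
Proof. by rewrite openE => oU Ux; exact: (oU _ Ux). Qed.

Lemma eq_on_continuous (T S : topologicalType) (U : set T) (f g : T -> S) x :
  open U -> U x -> {in U, f =1 g} -> {for x, continuous f} -> {for x, continuous g}.
Proof.
move=> oU Ux fg; apply: near_eq_continuous.
apply: (@filterS _ (nbhs x) (nbhs_filter x) _ _ _ (open_near oU Ux)) => y Uy.
by apply: fg; rewrite inE.
Qed.

Lemma continuous_rV (T : topologicalType) n (F : T -> 'rV[R]_n) x :
  (forall i, {for x, continuous (fun y => F y 0 i)}) -> {for x, continuous F}.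
Proof.
move=> cF; apply/cvgrPdist_le => e e0.
pose Q (i : 'I_n) y := `|F x 0 i - F y 0 i| <= e.
have H : \forall y \near x, forall i, Q i y.
  apply: (@filter_forall _ _ Q (nbhs x) (nbhs_filter x)) => i.
  by have /cvgrPdist_le/(_ _ e0) := cF i.
apply: (@filterS _ (nbhs x) (nbhs_filter x) _ _ _ H) => y Hy.
by apply: norm_rV_le => [|i]; [exact: ltW|rewrite mxBE; exact: Hy].
Qed.

Context {k : nat}.
Implicit Types (U : set 'rV[R]_k) (f g : 'rV[R]_k -> R).

(** The scalar counterpart of [C1_on], for which products and inverses make sense. *)
Definition C1s U f := (forall x, U x -> differentiable f x) /\
  (forall v, cont_on U (fun x => 'd f x v)).

Lemma C1s_ring_closed U : open U -> ring_closed (C1s U).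
Proof.
move=> oU; split.
- move=> c; split => [x _|v x Ux]; first exact: differentiable_cst.
  apply: (@eq_on_continuous _ _ U (fun=> 0)) => //; last exact: cst_continuous.
  by move=> y _; rewrite diff_cst.
- move=> f g [df cf] [dg cg]; split => [x Ux|v x Ux].
    by apply: (@differentiableD _ _ _ f g); [exact: df|exact: dg].
  apply: (@eq_on_continuous _ _ U (fun y => 'd f y v + 'd g y v)) => //.
    move=> y; rewrite inE => Uy.
    exact/esym/(congr1 (fun k : _ -> _ => k v) (diffD (df _ Uy) (dg _ Uy))).
  by apply: (@continuousD _ _ _ (fun y => 'd f y v)); [exact: cf|exact: cg].
- move=> f g [df cf] [dg cg]; split => [x Ux|v x Ux].
    by apply: (@differentiableM _ _ f g); [exact: df|exact: dg].
  apply: (@eq_on_continuous _ _ U (fun y => f y * 'd g y v + g y * 'd f y v)) => //.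
    move=> y; rewrite inE => Uy.
    exact/esym/(congr1 (fun k : _ -> _ => k v) (diffM (df _ Uy) (dg _ Uy))).
  apply: (@continuousD _ _ _ (fun y => f y * 'd g y v)).
    apply: (@continuousM _ _ f); last exact: cg.
    exact: (differentiable_continuous (df _ Ux)).
  apply: (@continuousM _ _ g); last exact: cf.
  exact: (differentiable_continuous (dg _ Ux)).
Qed.

Lemma C1s_inv U f : open U -> C1s U f -> (forall x, U x -> f x != 0) ->
  C1s U (fun x => (f x)^-1).
Proof.
move=> oU [df cf] f0; split => [x Ux|v x Ux].
  by apply: (@differentiableV _ _ f); [exact: df|exact: f0].
apply: (@eq_on_continuous _ _ U (fun y => - (f y)^-2 * 'd f y v)) => //.
  move=> y; rewrite inE => Uy.
  exact/esym/(congr1 (fun k : _ -> _ => k v) (diffV (df _ Uy) (f0 _ Uy))).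
apply: (@continuousM _ _ (fun y => - (f y)^-2)); last exact: cf.
have cfx : {for x, continuous f} by exact: (differentiable_continuous (df _ Ux)).
apply: (@continuousN _ _ _ (fun y => (f y)^-2)).
apply: (@continuousV _ _ (fun y => f y ^+ 2)); first by rewrite expf_neq0// f0.
exact: (@continuousM _ _ f f).
Qed.

Lemma eq_on_C1s U f g : open U -> {in U, f =1 g} -> C1s U f -> C1s U g.
Proof.
move=> oU fg [df cf].
have H x : U x -> differentiable g x /\ 'd g x = 'd f x :> (_ -> _).
  move=> Ux; apply: near_eq_diff (df _ Ux).
  apply: (@filterS _ (nbhs x) (nbhs_filter x) _ _ _ (open_near oU Ux)) => y Uy.
  by apply: fg; rewrite inE.
split => [x /H[]//|v x Ux].
apply: (@eq_on_continuous _ _ U (fun y => 'd f y v)) => //; last exact: cf.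
by move=> y; rewrite inE => /H[_ ->].
Qed.

Lemma C1_on_coord q U (F : 'rV[R]_k -> 'rV[R]_q) j : open U -> C1_on U F ->
  C1s U (fun x => F x 0 j).
Proof.
move=> oU C1F; have [dF cF] := C1F.
split => [x Ux|v x Ux]; first by have [] := diff_coord j (dF _ Ux).
apply: (@eq_on_continuous _ _ U (fun y => 'd F y v 0 j)) => //.
  by move=> y; rewrite inE => Uy; have [_ ->] := diff_coord j (dF _ Uy).
apply: (@continuous_comp _ _ _ (fun y => 'd F y v) (fun w : 'rV[R]_q => w 0 j)).
  exact: C1_on_continuous oU C1F Ux.
exact: continuous_coord_rV.
Qed.

(** The candidate differential has those of the coordinates as its columns; the finitely many
    coordinate estimates hold on a common neighborhood. *)
Lemma coord_C1_on q U (F : 'rV[R]_k -> 'rV[R]_q) : open U ->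
  (forall j, C1s U (fun x => F x 0 j)) -> C1_on U F.
Proof.
move=> oU CF.
have H x : U x -> differentiable F x /\
    forall v, 'd F x v = v *m \matrix_(i, j) 'd (fun x => F x 0 j) x (delta_mx 0 i).
  move=> Ux; apply: diff_of_jac => e e0.
  pose Q (j : 'I_q) y := `|F y 0 j - F x 0 j - 'd (fun x => F x 0 j) x (y - x)| <= e * `|y - x|.
  have HQ : \forall y \near x, forall j, Q j y.
    apply: (@filter_forall _ _ Q (nbhs x) (nbhs_filter x)) => j.
    by have := diff_eps ((CF j).1 x Ux) e0.
  apply: (@filterS _ (nbhs x) (nbhs_filter x) _ _ _ HQ) => y Hy.
  apply: norm_rV_le => [|j]; first by rewrite mulr_ge0// ltW.
  have := Hy j; rewrite /Q; congr (`|_| <= _).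
  rewrite !mxBE; congr (_ - _); rewrite mxE.
  rewrite {1}[y - x]row_sum_delta linear_sum; apply: eq_bigr => i _.
  by rewrite linearZ -[LHS]/(_ * _); congr (_ * _); rewrite [RHS]mxE.
split => [x /H[]//|v]; rewrite continuous_open_subspace// => x; rewrite inE => Ux.
apply: continuous_rV => j.
apply: (@eq_on_continuous _ _ U (fun y => 'd (fun x => F x 0 j) y v)) => //.
  move=> y; rewrite inE => Uy.
  by have [dF _] := H _ Uy; have [_ ->] := diff_coord j dF.
exact: (CF j).2.
Qed.

End regular_functions.

(** * Gram determinants and complements of a kernel *)

Section linear_algebra.
Context {R : realType}.

(** The quadratic form [v A A^T v^T] is the sum of the squares of the entries of [v *m A]. *)
Lemma mulmx_tr_ge0 m n (A : 'M[R]_(m, n)) (v : 'rV[R]_m) :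
  0 <= (v *m (A *m A^T) *m v^T) 0 0 ?= iff (v *m A == 0).
Proof.
have -> : v *m (A *m A^T) *m v^T = (v *m A) *m (v *m A)^T.
  by rewrite trmx_mul !mulmxA.
move: (v *m A) => w; split; first by rewrite mxE sumr_ge0// => i _; rewrite mxE -expr2 sqr_ge0.
apply/eqP/eqP => [|->]; last by rewrite mul0mx mxE.
rewrite mxE => /esym/eqP; rewrite psumr_eq0; last by move=> i _; rewrite mxE -expr2 sqr_ge0.
move=> /allP H; apply/rowP => i; have := H i (mem_index_enum _).
by rewrite mxE -expr2 sqrf_eq0 => /eqP ->; rewrite mxE.
Qed.

(* The segment from the identity to A consists of positive definite, hence
   nonsingular, matrices: the determinant keeps its sign along it. *)
Lemma posdef_det_gt0 n (A : 'M[R]_n) :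
  (forall v : 'rV[R]_n, v != 0 -> 0 < (v *m A *m v^T) 0 0) -> 0 < \det A.
Proof.
move=> A_gt0; rewrite ltNge; apply/negP => detA.
pose B (t : R) := t%:M + (1 - t) *: A.
have cB : {within `[0, 1], continuous (fun t => \det (B t))}.
  apply: continuous_subspaceT => t.
  have Qr := @cont_on_ring_closed R R setT; have [Qc QD QM] := Qr.
  apply: (ring_closed_det Qr) => // i j.
  rewrite (_ : (fun x => _) = fun x : R => x * (i == j)%:R + (1 + (-1) * x) * A i j).
    have Qid : @cont_on R R setT id by move=> x _; exact: cvg_id.
    apply: (QD (fun x => x * (i == j)%:R) (fun x => (1 + (-1) * x) * A i j)).
      exact: (QM id).
    apply: (QM (fun x => 1 + (-1) * x)) => //; apply: (QD (fun=> 1)) => //.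
    exact: (QM (fun=> -1) id).
  by apply/funext => x; rewrite !mxE mulr_natr mulN1r.
have [|t] := @IVT R (fun t => \det (B t)) 0 1 0 ler01 cB.
  rewrite /B subr0 subrr scale0r addr0 scale1r det1 raddf0 add0r.
  by rewrite ge_min detA/= le_max ler01 orbT.
rewrite in_itv/= => /andP[t0 t1] /eqP; rewrite -[_ == 0]negbK -unitfE -unitmxE.
move=> /negP; apply; rewrite -row_free_unit; apply: inj_row_free => v vB.
apply/eqP; apply: contraT => v0.
have : 0 < (v *m B t *m v^T) 0 0; last by rewrite vB mul0mx mxE ltxx.
have -> : (v *m B t *m v^T) 0 0 = t * (v *m v^T) 0 0 + (1 - t) * (v *m A *m v^T) 0 0.
  rewrite /B mulmxDr mul_mx_scalar -scalemxAr mulmxDl -!scalemxAl.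
  by rewrite [LHS]mxE [X in X + _]mxE [X in _ + X]mxE.
have vv : 0 < (v *m v^T) 0 0.
  have [h1 h2] := mulmx_tr_ge0 (1%:M : 'M[R]_n) v.
  rewrite trmx1 !mulmx1 in h1 h2.
  by rewrite lt_def h1 andbT eq_sym h2.
have vA := A_gt0 _ v0.
have [->|tn0] := eqVneq t 0; first by rewrite mul0r add0r subr0 mul1r.
apply: ltr_pwDl; first by rewrite mulr_gt0// lt0r tn0.
by rewrite mulr_ge0 ?subr_ge0// ltW.
Qed.

Lemma det_gram_gt0 m n (A : 'M[R]_(m, n)) :
  (forall v : 'rV[R]_m, v *m A = 0 -> v = 0) -> 0 < \det (A *m A^T).
Proof.
move=> Ainj; apply: posdef_det_gt0 => v v0.
have [h1 h2] := mulmx_tr_ge0 A v.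
rewrite lt_def h1 andbT eq_sym h2; apply: contra v0 => /eqP/Ainj ->.
by rewrite eqxx.
Qed.

(** The rows of [K] are a basis of the kernel, those of [S] are preimages of the standard basis.
    Applying [J] to a vanishing combination kills first the part along [S], then freeness of [K]
    kills the rest. *)
Lemma surjective_complement k n (J : 'M[R]_(k + n, n)) :
  (forall y, exists v : 'rV[R]_(k + n), v *m J = y) ->
  exists (K : 'M[R]_(k, k + n)) (S : 'M[R]_(n, k + n)),
    [/\ K *m J = 0, S *m J = 1%:M & col_mx K S \in unitmx].
Proof.
move=> Jsurj.
have /choice[s sP] : forall i : 'I_n, exists v : 'rV[R]_(k + n), v *m J = delta_mx 0 i.
  by move=> i; exact: Jsurj.
pose S : 'M[R]_(n, k + n) := \matrix_i s i.
have SJ : S *m J = 1%:M.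
  apply/row_matrixP => i; rewrite row_mul rowK sP.
  by apply/rowP => j; rewrite !mxE eqxx [i == _]eq_sym.
have rJ : \rank J = n.
  apply/eqP; rewrite eqn_leq rank_leq_col /= -{1}(mxrank1 R n) -SJ.
  exact: mxrankM_maxr.
have rK : \rank (kermx J) = k by rewrite mxrank_ker rJ addnK.
have [K [KJ Kfree]] : exists K : 'M[R]_(k, k + n), K *m J = 0 /\ row_free K.
  (* [row_base] has [\rank (kermx J)] rows, equal to [k] only through [rK]. The ambient dimension
     mentions [k], so it is generalized before that equation is destructed. *)
  move: (k + n)%N J {Jsurj s sP S SJ rJ} rK => d J rK.
  case: _ / rK; exists (row_base (kermx J)); split; last exact: row_base_free.
  by apply/sub_kermxP; rewrite eq_row_base.
exists K, S; split => //; rewrite -row_free_unit; apply: inj_row_free => w.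
rewrite -[w]hsubmxK mul_row_col => w0.
have r0 : rsubmx w = 0.
  have := congr1 (mulmx^~ J) w0.
  by rewrite /= mulmxDl -!mulmxA KJ SJ mulmx0 mulmx1 add0r mul0mx.
move: w0; rewrite r0 mul0mx addr0 => w0.
suff -> : lsubmx w = 0 by rewrite row_mx0.
by apply: (row_free_inj Kfree); rewrite w0 mul0mx.
Qed.

(* With C = (Phi ; J^T) one has (Phi ; S) C^T = (g 0 ; * E) and
   C C^T = (g 0 ; * J^T J), while det (Phi ; S) = det T. *)
Lemma det_graph k n (K : 'M[R]_(k, k + n)) (S : 'M[R]_(n, k + n)) (Z : 'M[R]_(k, n))
    (J : 'M[R]_(k + n, n)) :
  col_mx K S \in unitmx -> S *m J \in unitmx -> (K + Z *m S) *m J = 0 ->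
  0 < \det (J^T *m J) /\
  `|\det (col_mx K S)| / `|\det (S *m J)| =
  Num.sqrt (\det ((K + Z *m S) *m (K + Z *m S)^T)) / Num.sqrt (\det (J^T *m J)).
Proof.
set Phi := K + Z *m S => uT uE PhiJ.
have T'E : col_mx Phi S = block_mx 1%:M Z 0 1%:M *m col_mx K S.
  by rewrite mul_block_col !mul1mx mul0mx add0r.
have uT' : col_mx Phi S \in unitmx.
  by rewrite T'E unitmx_mul uT andbT unitmxE det_ublock !det1 mulr1 unitr1.
have dT' : \det (col_mx Phi S) = \det (col_mx K S).
  by rewrite T'E det_mulmx det_ublock !det1 !mul1r.
have j_gt0 : 0 < \det (J^T *m J).
  rewrite -{2}[J]trmxK; apply: det_gram_gt0 => v vJ.
  have : v *m (S *m J)^T = 0 by rewrite trmx_mul mulmxA vJ mul0mx.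
  move=> /(congr1 (mulmx^~ (invmx (S *m J)^T))).
  by rewrite /= mulmxK ?unitmx_tr// mul0mx.
have g_gt0 : 0 < \det (Phi *m Phi^T).
  apply: det_gram_gt0 => v vPhi.
  have : row_mx v 0 *m col_mx Phi S = 0 by rewrite mul_row_col vPhi mul0mx addr0.
  move=> /(congr1 (mulmx^~ (invmx (col_mx Phi S)))).
  rewrite /= mulmxK// mul0mx => /(congr1 lsubmx).
  by rewrite row_mxKl linear0.
have e0 : \det (S *m J) != 0 by rewrite -unitfE -unitmxE.
have JP : J^T *m Phi^T = 0 by rewrite -trmx_mul PhiJ trmx0.
have E1 : \det (col_mx K S) * \det (row_mx Phi^T J) = \det (Phi *m Phi^T) * \det (S *m J).
  by rewrite -dT' -det_mulmx mul_col_row PhiJ det_lblock.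
have E2 : \det (row_mx Phi^T J) ^+ 2 = \det (Phi *m Phi^T) * \det (J^T *m J).
  rewrite expr2 -{1}det_tr tr_row_mx trmxK -det_mulmx mul_col_row PhiJ.
  by rewrite det_lblock.
split => //.
have -> : \det (Phi *m Phi^T) = (\det (col_mx K S) / \det (S *m J)) ^+ 2 * \det (J^T *m J).
  apply: (mulfI (lt0r_neq0 g_gt0)).
  have -> : \det (Phi *m Phi^T) * ((\det (col_mx K S) / \det (S *m J)) ^+ 2 * \det (J^T *m J))
      = (\det (col_mx K S) * \det (row_mx Phi^T J) / \det (S *m J)) ^+ 2.
    rewrite mulrCA -E2 -exprMn; congr (_ ^+ 2); by rewrite mulrAC.
  by rewrite E1 mulfK// expr2.
rewrite sqrtrM ?sqr_ge0// sqrtr_sqr normrM normfV mulfK//.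
by rewrite sqrtr_eq0 -ltNge.
Qed.

End linear_algebra.

Lemma continuous_of_dist {R : realType} (T : topologicalType) (V : normedModType R)
    (f : T -> V) x : (forall e : R, 0 < e -> \forall y \near x, `|f x - f y| <= e) ->
  {for x, continuous f}.
Proof. by move=> H; apply/cvgrPdist_le. Qed.

Lemma compact_norm_le {R : realType} n (r : R) : 0 <= r ->
  compact [set w : 'rV[R]_n | `|w| <= r].
Proof.
move=> r0; have -> : [set w : 'rV[R]_n | `|w| <= r] =
    [set w : 'rV[R]_n | forall i, `[- r, r]%classic (w ord0 i)].
  apply/seteqP; split => w /= wr.
    by move=> i; rewrite in_itv/= -ler_norml; exact: le_trans (norm_coord_le _ _) wr.
  apply: norm_rV_le => // i.
  by have := wr i; rewrite in_itv/= -ler_norml.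
apply: (@rV_compact R n (fun=> `[- r, r]%classic)) => i.
exact: segment_compact.
Qed.

(** * The implicit function theorem in affine coordinates, with C^2 regularity of the graph *)

Section graph_chart.
Context {R : realType} {k n : nat}.
Variables (X : set 'rV[R]_(k + n)) (h : 'rV[R]_(k + n) -> 'rV[R]_n).
Variables (x0 : 'rV[R]_(k + n)) (K : 'M[R]_(k, k + n)) (S : 'M[R]_(n, k + n)).
Hypotheses (oX : open X) (hC1 : C1_on X h) (Xx0 : X x0) (hx0 : h x0 = 0).
Hypotheses (KJ : K *m 'J h x0 = 0) (SJ : S *m 'J h x0 = 1%:M).
Hypothesis uT : col_mx K S \in unitmx.

(* Affine coordinates at x0: the rows of K span the kernel of the differential,
   those of S a complement of it. Near x0 the zero set is a graph w = z u. *)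
Definition pt (u : 'rV[R]_k) (w : 'rV[R]_n) : 'rV[R]_(k + n) :=
  u *m K + w *m S + x0.

Lemma ptE u w : pt u w = row_mx u w *m col_mx K S + x0.
Proof. by rewrite mul_row_col. Qed.

Lemma ptB u w u' w' : pt u w - pt u' w' = (u - u') *m K + (w - w') *m S.
Proof.
by rewrite /pt !mulmxBl; apply/rowP => i; rewrite !mxE; ring.
Qed.

(** A Lipschitz constant of [pt]. The extra 1 makes it positive and, through [norm_dir_le], sends
    closed boxes into open balls. *)
Definition dir_bound : R := mxsum K + mxsum S + 1.

Lemma dir_bound_gt0 : 0 < dir_bound.
Proof. by rewrite ltr_wpDl// addr_ge0// mxsum_ge0. Qed.

Lemma norm_dir_le (u : 'rV[R]_k) (w : 'rV[R]_n) (m : R) : `|u| <= m -> `|w| <= m ->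
  `|u *m K + w *m S| <= (dir_bound - 1) * m.
Proof.
move=> um wm; rewrite (le_trans (ler_normD _ _))// /dir_bound addrK mulrDl.
apply: lerD; apply: le_trans (norm_mulmx_le _ _) _.
  by rewrite ler_wpM2l ?mxsum_ge0.
by rewrite ler_wpM2l ?mxsum_ge0.
Qed.

Lemma norm_dir_le' (u : 'rV[R]_k) (w : 'rV[R]_n) (m : R) : `|u| <= m -> `|w| <= m ->
  `|u *m K + w *m S| <= dir_bound * m.
Proof.
move=> um wm; rewrite (le_trans (norm_dir_le um wm))// ler_wpM2r//.
  exact: le_trans um.
by rewrite gerBl.
Qed.

(** At [x0] the map [h (pt u w)] has differential [w]. Strict differentiability with constant
    [1 / (2 c)], where [c] is the Lipschitz constant of [pt], makes the remainder 1/2-Lipschitz; the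
    same constant gives [|v| <= |v| / 2] for any [v] killed by [S *m 'J h (pt u w)]. *)
Lemma slice_estimates : exists r : R, [/\ 0 < r,
  forall u w, `|u| <= r -> `|w| <= r -> X (pt u w),
  forall u w u' w', `|u| <= r -> `|w| <= r -> `|u'| <= r -> `|w'| <= r ->
    `|h (pt u w) - h (pt u' w') - (w - w')| <= 1 / 2 * Num.max `|u - u'| `|w - w'| &
  forall u w, `|u| <= r -> `|w| <= r -> S *m 'J h (pt u w) \in unitmx].
Proof.
have c0 := dir_bound_gt0; set c := dir_bound in c0 *.
have e0 : 0 < 1 / (2 * c) by rewrite divr_gt0// mulr_gt0.
have [d [d0 dX dJ dh]] := C1_on_strict oX hC1 Xx0 e0.
have r0 : 0 < d / c by rewrite divr_gt0.
have ptd u w : `|u| <= d / c -> `|w| <= d / c -> ball x0 d (pt u w).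
  move=> ur wr; rewrite -ball_normE /= /pt opprD addrCA subrr addr0 normrN.
  apply: (le_lt_trans (norm_dir_le ur wr)).
  by rewrite -/c mulrBl mul1r mulrC divfK ?gt_eqF// ltrBlDr ltrDl.
exists (d / c); split => //.
- by move=> u w ur wr; apply: dX; exact: ptd.
- move=> u w u' w' ur wr ur' wr'.
  have := dh _ _ (ptd _ _ ur wr) (ptd _ _ ur' wr').
  rewrite ptB mulmxDl -!mulmxA KJ SJ mulmx0 mulmx1 add0r => /le_trans; apply.
  have -> : 1 / 2 * Num.max `|u - u'| `|w - w'| =
     1 / (2 * c) * (c * Num.max `|u - u'| `|w - w'|) by field; rewrite gt_eqF.
  apply: ler_wpM2l; first exact: ltW.
  apply: norm_dir_le'.
    by rewrite le_max lexx.
  by rewrite le_max lexx orbT.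
- move=> u w ur wr; rewrite -row_free_unit; apply: inj_row_free => v vE.
  have vJ0 : v *m S *m 'J h x0 = v by rewrite -mulmxA SJ mulmx1.
  have vJ : v *m S *m 'J h (pt u w) = 0 by rewrite -mulmxA vE.
  have h1 : `|v *m S *m 'J h (pt u w) - v *m S *m 'J h x0| <=
    1 / (2 * c) * `|v *m S| by exact: dJ (ptd _ _ ur wr).
  have vJB : v *m S *m 'J h (pt u w) - v *m S *m 'J h x0 = - v.
    exact: etrans (congr2 (fun a b => a - b) vJ vJ0) (sub0r _).
  rewrite vJB normrN in h1.
  have h2 : `|v *m S| <= c * `|v|.
    by have := @norm_dir_le' 0 v `|v|; rewrite mul0mx add0r normr0; apply.
  have h3 : 1 / (2 * c) * `|v *m S| <= 1 / (2 * c) * (c * `|v|).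
    by apply: ler_wpM2l => //; exact: ltW.
  have h4 : 1 / (2 * c) * (c * `|v|) = 1 / 2 * `|v| by field; rewrite gt_eqF.
  have : `|v| <= 0 by lra.
  by rewrite normr_le0 => /eqP.
Qed.

Variable r : R.
Hypotheses (r0 : 0 < r) (ptX : forall u w, `|u| <= r -> `|w| <= r -> X (pt u w)).
Hypothesis hlip : forall u w u' w', `|u| <= r -> `|w| <= r -> `|u'| <= r -> `|w'| <= r ->
  `|h (pt u w) - h (pt u' w') - (w - w')| <= 1 / 2 * Num.max `|u - u'| `|w - w'|.
Hypothesis hunit : forall u w, `|u| <= r -> `|w| <= r -> S *m 'J h (pt u w) \in unitmx.

Lemma pt00 : pt 0 0 = x0.
Proof. by rewrite /pt !mul0mx !add0r. Qed.

Lemma norm0r m : `|0 : 'rV[R]_m| <= r.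
Proof. by rewrite normr0 ltW. Qed.

Lemma continuous_pt u : continuous (pt u).
Proof.
have -> : pt u = (fun=> u *m K) + (fun w : 'rV[R]_n => w *m S) + (fun=> x0).
  exact/funext.
move=> w; apply: continuousD; last exact: cst_continuous.
by apply: continuousD; [exact: cst_continuous|exact: mulmx_continuous].
Qed.

(** Instead of iterating a contraction, [|h (pt u w)|] is minimized over a compact ball. The minimum
    is attained in the interior, where a nonzero value [a] could be lowered by moving [w] along
    [- a]. *)
Lemma implicit_exists u : `|u| < r -> exists w, `|w| <= `|u| / 2 /\ h (pt u w) = 0.
Proof.
move=> ur; have ur' := ltW ur.
pose A := [set w : 'rV[R]_n | `|w| <= r].
have cA : compact A by apply: compact_norm_le; exact: ltW.
have cf : {within A, continuous (fun w => `|h (pt u w)|)}.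
  apply: continuous_in_subspaceT => w; rewrite inE => Aw.
  apply: (@continuous_comp _ _ _ (fun w => h (pt u w)) (fun y => `|y|));
    last exact: norm_continuous.
  apply: (@continuous_comp _ _ _ (pt u) h); first exact: continuous_pt.
  exact/differentiable_continuous/(C1_on_diff hC1)/ptX.
have A0 : A 0 by exact: norm0r.
have [w /[!inE] Aw wmin] := EVT_min_rV (ex_intro _ 0 A0) cA cf.
have H0 := hlip ur' Aw (norm0r k) (norm0r n).
rewrite pt00 hx0 !subr0 in H0.
have Hu0 := hlip ur' (norm0r n) (norm0r k) (norm0r n).
rewrite pt00 hx0 !subr0 normr0 (max_l (normr_ge0 _)) in Hu0.
have wu0 : `|h (pt u w)| <= `|h (pt u 0)| by apply: wmin; rewrite inE.
have tri : `|w| <= `|h (pt u w)| + `|h (pt u w) - w|.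
  by rewrite -{1}[w](subKr (h (pt u w))) (le_trans (ler_normB _ _)).
have maxE : Num.max `|u| `|w| = `|u| /\ `|w| <= `|u| \/ Num.max `|u| `|w| = `|w| /\ `|u| <= `|w|.
  by case: (leP `|w| `|u|) => [|/ltW]; [left|right].
(* Comparison with [w = 0] gives [|h (pt u w)| <= |u| / 2]; if [|w|] exceeded [|u|], the triangle
   inequality would give [|w| <= |u| / 2 + |w| / 2]. *)
have wu : `|w| <= `|u| by case: maxE => -[ME ?]; rewrite ME in H0; lra.
have hw0 : h (pt u w) = 0.
  apply/eqP; rewrite -normr_eq0; apply: contraT => hw_neq0.
  have hw_gt0 : 0 < `|h (pt u w)| by rewrite lt0r hw_neq0 normr_ge0.
  set a := h (pt u w) in hw_neq0 hw_gt0 tri wu0 H0 *.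
  (* The step [t *: a] must stay in the ball and not overshoot: the new value is then at most
     [(1 - t / 2) |a|], below the minimum. *)
  pose t := Num.min 1 ((r - `|w|) / `|a|).
  have t0 : 0 < t by rewrite lt_min ltr01 divr_gt0// subr_gt0 (le_lt_trans wu).
  have t1 : t <= 1 by rewrite ge_min lexx.
  have tr : t * `|a| <= r - `|w| by rewrite -ler_pdivlMr// ge_min lexx orbT.
  have nta : `|t *: a| = t * `|a| by rewrite normrZ gtr0_norm.
  have Aw' : A (w - t *: a).
    by rewrite /A /= (le_trans (ler_normB _ _))// nta; lra.
  have wE : w - t *: a - w = - (t *: a) by rewrite addrAC subrr add0r.
  have := hlip ur' Aw' ur' Aw; rewrite wE opprK normrN nta (subrr u) normr0.
  rewrite max_r ?(ltW (mulr_gt0 _ _))// -/a => H1.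
  have : `|a| <= `|h (pt u (w - t *: a))| by apply: wmin; rewrite inE.
  have E1 : h (pt u (w - t *: a)) = (h (pt u (w - t *: a)) - a + t *: a) + (1 - t) *: a.
    by apply/rowP => i; rewrite !mxE; ring.
  have : `|h (pt u (w - t *: a))| <= 1 / 2 * (t * `|a|) + (1 - t) * `|a|.
    rewrite E1 (le_trans (ler_normD _ _))// lerD// normrZ ger0_norm ?subr_ge0//.
  have ta : 0 < t * `|a| by rewrite mulr_gt0.
  by move=> h1 h2; exfalso; lra.
exists w; split => //.
rewrite hw0 sub0r normrN in H0.
by case: maxE => -[ME ?]; rewrite ME in H0; lra.
Qed.

Variable z : 'rV[R]_k -> 'rV[R]_n.
Hypothesis zP : forall u, `|u| < r -> `|z u| <= `|u| / 2 /\ h (pt u (z u)) = 0.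

Lemma norm_z u : `|u| < r -> `|z u| < r.
Proof.
by move=> ur; have [zu _] := zP ur; have := normr_ge0 u; lra.
Qed.

(** The 1/2-Lipschitz remainder absorbs half of [|w - z u|]. Besides uniqueness of [z], this says
    that a slice of the [e]-tube has width of order [e], which later provides the domination. *)
Lemma dist_z_le u w : `|u| < r -> `|w| <= r -> `|w - z u| <= 2 * `|h (pt u w)|.
Proof.
move=> ur wr; have := hlip (ltW ur) wr (ltW ur) (ltW (norm_z ur)).
have [_ ->] := zP ur; rewrite subrr normr0 (max_r (normr_ge0 _)) subr0 => H.
have : `|w - z u| <= `|h (pt u w)| + `|h (pt u w) - (w - z u)|.
  by rewrite -{1}[w - z u](subKr (h (pt u w))) (le_trans (ler_normB _ _)).
lra.
Qed.

Lemma z_unique u w : `|u| < r -> `|w| <= r -> h (pt u w) = 0 -> w = z u.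
Proof.
move=> ur wr hw; have := dist_z_le ur wr.
by rewrite hw normr0 mulr0 normr_le0 subr_eq0 => /eqP.
Qed.

(** If [|z u - z u'|] exceeded [|u - u'|], the slice estimate would make it at most half of
    itself. *)
Lemma z_lipschitz u u' : `|u| < r -> `|u'| < r -> `|z u - z u'| <= 1 / 2 * `|u - u'|.
Proof.
move=> ur ur'.
have := hlip (ltW ur) (ltW (norm_z ur)) (ltW ur') (ltW (norm_z ur')).
have [_ ->] := zP ur; have [_ ->] := zP ur'; rewrite subrr sub0r normrN.
have := normr_ge0 (u - u'); have := normr_ge0 (z u - z u').
by case: (leP `|z u - z u'| `|u - u'|) => H ? ? ?; lra.
Qed.

Definition graph u := pt u (z u).

(* The derivative of z, from (K + (dz) S) J = 0. *)
Definition slope u : 'M[R]_(k, n) :=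
  - (K *m 'J h (graph u) *m invmx (S *m 'J h (graph u))).

Definition chart_dom := [set u : 'rV[R]_k | `|u| < r].

Lemma open_chart_dom : open chart_dom.
Proof.
rewrite (_ : chart_dom = ball (0 : 'rV[R]_k) r); first exact: ball_open.
by rewrite -ball_normE; apply/seteqP; split => u /=; rewrite sub0r normrN.
Qed.

Lemma graphX u : chart_dom u -> X (graph u).
Proof. by move=> ur; apply: ptX; apply: ltW => //; exact: norm_z. Qed.

Lemma graph_lipschitz u u' : chart_dom u -> chart_dom u' ->
  `|graph u - graph u'| <= dir_bound * `|u - u'|.
Proof.
move=> ur ur'; rewrite ptB; apply: norm_dir_le' => //.
by have := z_lipschitz ur ur'; have := normr_ge0 (u - u'); lra.
Qed.

Lemma graph_continuous u : chart_dom u -> {for u, continuous graph}.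
Proof.
move=> ur; apply: continuous_of_dist => e e0.
have e1 : 0 < e / dir_bound by rewrite divr_gt0// dir_bound_gt0.
have H1 : nbhs u (ball u (e / dir_bound)) by exact: nbhsx_ballx.
have H2 := open_near open_chart_dom ur.
apply: (@filterS2 _ (nbhs u) (nbhs_filter u) _ _ _ _ H1 H2) => u'.
rewrite -ball_normE /= => uu' ur'.
rewrite (le_trans (graph_lipschitz ur ur'))// mulrC -ler_pdivlMr ?dir_bound_gt0//.
exact: ltW.
Qed.

Lemma unit_slice u : chart_dom u -> S *m 'J h (graph u) \in unitmx.
Proof. by move=> ur; apply: hunit; apply: ltW => //; exact: norm_z. Qed.

Lemma slope_jacobian u : chart_dom u -> (K + slope u *m S) *m 'J h (graph u) = 0.
Proof.
move=> ur; rewrite mulmxDl /slope -mulmxA mulNmx mulmxKV ?subrr//.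
exact: unit_slice.
Qed.

(** Since [h] vanishes along the graph, its differential maps graph increments to a small remainder;
    multiplying by the inverse of [S *m J] isolates the increment of [z]. *)
Lemma slope_diff u (e : R) : chart_dom u -> 0 < e ->
  \forall u' \near u, `|z u' - z u - (u' - u) *m slope u| <= e * `|u' - u|.
Proof.
move=> ur e0.
pose J := 'J h (graph u); pose E := S *m J.
have c0 := dir_bound_gt0; set c := dir_bound in c0.
have m0 : 0 < mxsum (invmx E) + 1 by rewrite ltr_wpDl// mxsum_ge0.
(* The factor [c] pays for the Lipschitz constant of the graph, the other one for [invmx E]. *)
have e1 : 0 < e / (c * (mxsum (invmx E) + 1)) by rewrite divr_gt0// mulr_gt0.
have H1 : \forall u' \near u, `|h (graph u') - h (graph u) -
    'd h (graph u) (graph u' - graph u)| <=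
    e / (c * (mxsum (invmx E) + 1)) * `|graph u' - graph u|.
  have H := diff_eps (C1_on_diff hC1 (graphX ur)) e1.
  exact: (graph_continuous ur H).
have H2 := open_near open_chart_dom ur.
apply: (@filterS2 _ (nbhs u) (nbhs_filter u) _ _ _ _ H1 H2) => u' + ur'.
have [_ hu] := zP ur; have [_ hu'] := zP ur'.
rewrite /graph hu hu' subrr sub0r normrN diffJ -/(graph u) -/(graph u') => H.
have -> : z u' - z u - (u' - u) *m slope u =
    ((graph u' - graph u) *m J) *m invmx E.
  rewrite ptB mulmxDl mulmxDl -(mulmxA (z u' - z u)) mulmxK ?unit_slice//.
  by rewrite /slope mulmxN opprK addrC !mulmxA.
rewrite (le_trans (norm_mulmx_le _ _))//.
have G := graph_lipschitz ur' ur; rewrite -/c in G.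
apply: (@le_trans _ _ ((mxsum (invmx E) + 1) * `|(graph u' - graph u) *m J|)).
  by rewrite ler_wpM2r// lerDl.
rewrite mulrC -ler_pdivlMr//; apply: (le_trans H).
apply: (@le_trans _ _ (e / (c * (mxsum (invmx E) + 1)) * (c * `|u' - u|))).
  by rewrite ler_wpM2l// ltW.
rewrite le_eqVlt; apply/orP; left; apply/eqP.
by field; rewrite !gt_eqF.
Qed.

Lemma graph_diff u : chart_dom u -> differentiable graph u /\
  forall v, 'd graph u v = v *m (K + slope u *m S).
Proof.
move=> ur; apply: diff_of_jac => e e0.
have s0 : 0 < mxsum S + 1 by rewrite ltr_wpDl// mxsum_ge0.
have e1 : 0 < e / (mxsum S + 1) by rewrite divr_gt0.
apply: (@filterS _ (nbhs u) (nbhs_filter u) _ _ _ (slope_diff ur e1)) => u' H.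
have -> : graph u' - graph u - (u' - u) *m (K + slope u *m S) =
    (z u' - z u - (u' - u) *m slope u) *m S.
  rewrite ptB mulmxDr [RHS]mulmxBl -(mulmxA _ (slope u)) opprD addrA.
  by congr (_ - _); rewrite addrAC subrr add0r.
rewrite (le_trans (norm_mulmx_le _ _))//.
apply: (@le_trans _ _ ((mxsum S + 1) * `|z u' - z u - (u' - u) *m slope u|)).
  by rewrite ler_wpM2r// lerDl.
by rewrite mulrC -ler_pdivlMr// mulrAC.
Qed.

(** By Cramer's rule [slope] is a ring expression in the entries of the Jacobian and one inverse
    determinant. Stated for a class [Q], it bootstraps: continuity makes the graph C^1, after which
    the C^1 class makes it C^2. *)
Lemma ring_closed_slope (Q : ('rV[R]_k -> R) -> Prop) :
  ring_closed Q ->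
  (forall f, Q f -> (forall u, chart_dom u -> f u != 0) -> Q (fun u => (f u)^-1)) ->
  (forall f g, {in chart_dom, f =1 g} -> Q f -> Q g) ->
  (forall i j, Q (fun u => 'J h (graph u) i j)) ->
  forall i j, Q (fun u => slope u i j).
Proof.
move=> Qr Qinv Qext QJ i j; have [Qc QD QM] := Qr.
pose E u := S *m 'J h (graph u).
have QE : forall i j, Q (fun u => E u i j).
  by apply: ring_closed_mulmx => // a b; exact: Qc.
have QKJ : forall i j, Q (fun u => (K *m 'J h (graph u)) i j).
  by apply: ring_closed_mulmx => // a b; exact: Qc.
have Qadj := ring_closed_adj Qr QE.
have Qdet := ring_closed_det Qr QE.
apply: (Qext (fun u => (-1) * (\sum_l (K *m 'J h (graph u)) i l *
    ((\det (E u))^-1 * \adj (E u) l j)))).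
  move=> u; rewrite inE => ur.
  rewrite /slope [RHS]mxE mulN1r [in RHS]mxE; congr (- _); apply: eq_bigr => l _.
  by rewrite /invmx unit_slice//; congr (_ * _); rewrite [RHS]mxE.
apply: (QM (fun=> -1)) => //; apply: ring_closed_sum => // l.
apply: (QM (fun u => (K *m 'J h (graph u)) i l)) => //.
apply: (QM (fun u => (\det (E u))^-1)) => //.
by apply: Qinv => // u ur; rewrite -unitfE -unitmxE; exact: unit_slice.
Qed.

Lemma ring_closed_diff_graph (Q : ('rV[R]_k -> R) -> Prop) (v : 'rV[R]_k) :
  ring_closed Q -> (forall i j, Q (fun u => slope u i j)) ->
  forall j, Q (fun u => (v *m (K + slope u *m S)) 0 j).
Proof.
move=> Qr Qs j; apply: ring_closed_mulmx => // [a b|a b]; first exact: ring_closed_cst.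
apply: ring_closed_addmx => // [c d|c d]; first exact: ring_closed_cst.
by apply: ring_closed_mulmx => // e f; exact: ring_closed_cst.
Qed.

Lemma eq_on_cont_on (f g : 'rV[R]_k -> R) : {in chart_dom, f =1 g} ->
  cont_on chart_dom f -> cont_on chart_dom g.
Proof.
move=> fg cf u ur; apply: (eq_on_continuous open_chart_dom ur fg).
exact: cf.
Qed.

Lemma cont_on_inv (f : 'rV[R]_k -> R) : cont_on chart_dom f ->
  (forall u, chart_dom u -> f u != 0) -> cont_on chart_dom (fun u => (f u)^-1).
Proof.
move=> cf f0 u ur; apply: (@continuousV _ _ f); first exact: f0.
exact: cf.
Qed.

Lemma jacobian_graph_continuous i j : cont_on chart_dom (fun u => 'J h (graph u) i j).
Proof.
move=> u ur; apply: (@continuous_comp _ _ _ graph (fun x => 'J h x i j)).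
  exact: graph_continuous.
by apply: C1_on_jacobian_continuous oX hC1 _; exact: graphX.
Qed.

Lemma slope_continuous i j : cont_on chart_dom (fun u => slope u i j).
Proof.
apply: ring_closed_slope.
- exact: cont_on_ring_closed.
- exact: cont_on_inv.
- exact: eq_on_cont_on.
- exact: jacobian_graph_continuous.
Qed.

Lemma graph_C1 : C1_on chart_dom graph.
Proof.
split => [u /graph_diff[]//|v].
rewrite continuous_open_subspace; last exact: open_chart_dom.
move=> u; rewrite inE => ur; apply: continuous_rV => j.
apply: (@eq_on_continuous _ _ chart_dom (fun u => (v *m (K + slope u *m S)) 0 j)) => //.
- exact: open_chart_dom.
- by move=> y; rewrite inE => yr; have [_ ->] := graph_diff yr.
- apply: (ring_closed_diff_graph v (cont_on_ring_closed chart_dom)) => //.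
  exact: slope_continuous.
Qed.

Lemma C1s_comp m (Y : set 'rV[R]_m) p (U : set 'rV[R]_p) (f : 'rV[R]_m -> R)
    (phi : 'rV[R]_p -> 'rV[R]_m) : open U ->
  C1s Y f -> C1_on U phi -> (forall u, U u -> Y (phi u)) -> C1s U (f \o phi).
Proof.
move=> oU [df cf] phiC1 UY.
have dphi u : U u -> differentiable phi u by move=> /(C1_on_diff phiC1).
split => [u Uu|v u Uu].
  by apply: differentiable_comp; [exact: dphi|exact/df/UY].
(* Continuity of ['d f] is known for fixed directions only, so the moving direction ['d phi u v] is
   expanded in the standard basis. *)
apply: (@eq_on_continuous _ _ U (fun u =>
    \sum_i 'd phi u v 0 i * 'd f (phi u) (delta_mx 0 i))) => //.
  move=> y; rewrite inE => Uy.
  rewrite (diff_comp (dphi _ Uy) (df _ (UY _ Uy))) /=.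
  rewrite ['d phi y v in RHS]row_sum_delta linear_sum; apply: eq_bigr => i _.
  by rewrite linearZ.
apply: continuous_sum_fun => i _.
apply: (@continuousM _ _ (fun u => 'd phi u v 0 i)).
  apply: (@continuous_comp _ _ _ (fun u => 'd phi u v) (fun w : 'rV[R]_m => w 0 i)).
    exact: C1_on_continuous oU phiC1 Uu.
  exact: continuous_coord_rV.
apply: (@continuous_comp _ _ _ phi (fun x => 'd f x (delta_mx 0 i))).
  exact/differentiable_continuous/dphi.
by apply: cf; exact: UY.
Qed.

Hypothesis hC2 : C2_on X h.

(** The entries of the Jacobian are C^1 because [h] is C^2, and they are composed with a graph
    already known to be C^1. *)
Lemma slope_C1 i j : C1s chart_dom (fun u => slope u i j).
Proof.
apply: ring_closed_slope.
- by apply: C1s_ring_closed; exact: open_chart_dom.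
- by move=> f; apply: C1s_inv; exact: open_chart_dom.
- by move=> f g; apply: eq_on_C1s; exact: open_chart_dom.
- move=> {}i {}j; apply: (@C1s_comp _ X _ _ (fun x => 'J h x i j)).
  + exact: open_chart_dom.
  + rewrite (_ : (fun x => _) = fun x => 'd h x (delta_mx 0 i) 0 j); last first.
      by apply/funext => x; rewrite jacobianE.
    exact: (@C1_on_coord _ _ _ X (fun x => 'd h x (delta_mx 0 i)) j oX (hC2.2 _)).
  + exact: graph_C1.
  + exact: graphX.
Qed.

Lemma graph_C2 : C2_on chart_dom graph.
Proof.
split; first exact: graph_C1.
move=> v; apply: coord_C1_on; first exact: open_chart_dom.
move=> j; apply: (@eq_on_C1s _ _ _ (fun u => (v *m (K + slope u *m S)) 0 j)).
- exact: open_chart_dom.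
- by move=> y; rewrite inE => yr; have [_ ->] := graph_diff yr.
- apply: ring_closed_diff_graph; last exact: slope_C1.
  by apply: C1s_ring_closed; exact: open_chart_dom.
Qed.

Definition unpt (x : 'rV[R]_(k + n)) : 'rV[R]_(k + n) :=
  (x - x0) *m invmx (col_mx K S).

Lemma ptK u w : unpt (pt u w) = row_mx u w.
Proof. by rewrite /unpt ptE addrK mulmxK. Qed.

Lemma unptK x : pt (lsubmx (unpt x)) (rsubmx (unpt x)) = x.
Proof. by rewrite ptE hsubmxK /unpt mulmxKV// subrK. Qed.

Lemma unpt_continuous : continuous unpt.
Proof.
have -> : unpt = (fun x : 'rV[R]_(k + n) => x *m invmx (col_mx K S)) +
    (fun=> - (x0 *m invmx (col_mx K S))).
  by apply/funext => x; rewrite /unpt mulmxBl.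
move=> x; apply: continuousD; last exact: cst_continuous.
exact: mulmx_continuous.
Qed.

Lemma open_pt_preimage (A : set 'rV[R]_k) (B : set 'rV[R]_n) : open A -> open B ->
  open [set x | A (lsubmx (unpt x)) /\ B (rsubmx (unpt x))].
Proof.
move=> oA oB; apply: openI.
  apply: (@open_comp _ _ (lsubmx \o unpt)) => // x _.
  apply: continuous_comp; first exact: unpt_continuous.
  exact/differentiable_continuous/differentiable_lsubmx.
apply: (@open_comp _ _ (rsubmx \o unpt)) => // x _.
apply: continuous_comp; first exact: unpt_continuous.
exact/differentiable_continuous/differentiable_rsubmx.
Qed.

(** Uniqueness of [z] leaves a single sheet of the zero set in the box, so the graph is cut out by a
    condition on the affine coordinates that is open when [W] is. *)
Lemma image_graph (W : set 'rV[R]_k) : W `<=` chart_dom ->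
  graph @` W = zero_set X h `&`
    [set x | W (lsubmx (unpt x)) /\ `|rsubmx (unpt x)| < r].
Proof.
move=> WU; apply/seteqP; split => [_ [u Wu <-]|x [[Xx hx] [Wx xr]]].
  have ur := WU _ Wu; have [_ hu] := zP ur.
  split; first by split => //; exact: graphX.
  by rewrite /= ptK row_mxKl row_mxKr; split => //; exact: norm_z.
exists (lsubmx (unpt x)) => //; rewrite /graph.
by rewrite -(z_unique (WU _ Wx) (ltW xr))// unptK.
Qed.

Lemma open_norm_lt : open [set w : 'rV[R]_n | `|w| < r].
Proof.
rewrite (_ : [set w | _] = ball (0 : 'rV[R]_n) r); first exact: ball_open.
by rewrite -ball_normE; apply/seteqP; split => u /=; rewrite sub0r normrN.
Qed.

(** This gives access to the Riemannian measure, which is specified only along such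
    parametrizations. *)
Lemma graph_local_parametrization :
  local_parametrization (zero_set X h) chart_dom graph.
Proof.
split.
- exact: open_chart_dom.
- exact: graph_C2.
- move=> u u' _ _ /(congr1 unpt); rewrite !ptK => /(congr1 lsubmx).
  by rewrite !row_mxKl.
- move=> u ur v v'; have [_ dE] := graph_diff ur; rewrite !dE => vv.
  have E w : w *m (K + slope u *m S) = row_mx w (w *m slope u) *m col_mx K S.
    by rewrite mul_row_col mulmxDr mulmxA.
  move: vv; rewrite !E => /(congr1 (mulmx^~ (invmx (col_mx K S)))).
  by rewrite /= !mulmxK// => /(congr1 lsubmx); rewrite !row_mxKl.
- move=> W oW WU.
  exists [set x | W (lsubmx (unpt x)) /\ `|rsubmx (unpt x)| < r].
    exact: (open_pt_preimage oW open_norm_lt).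
  exact: image_graph.
Qed.

Lemma metric_tensor_graph u : chart_dom u ->
  metric_tensor graph u = (K + slope u *m S) *m (K + slope u *m S)^T.
Proof.
move=> ur; rewrite /metric_tensor /nabla trmxK.
suff JE : 'J graph u = K + slope u *m S by rewrite JE.
have [_ dE] := graph_diff ur.
by apply/matrixP => i j; rewrite jacobianE dE -rowE [LHS]mxE.
Qed.

End graph_chart.

(** * Integrals against an image measure with a density *)

Section density.
Import HBNNSimple.
Local Open Scope ereal_scope.
Context {R : realType} d1 d2 (T1 : measurableType d1) (T2 : measurableType d2).
Variables (mu : {measure set T1 -> \bar R}) (nu : {measure set T2 -> \bar R}).
Variables (D1 : set T1) (D2 : set T2) (phi : T1 -> T2) (s : T1 -> R).
Hypotheses (mD1 : measurable D1) (mD2 : measurable D2).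
Hypotheses (mphi : measurable_fun D1 phi) (ms : measurable_fun D1 s).
Hypothesis s_ge0 : forall x, D1 x -> (0 <= s x)%R.
Hypothesis D12 : forall x, D1 x -> D2 (phi x).
Hypothesis nuE : forall A, measurable A -> A `<=` D2 ->
  nu A = \int[mu]_(x in D1 `&` phi @^-1` A) (s x)%:E.

Let mus : measurable_fun D1 (EFin \o s).
Proof. exact/measurable_EFinP. Qed.

Let measurable_phi (G : T2 -> \bar R) : measurable_fun D2 G ->
  measurable_fun D1 (fun x => G (phi x)).
Proof.
move=> mG; apply: (measurable_comp mD2) mG mphi.
by move=> _ [x D1x <-]; exact: D12.
Qed.

Let integral_indic_density A : measurable A ->
  \int[nu]_(y in D2) (\1_A y)%:E =
  \int[mu]_(x in D1) ((\1_A (phi x))%:E * (s x)%:E).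
Proof.
move=> mA; rewrite integral_indic// nuE; [|exact: measurableI|by move=> y []].
have -> : D1 `&` phi @^-1` (A `&` D2) = D1 `&` phi @^-1` A.
  by apply/seteqP; split=> x /= [D1x];
    [move=> []//|move=> Ax; split => //; split => //; exact: D12].
rewrite integral_mkcondr; apply: eq_integral => x _.
by rewrite epatch_indic /= muleC !indicE; congr ((_%:R)%:E * _); apply/idP/idP; rewrite !inE.
Qed.

(** [nuE] is the case of indicators; simple functions follow by additivity and nonnegative functions
    by monotone convergence. *)
Lemma integral_density_pushforward (G : T2 -> \bar R) :
  measurable_fun D2 G -> (forall y, D2 y -> 0 <= G y) ->
  \int[nu]_(y in D2) G y = \int[mu]_(x in D1) (G (phi x) * (s x)%:E).
Proof.
move=> mG G0.
pose g := nnsfun_approx mD2 mG.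
have gG y : D2 y -> (g n y)%:E @[n --> \oo] --> G y.
  by move=> D2y; exact: cvg_nnsfun_approx.
have ndg y : {homo (fun n => (g n y)%:E) : m n / (m <= n)%N >-> m <= n}.
  by move=> m n mn; rewrite lee_fin; exact/lefP/nd_nnsfun_approx.
have mg n : measurable_fun setT (g n) by [].
have L : \int[nu]_(y in D2) G y = limn (fun n => \int[nu]_(y in D2) (g n y)%:E).
  rewrite -monotone_convergence//.
  - apply: eq_integral => y; rewrite inE => D2y.
    by apply/esym/cvg_lim => //; exact: gG.
  - by move=> n; apply/measurable_EFinP; exact: measurable_funTS.
  - by move=> n y _; rewrite lee_fin.
have mgphi n : measurable_fun D1 (fun x => (g n (phi x))%:E * (s x)%:E).
  apply: emeasurable_funM => //.
  by apply: (measurable_phi (G := EFin \o g n)); apply/measurable_EFinP; exact: measurable_funTS.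
have M : \int[mu]_(x in D1) (G (phi x) * (s x)%:E) =
    limn (fun n => \int[mu]_(x in D1) ((g n (phi x))%:E * (s x)%:E)).
  rewrite -monotone_convergence//.
  - apply: eq_integral => x; rewrite inE => D1x.
    apply/esym/cvg_lim => //; apply: cvgeZr => //.
    by apply: gG; exact: D12.
  - by move=> n x D1x; rewrite mule_ge0// lee_fin// s_ge0.
  - move=> x D1x m n mn; apply: lee_wpmul2r; first by rewrite lee_fin s_ge0.
    exact: ndg.
rewrite L M; congr (limn _); apply/funext => n.
have gE y : (g n y)%:E =
    \sum_(r \in range (g n)) (r%:E * (\1_(g n @^-1` [set r]) y)%:E).
  by rewrite fimfunE -fsumEFin//; apply: eq_fsbigr.
have r0 r : r \in range (g n) -> (0 <= r)%R by rewrite inE => -[y _ <-].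
have mindphi r : measurable_fun D1 (fun x => (\1_(g n @^-1` [set r]) (phi x) : R)%:E).
  apply: (measurable_phi (G := fun y => (\1_(g n @^-1` [set r]) y : R)%:E)).
  exact/measurable_EFinP.
transitivity (\sum_(r \in range (g n)) \int[nu]_(y in D2)
    (r%:E * (\1_(g n @^-1` [set r]) y)%:E)).
  under eq_integral do rewrite gE.
  rewrite ge0_integral_fsum//.
  - by move=> r; apply: emeasurable_funM => //; apply/measurable_EFinP.
  - by move=> r y _; exact: nnfun_muleindic_ge0.
transitivity (\sum_(r \in range (g n)) \int[mu]_(x in D1)
    (r%:E * (\1_(g n @^-1` [set r]) (phi x))%:E * (s x)%:E)).
  apply: eq_fsbigr => r /r0 r_ge0.
  rewrite ge0_integralZl_EFin//; last by apply/measurable_EFinP.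
  rewrite integral_indic_density//.
  rewrite -ge0_integralZl_EFin//.
  - by apply: eq_integral => x _; rewrite muleA.
  - by move=> x D1x; rewrite mule_ge0// lee_fin s_ge0.
  - by apply: emeasurable_funM => //; exact: mindphi.
rewrite -ge0_integral_fsum//.
- apply: eq_integral => x _; rewrite gE.
  by rewrite ge0_mule_fsuml// => r; exact: nnfun_muleindic_ge0.
- move=> r; apply: emeasurable_funM => //.
  by apply: (emeasurable_funM (f := cst r%:E)) => //; exact: mindphi.
- move=> r x D1x; rewrite mule_ge0 ?lee_fin ?s_ge0//.
  exact: nnfun_muleindic_ge0.
Qed.

End density.

(** * Charts of the zero set of a submersion *)

Section chart_record.
Context {R : realType} {k n : nat}.
Variables (X : set 'rV[R]_(k + n)) (h : 'rV[R]_(k + n) -> 'rV[R]_n).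

(** A [v] with [v *m nabla h x = 0] is orthogonal to the range of the differential, which is
    everything, hence to itself. *)
Lemma submersion_gram_gt0 x : submersion_on X h -> X x ->
  0 < \det (nabla h x *m (nabla h x)^T).
Proof.
move=> hsub Xx; have [_ hs] := hsub _ Xx.
apply: det_gram_gt0 => v vJ.
have [w wv] := hs v.
have : v *m v^T = 0.
  by rewrite -{2}wv diffJ trmx_mul mulmxA vJ mul0mx.
move=> vv; have [_] := mulmx_tr_ge0 (1%:M : 'M[R]_n) v.
by rewrite trmx1 !mulmx1 vv mxE eqxx => /esym/eqP.
Qed.

(** Everything that integration needs from a chart, detached from the estimates that produce it. [V]
    is the open box in which the zero set is exactly the graph. *)
Record is_graph_chart (x0 : 'rV[R]_(k + n)) (K : 'M[R]_(k, k + n)) (S : 'M[R]_(n, k + n))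
    (r : R) (z : 'rV[R]_k -> 'rV[R]_n) (V : set 'rV[R]_(k + n)) : Prop := IsGraphChart {
  chart_unit : col_mx K S \in unitmx;
  chart_r : 0 < r;
  chart_z : forall u, `|u| < r -> h (pt x0 K S u (z u)) = 0;
  chart_dist : forall u w, `|u| < r -> `|w| <= r ->
    `|w - z u| <= 2 * `|h (pt x0 K S u w)|;
  chart_X : forall u, `|u| < r -> X (graph x0 K S z u);
  chart_param : local_parametrization (zero_set X h) (@chart_dom R k r) (graph x0 K S z);
  chart_cont : forall u, `|u| < r -> {for u, continuous (graph x0 K S z)};
  chart_E : forall u, `|u| < r -> S *m 'J h (graph x0 K S z u) \in unitmx;
  (* Up to the constant det (K ; S), the Jacobian of w |-> h (pt u w) relates
     Lebesgue measure to the weighted area element of the graph. *)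
  chart_det : forall u, `|u| < r ->
    `|\det (col_mx K S)| / `|\det (S *m 'J h (graph x0 K S z u))| =
    Num.sqrt (\det (metric_tensor (graph x0 K S z) u)) /
    Num.sqrt (\det (nabla h (graph x0 K S z u) *m (nabla h (graph x0 K S z u))^T));
  chart_cont_E : cont_on (@chart_dom R k r) (fun u => \det (S *m 'J h (graph x0 K S z u)));
  chart_cont_g : cont_on (@chart_dom R k r)
    (fun u => Num.sqrt (\det (metric_tensor (graph x0 K S z) u)));
  chart_openV : open V;
  chart_V : V x0;
  chart_box : forall u w, V (pt x0 K S u w) -> `|u| < r /\ `|w| < r;
  chart_image : graph x0 K S z @` (@chart_dom R k r) = zero_set X h `&` V }.

Lemma submersion_graph_chart x0 : open X -> C2_on X h -> submersion_on X h ->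
  zero_set X h x0 -> exists K S r z V, is_graph_chart x0 K S r z V.
Proof.
move=> oX hC2 hsub [Xx0 hx0].
have hC1 := hC2.1.
have [K [S [KJ SJ uT]]] : exists (K : 'M[R]_(k, k + n)) (S : 'M[R]_(n, k + n)),
    [/\ K *m 'J h x0 = 0, S *m 'J h x0 = 1%:M & col_mx K S \in unitmx].
  apply: surjective_complement => y.
  by have [_ /(_ y)[v vy]] := hsub _ Xx0; exists v; rewrite -diffJ.
have [r [r0 ptX hlip hunit]] := slice_estimates oX hC1 Xx0 KJ SJ.
have /choice[z zP] : forall u, exists w, `|u| < r ->
    `|w| <= `|u| / 2 /\ h (pt x0 K S u w) = 0.
  move=> u; have [ur|_] := ltP `|u| r; last by exists 0.
  have [w wP] : exists w, `|w| <= `|u| / 2 /\ h (pt x0 K S u w) = 0.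
    by eapply implicit_exists; eassumption.
  by exists w.
have gc u : chart_dom r u -> {for u, continuous (graph x0 K S z)}.
  by move=> ?; eapply graph_continuous; eassumption.
have gX u : chart_dom r u -> X (graph x0 K S z u).
  by move=> ?; eapply graphX; eassumption.
have uE u : chart_dom r u -> S *m 'J h (graph x0 K S z u) \in unitmx.
  by move=> ?; eapply unit_slice; eassumption.
have PJ u : chart_dom r u -> (K + slope h x0 K S z u *m S) *m 'J h (graph x0 K S z u) = 0.
  by move=> ?; eapply slope_jacobian; eassumption.
have gE u : chart_dom r u -> metric_tensor (graph x0 K S z) u =
    (K + slope h x0 K S z u *m S) *m (K + slope h x0 K S z u *m S)^T.
  by move=> ?; eapply metric_tensor_graph; eassumption.
pose V := [set x | @chart_dom R k r (lsubmx (unpt x0 K S x)) /\ `|rsubmx (unpt x0 K S x)| < r].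
exists K, S, r, z, V; split => //.
- by move=> u /zP[].
- by move=> u w ur wr; eapply dist_z_le; eassumption.
- by eapply graph_local_parametrization; eassumption.
- move=> u ur.
  have [_ ->] := det_graph uT (uE _ ur) (PJ _ ur).
  by rewrite gE// /nabla trmxK.
- apply: (ring_closed_det (cont_on_ring_closed _)).
  apply: (ring_closed_mulmx (cont_on_ring_closed _)).
    exact: (ring_closed_cst S (cont_on_ring_closed _)).
  by move=> i j; eapply jacobian_graph_continuous; eassumption.
- move=> u ur.
  apply: (@eq_on_continuous _ _ (@chart_dom R k r) (fun u =>
    Num.sqrt (\det ((K + slope h x0 K S z u *m S) *m (K + slope h x0 K S z u *m S)^T)))) => //.
  + exact: open_chart_dom.
  + move=> v; rewrite inE => vr.
    by rewrite gE.
  + apply: (@continuous_comp _ _ _ (fun u =>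
      \det ((K + slope h x0 K S z u *m S) *m (K + slope h x0 K S z u *m S)^T)) Num.sqrt);
      last exact: sqrt_continuous.
    have Qr := @cont_on_ring_closed R _ (@chart_dom R k r).
    have Qs : forall i j,
        cont_on (@chart_dom R k r) (fun u => (K + slope h x0 K S z u *m S) i j).
      apply: (ring_closed_addmx Qr); first exact: (ring_closed_cst K Qr).
      apply: (ring_closed_mulmx Qr); last exact: (ring_closed_cst S Qr).
      by move=> i j; eapply slope_continuous; eassumption.
    apply: (ring_closed_det Qr) => //.
    apply: (ring_closed_mulmx Qr) => // i j v vr.
    apply: (@eq_on_continuous _ _ (@chart_dom R k r)
      (fun u => (K + slope h x0 K S z u *m S) j i)) => //.
    * exact: open_chart_dom.
    * by move=> ? _; rewrite [RHS]mxE.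
    * exact: Qs.
- have oD : open (@chart_dom R k r) by exact: open_chart_dom.
  have := @open_pt_preimage R k n x0 K S _ _ oD (@open_norm_lt R n r).
  exact.
- have : V (pt x0 K S 0 0); last by rewrite pt00.
  by rewrite /V /= ptK// row_mxKl row_mxKr /chart_dom /= !normr0.
- by move=> u w; rewrite /V /= ptK// row_mxKl row_mxKr.
- by rewrite /V; eapply image_graph => //; eassumption.
Qed.

End chart_record.

Lemma cvg_seq_comp (T S : topologicalType) (f : nat -> T) (g : T -> S) a :
  f m @[m --> \oo] --> a -> {for a, continuous g} ->
  g (f m) @[m --> \oo] --> g a.
Proof. by move=> fa ga; exact: (cvg_comp _ _ fa ga). Qed.

(** * Measurability of tubes and regularity of the weight *)

Section tube_measurability.
Context {R : realType} {d n : nat}.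
Variables (X : set 'rV[R]_d) (h : 'rV[R]_d -> 'rV[R]_n).
Hypotheses (oX : open X) (hC1 : C1_on X h).

Lemma measurable_tube e : measurable (tube X h e).
Proof.
have mX : measurable X by exact: measurable_open_mx.
have mh : measurable_fun X (fun x => enorm (h x)).
  apply: continuous_measurable_rV => // x Xx.
  apply: (@continuous_comp _ _ _ h (@enorm R n)); last exact: continuous_enorm.
  exact/differentiable_continuous/(C1_on_diff hC1).
have := mh mX `]-oo, e]%classic; rewrite (_ : X `&` _ = tube X h e); first by apply.
by apply/seteqP; split => x /=; rewrite in_itv.
Qed.

Lemma measurable_zero_set : measurable (zero_set X h).
Proof.
rewrite (_ : zero_set X h = tube X h 0); first exact: measurable_tube.
apply/seteqP; split => x [Xx /= hx]; split => //.
  by rewrite hx -(scale0r (0 : 'rV[R]_n)) enormZ normr0 mul0r.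
have : `|h x| <= 0 by exact: le_trans (norm_le_enorm _) hx.
by rewrite normr_le0 => /eqP.
Qed.

Definition weight (x : 'rV[R]_d) : R :=
  (Num.sqrt (\det (nabla h x *m (nabla h x)^T)))^-1.

Lemma weight_ge0 x : 0 <= weight x.
Proof. by rewrite invr_ge0 sqrtr_ge0. Qed.

Lemma weight_continuous : (forall x, X x -> 0 < \det (nabla h x *m (nabla h x)^T)) ->
  forall x, X x -> {for x, continuous weight}.
Proof.
move=> hdet x Xx.
have Qr := @cont_on_ring_closed R _ X.
have QJ i j : cont_on X (fun x => nabla h x i j).
  move=> y Xy; rewrite (_ : (fun x => _) = (fun x => 'J h x j i)).
    exact: C1_on_jacobian_continuous oX hC1 Xy.
  by apply/funext => w; rewrite [LHS]mxE.
apply: (@continuousV _ _ (fun x => Num.sqrt (\det (nabla h x *m (nabla h x)^T)))).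
  by rewrite gt_eqF// sqrtr_gt0 hdet.
apply: (@continuous_comp _ _ _ (fun x => \det (nabla h x *m (nabla h x)^T)) Num.sqrt).
  apply: (ring_closed_det Qr) => //; apply: (ring_closed_mulmx Qr) => // i j y Xy.
  rewrite (_ : (fun x => _) = (fun x => nabla h x j i)); first exact: QJ.
  by apply/funext => w; rewrite [LHS]mxE.
exact: sqrt_continuous.
Qed.

End tube_measurability.

(** * The limit of tube integrals inside one chart *)

Section local_limit.
Context {R : realType} {k n : nat}.
Variables (X : set 'rV[R]_(k + n)) (h : 'rV[R]_(k + n) -> 'rV[R]_n).
Variables (x0 : 'rV[R]_(k + n)) (K : 'M[R]_(k, k + n)) (S : 'M[R]_(n, k + n)).
Variables (r : R) (z : 'rV[R]_k -> 'rV[R]_n) (V : set 'rV[R]_(k + n)).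
Hypotheses (oX : open X) (hC1 : C1_on X h).
Hypothesis ch : is_graph_chart X h x0 K S r z V.
Variables (F : 'rV[R]_(k + n) -> R) (B : R).
Hypotheses (F0 : forall x, 0 <= F x) (mF : measurable_fun setT F).
Hypotheses (FB : forall x, F x <= B) (cF : forall x, X x -> {for x, continuous F}).
Hypothesis FV : forall x, ~ V x -> F x = 0.

Let T := col_mx K S.
Let phi := graph x0 K S z.
Let E u := S *m 'J h (phi u).
Let U := @chart_dom R k r.
Let p := pt x0 K S.
Let F' e x : R := F x * \1_(tube X h e) x.

Let F'_ge0 e x : 0 <= F' e x.
Proof. by rewrite mulr_ge0// indicE. Qed.

Let F'_le e x : F' e x <= B.
Proof. by rewrite (le_trans _ (FB x))// ler_piMr// indicE lern1 leq_b1. Qed.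

Let measurable_F' e : measurable_fun setT (EFin \o F' e).
Proof.
apply/measurable_EFinP; apply: measurable_funM => //.
by apply: measurable_indic; exact: measurable_tube.
Qed.

Let integral_tube e : (\int[lebesgue_rV R (k + n)]_(x in tube X h e) (F x)%:E =
  \int[lebesgue_rV R (k + n)]_x (F' e x)%:E)%E.
Proof.
rewrite integral_mkcond; apply: eq_integral => x _.
by rewrite epatch_indic /= -EFinM.
Qed.

Let integral_tube_slices e : (\int[lebesgue_rV R (k + n)]_x (F' e x)%:E =
  `|\det T|%:E * \int[lebesgue_rV R k]_u \int[lebesgue_rV R n]_w (F' e (p u w))%:E)%E.
Proof.
have mG : measurable_fun setT (fun y => (F' e (y *m T + x0)%R)%:E).
  apply: (measurableT_comp (@measurable_F' e)); exact: measurable_affine.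
have G0 y : (0 <= (F' e (y *m T + x0))%:E)%E by rewrite lee_fin F'_ge0.
have F'0 y : (0 <= (F' e y)%:E)%E by rewrite lee_fin F'_ge0.
rewrite (integral_rV_affine x0 (chart_unit ch) (measurable_F' e) F'0).
congr (_ * _)%E; apply: etrans (integral_rV_add mG G0) _.
by apply: eq_integral => u _; apply: eq_integral => w _; rewrite /p ptE.
Qed.

Let integral_slice_scale e u : 0 < e ->
  (\int[lebesgue_rV R n]_w (F' e (p u w))%:E =
   (e ^+ n)%:E * \int[lebesgue_rV R n]_w (F' e (p u (z u + e *: w)%R))%:E)%E.
Proof.
move=> e0.
have ue : e%:M \in @unitmx R n by rewrite unitmxE det_scalar unitrX// unitfE gt_eqF.
have mG : measurable_fun setT (fun w => (F' e (p u w))%:E).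
  apply: (measurableT_comp (@measurable_F' e)).
  rewrite (_ : p u = fun w => w *m S + (u *m K + x0)); first exact: measurable_affine.
  by apply/funext => w; rewrite /p /pt addrAC addrC addrA.
have G0 w : (0 <= (F' e (p u w))%:E)%E by rewrite lee_fin F'_ge0.
have H := @integral_rV_affine R n e%:M (z u) (fun w => (F' e (p u w))%:E) ue mG G0.
have dE : `|\det (e%:M : 'M[R]_n)| = e ^+ n by rewrite det_scalar normrX gtr0_norm.
apply: etrans H _; apply: (@f_equal2 _ _ _ mule); first exact: (congr1 EFin dE).
by apply: eq_integral => w _; rewrite mul_mx_scalar addrC.
Qed.

(** The slice over [u] after the substitution [w = z u + e w'], with its Jacobian [e ^+ n] left
    out. *)
Let slice_mass e u : \bar R :=
  (\int[lebesgue_rV R n]_w (F' e (p u (z u + e *: w)%R))%:E)%E.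

Let slice_mass_ge0 e u : (0 <= slice_mass e u)%E.
Proof. by apply: integral_ge0 => w _; rewrite lee_fin F'_ge0. Qed.

(** Nothing is known of [z] outside the chart, so measurability is read off from the unscaled slice
    integral, in which [z] does not occur. *)
Let measurable_slice_mass e : 0 < e -> measurable_fun setT (slice_mass e).
Proof.
move=> e0.
have mG : measurable_fun setT (fun y : 'rV[R]_k * 'rV[R]_n => (F' e (p y.1 y.2))%:E).
  apply: (measurableT_comp (@measurable_F' e)).
  rewrite (_ : (fun y => _) =
    (fun y => y *m T + x0) \o (fun y : 'rV[R]_k * 'rV[R]_n => row_mx y.1 y.2)).
    by apply: measurableT_comp; [exact: measurable_affine|exact: measurable_row_mx].
  by apply/funext => y /=; rewrite /p ptE.
have := @measurable_fun_fubini_tonelli_F _ _ _ _ _ (lebesgue_rV R n) _ mG.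
move=> /(_ (fun y => F'_ge0 _ _)) mI.
rewrite (_ : slice_mass e = fun u => ((e ^- n)%:E *
    \int[lebesgue_rV R n]_w (F' e (p u w))%:E)%E).
  by apply: emeasurable_funM => //; exact: mI.
apply/funext => u; rewrite integral_slice_scale// muleA -EFinM mulVf ?mul1e//.
by rewrite expf_neq0// gt_eqF.
Qed.

Let integral_tube_mass e : 0 < e ->
  ((e ^- n)%:E * \int[lebesgue_rV R (k + n)]_(x in tube X h e) (F x)%:E =
   `|\det T|%:E * \int[lebesgue_rV R k]_(u in U) slice_mass e u)%E.
Proof.
move=> e0; rewrite integral_tube integral_tube_slices.
have -> : (\int[lebesgue_rV R k]_u \int[lebesgue_rV R n]_w (F' e (p u w))%:E =
    (e ^+ n)%:E * \int[lebesgue_rV R k]_u slice_mass e u)%E.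
  rewrite -ge0_integralZl_EFin ?exprn_ge0 ?ltW//.
  - by apply: eq_integral => u _; exact: integral_slice_scale.
  - exact: measurable_slice_mass.
rewrite muleCA; apply: (@f_equal2 _ _ _ mule) => //.
rewrite muleA -EFinM mulVf ?mul1e; last by rewrite expf_neq0// gt_eqF.
rewrite [RHS]integral_mkcond; apply: eq_integral => u _.
rewrite patchE; case: ifPn => // /negP; rewrite inE => uU.
rewrite /slice_mass integral0_eq// => w _.
rewrite /F' FV ?mul0r//; move=> /(chart_box ch)[ur _].
exact: uU.
Qed.

Variable e_ : nat -> R.
Hypotheses (e_gt0 : forall m, 0 < e_ m) (e_cvg : e_ m @[m --> \oo] --> (0 : R)).

(** The 2 is that of [chart_dist]: in the tube [|e w| <= 2 |h| <= 2 e]. The rescaled slices thus lie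
    in one cube for all [e]. *)
Let cube := [set w : 'rV[R]_n | forall i, w 0 i \in `[- 2, 2]].

Let F'_slice_le e u w : 0 < e -> U u -> F' e (p u (z u + e *: w)) <= B * \1_cube w.
Proof.
move=> e0 uU; have [wc|wc] := pselect (cube w).
  by rewrite indicE mem_set// mulr1 F'_le.
rewrite indicE memNset// mulr0 /F'.
have [Vx|Vx] := pselect (V (p u (z u + e *: w))); last by rewrite FV// mul0r.
rewrite indicE memNset ?mulr0// => -[_ /= hx]; apply: wc => i.
have [_ zr] := chart_box ch Vx.
have := chart_dist ch uU (ltW zr); rewrite [z u + _]addrC addrK normrZ gtr0_norm//.
rewrite addrC => H1.
have H2 : e * `|w| <= 2 * e.
  by rewrite (le_trans H1)// ler_wpM2l// (le_trans (norm_le_enorm _)).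
have w2 : `|w| <= 2 by rewrite -(ler_pM2l e0) [leRHS]mulrC.
by rewrite in_itv/= -ler_norml (le_trans (norm_coord_le _ _)).
Qed.

Let slice_cvg u (w : 'rV[R]_n) : U u ->
  p u (z u + e_ m *: w) @[m --> \oo] --> phi u.
Proof.
move=> uU; rewrite /phi /graph -/p.
have H : z u + e_ m *: w @[m --> \oo] --> z u.
  rewrite -[X in _ --> X]addr0 -(scale0r w).
  by apply: cvgD; [exact: cvg_cst|apply: cvgZr_tmp].
exact: (cvg_seq_comp (g := p u) H (@continuous_pt R k n x0 K S u (z u))).
Qed.

(** [h] vanishes at [phi u], so this is a difference quotient of [h] there in the direction
    [w *m S]. *)
Let quotient_cvg u (w : 'rV[R]_n) : U u ->
  (e_ m)^-1 *: h (p u (z u + e_ m *: w)) @[m --> \oo] --> w *m E u.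
Proof.
move=> uU; apply/cvgrPdist_le => eta eta0.
have a0 : 0 < `|w *m S| + 1 by rewrite ltr_wpDl.
have q0 : 0 < eta / (`|w *m S| + 1) by rewrite divr_gt0.
have H := diff_eps (C1_on_diff hC1 (chart_X ch uU)) q0.
have H' : \forall m \near \oo, `|h (p u (z u + e_ m *: w)) - h (graph x0 K S z u) -
    'd h (graph x0 K S z u) (p u (z u + e_ m *: w) - graph x0 K S z u)| <=
    eta / (`|w *m S| + 1) * `|p u (z u + e_ m *: w) - graph x0 K S z u|.
  exact: (slice_cvg w uU H).
near=> m.
have : `|h (p u (z u + e_ m *: w)) - h (graph x0 K S z u) -
    'd h (graph x0 K S z u) (p u (z u + e_ m *: w) - graph x0 K S z u)| <=
    eta / (`|w *m S| + 1) * `|p u (z u + e_ m *: w) - graph x0 K S z u|.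
  by near: m; exact: H'.
have -> : p u (z u + e_ m *: w) - graph x0 K S z u = e_ m *: (w *m S).
  by rewrite /p /graph ptB subrr mul0mx add0r [z u + _]addrC addrK scalemxAl.
rewrite (chart_z ch uU) subr0 diffJ -scalemxAl -mulmxA normrZ (gtr0_norm (e_gt0 m)) => H2.
have e1 := lt0r_neq0 (e_gt0 m).
have -> : w *m E u - (e_ m)^-1 *: h (p u (z u + e_ m *: w)) =
    - ((e_ m)^-1 *: (h (p u (z u + e_ m *: w)) - e_ m *: (w *m E u))).
  by rewrite scalerBr scalerA mulVf// scale1r opprB.
rewrite normrN normrZ gtr0_norm ?invr_gt0// ler_pdivrMl//.
apply: (le_trans H2); rewrite mulrCA ler_wpM2l ?(ltW (e_gt0 m))//.
rewrite mulrAC ler_pdivrMr// ler_wpM2l ?(ltW eta0)// lerDl.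
Unshelve. all: by end_near. Qed.

(** Off the sphere [enorm (w *m E u) = 1] the test [enorm (q_ m) <= 1] is eventually constant; on
    the sphere it may oscillate. *)
Let integrand_cvg u (w : 'rV[R]_n) : U u -> enorm (w *m E u) <> 1 ->
  F' (e_ m) (p u (z u + e_ m *: w)) @[m --> \oo] -->
  F (phi u) * \1_(@unit_ball R n) (w *m E u).
Proof.
move=> uU w1.
pose x_ m := p u (z u + e_ m *: w).
have cx : x_ m @[m --> \oo] --> phi u by exact: slice_cvg.
have cFx : F (x_ m) @[m --> \oo] --> F (phi u).
  exact: (cvg_seq_comp cx (cF (chart_X ch uU))).
pose q_ m := (e_ m)^-1 *: h (x_ m).
have cq : enorm (q_ m) @[m --> \oo] --> enorm (w *m E u).
  have cq0 : q_ m @[m --> \oo] --> w *m E u by exact: quotient_cvg.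
  have ce : {for w *m E u, continuous (@enorm R n)} by exact: continuous_enorm.
  exact: (cvg_seq_comp cq0 ce).
have qE m : (enorm (q_ m) <= 1) = (enorm (h (x_ m)) <= e_ m).
  by rewrite /q_ enormZ normfV (gtr0_norm (e_gt0 m)) ler_pdivrMl// mulr1.
have nX : \forall m \near \oo, X (x_ m).
  exact: (cx _ (open_near oX (chart_X ch uU))).
have n1 : \forall m \near \oo, (enorm (q_ m) <= 1) = (enorm (w *m E u) <= 1).
  have [wlt|wgt|//] := ltgtP (enorm (w *m E u)) 1.
    by near=> m; apply/ltW; near: m; exact: (cvgr_lt _ cq).
  by near=> m; apply/negbTE; rewrite -ltNge; near: m; exact: (cvgr_gt _ cq).
have n2 : \forall m \near \oo, F (x_ m) * \1_(@unit_ball R n) (w *m E u) = F' (e_ m) (x_ m).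
  apply: filterS2 nX n1 => m Xm Em; rewrite /F' !indicE; congr (_ * (_ : bool)%:R).
  apply/idP/idP; rewrite !inE /unit_ball /tube /= -Em qE; first by [].
  by case.
apply: cvg_trans (near_eq_cvg n2) _.
by apply: cvgM => //; exact: cvg_cst.
Unshelve. all: by end_near. Qed.

Let measurable_cube2 : measurable cube.
Proof. exact: measurable_cube. Qed.

Let lebesgue_cube2 : lebesgue_rV R n cube = (4 ^+ n)%:E.
Proof.
have -> : 4 = (2 : R) *+ 2 by ring.
exact: lebesgue_rV_cube (ler0n R 2).
Qed.

Let B_ge0 : 0 <= B.
Proof. exact: le_trans (F0 0) (FB 0). Qed.

Let measurable_slice_pt e u : measurable_fun setT (fun w : 'rV[R]_n => p u (z u + e *: w)).
Proof.
rewrite (_ : (fun w => _) = fun w => w *m (e *: S) + (z u *m S + u *m K + x0)).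
  exact: measurable_affine.
apply/funext => w; rewrite /p /pt mulmxDl -scalemxAl -scalemxAr.
by apply/rowP => i; rewrite !mxE; ring.
Qed.

Let integral_cube2 : (\int[lebesgue_rV R n]_w (B * \1_cube w)%:E = (B * 4 ^+ n)%:E)%E.
Proof.
under eq_integral do rewrite EFinM.
have mc : measurable_fun setT (fun w : 'rV[R]_n => (\1_cube w : R)%:E).
  exact/measurable_EFinP/measurable_indic.
apply: etrans (ge0_integralZl_EFin _ measurableT _ mc B_ge0) _ => //.
rewrite EFinM; congr (_ * _)%E.
apply: etrans (integral_indic _ measurableT measurable_cube2) _.
by rewrite setIT; exact: lebesgue_cube2.
Qed.

Let slice_mass_le e u : 0 < e -> U u -> (slice_mass e u <= (B * 4 ^+ n)%:E)%E.
Proof.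
move=> e0 uU.
have -> : (B * 4 ^+ n)%:E = (\int[lebesgue_rV R n]_w (B * \1_cube w)%:E)%E.
  exact/esym/integral_cube2.
apply: ge0_le_integral => //.
- by move=> w _; rewrite lee_fin F'_ge0.
- apply: (measurableT_comp (@measurable_F' e)); exact: measurable_slice_pt.
- by apply/measurable_EFinP; apply: measurable_funM => //; exact: measurable_indic.
- by move=> w _; rewrite lee_fin; exact: F'_slice_le.
Qed.

Let measurable_U : measurable U.
Proof. by apply: measurable_open_mx; exact: open_chart_dom. Qed.

Let lebesgue_U_fin : (lebesgue_rV R k U < +oo)%E.
Proof.
apply: (@le_lt_trans _ _ (((r *+ 2) ^+ k)%:E)); last exact: ltry.
rewrite -(lebesgue_rV_cube k (ltW (chart_r ch))).
apply: le_measure; rewrite ?inE//; first exact: measurable_cube.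
move=> u ur i; rewrite in_itv/= -ler_norml.
exact: le_trans (norm_coord_le _ _) (ltW ur).
Qed.

(** Dominated convergence in [w], with bound [B] on the cube. The exceptional set is the preimage of
    the unit sphere under the invertible [E u], hence null, and the volume of the preimage of the
    ball produces [|\det (E u)|^-1]. *)
Let slice_mass_cvg u : U u ->
  slice_mass (e_ m) u @[m --> \oo] -->
  ((F (phi u) * `|\det (E u)|^-1)%:E * lebesgue_rV R n (@unit_ball R n))%E.
Proof.
move=> uU.
have uE := chart_E ch uU.
pose PB := [set w : 'rV[R]_n | @unit_ball R n (w *m E u + 0)].
have mball : measurable PB.
  by apply: measurable_preimageT (@measurable_unit_ball R n); exact: measurable_affine.
have PBE w : \1_PB w = \1_(@unit_ball R n) (w *m E u) :> R.
  by rewrite !indicE; congr ((_ : bool)%:R); apply/idP/idP; rewrite !inE /PB /= addr0.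
have Fphi0 : 0 <= F (phi u) by exact: F0.
have mPB : measurable_fun setT (fun w : 'rV[R]_n => (\1_PB w : R)%:E).
  exact/measurable_EFinP/measurable_indic.
have <- : (\int[lebesgue_rV R n]_w (F (phi u) * \1_PB w)%:E =
    (F (phi u) * `|\det (E u)|^-1)%:E * lebesgue_rV R n (@unit_ball R n))%E.
  under eq_integral do rewrite EFinM.
  apply: etrans (ge0_integralZl_EFin _ measurableT _ mPB Fphi0) _ => //.
  rewrite EFinM -muleA -(lebesgue_rV_affine 0 uE)//; last exact: measurable_unit_ball.
  congr (_ * _)%E; apply: etrans (integral_indic _ measurableT mball) _.
  by rewrite setIT.
have mS1 : measurable [set y : 'rV[R]_n | enorm y = 1].
  exact: (@measurable_preimageT _ _ _ _ (@enorm R n) [set 1] (@measurable_enorm R n)).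
have msphere : measurable [set w : 'rV[R]_n | enorm (w *m E u + 0) = 1].
  by apply: measurable_preimageT mS1; exact: measurable_affine.
have mF'pt m : measurable_fun setT (fun w : 'rV[R]_n => (F' (e_ m) (p u (z u + e_ m *: w)))%:E).
  apply: (measurableT_comp (@measurable_F' (e_ m))); exact: measurable_slice_pt.
have [] // := @dominated_convergence _ _ _ (lebesgue_rV R n) setT measurableT
  (fun m (w : 'rV[R]_n) => (F' (e_ m) (p u (z u + e_ m *: w)))%:E)
  (fun w => (F (phi u) * \1_PB w)%:E)
  (fun w => (B * \1_cube w)%:E).
- by apply/measurable_EFinP; apply: measurable_funM => //; exact: measurable_indic.
- exists [set w : 'rV[R]_n | enorm (w *m E u + 0) = 1]; split => //.
    apply: etrans (lebesgue_rV_affine 0 uE mS1) _.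
    by rewrite lebesgue_unit_sphere mule0.
  move=> w /= Hw; apply: contrapT => w1; apply: Hw => _.
  rewrite addr0 in w1; rewrite PBE; apply: cvg_EFin; first by near=> m.
  exact: integrand_cvg.
- apply/integrableP; split.
    by apply/measurable_EFinP; apply: measurable_funM => //; exact: measurable_indic.
  apply: le_lt_trans (ltry (B * 4 ^+ n)); rewrite -integral_cube2 le_eqVlt.
  apply/orP; left; apply/eqP; apply: eq_integral => w _.
  by rewrite gee0_abs// lee_fin mulr_ge0// indicE.
- apply: aeW => w m _; rewrite gee0_abs ?lee_fin ?F'_ge0//.
  exact: F'_slice_le.
Unshelve. all: by end_near. Qed.

Variable lam : {measure set 'rV[R]_(k + n) -> \bar R}.
Hypothesis lamP : is_riemannian_measure k (zero_set X h) lam.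
Hypothesis gram_gt0 : forall x, X x -> 0 < \det (nabla h x *m (nabla h x)^T).

Let M := zero_set X h.
Let s u := Num.sqrt (\det (metric_tensor phi u)).
Let c := lebesgue_rV R n (@unit_ball R n).

Let measurable_phi_U : measurable (phi @` U).
Proof.
rewrite (chart_image ch); apply: measurableI; first exact: measurable_zero_set.
by apply: measurable_open_mx; exact: chart_openV ch.
Qed.

Let measurable_F_weight (D : set 'rV[R]_(k + n)) : measurable D -> D `<=` X ->
  measurable_fun D (fun x => (F x * weight h x)%:E).
Proof.
move=> mD DX; apply/measurable_EFinP; apply: measurable_funM.
  exact: measurable_funTS.
apply: (@measurable_funS _ _ _ _ X) => //; first exact: measurable_open_mx.
by apply: continuous_measurable_rV => // x Xx; exact: (weight_continuous oX hC1 gram_gt0 Xx).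
Qed.

Let F_weight_ge0 x : (0 <= (F x * weight h x)%:E)%E.
Proof. by rewrite lee_fin mulr_ge0// weight_ge0. Qed.

(** As [F] vanishes off [V], only the part of M covered by the chart contributes. *)
Let chart_integral : (\int[lam]_(x in M) (F x * weight h x)%:E =
  \int[lebesgue_rV R k]_(u in U) ((F (phi u) * weight h (phi u))%:E * (s u)%:E))%E.
Proof.
have phiUM : phi @` U `<=` M by rewrite (chart_image ch) => x [].
transitivity (\int[lam]_(x in phi @` U) (F x * weight h x)%:E)%E.
  rewrite integral_mkcond [RHS]integral_mkcond; apply: eq_integral => x _.
  rewrite !patchE; case: ifPn => [|xM]; case: ifPn => //.
    move=> xU; rewrite inE => Mx; rewrite FV ?mul0r// => Vx.
    by move/negP: xU; apply; rewrite inE (chart_image ch).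
  by rewrite inE => /phiUM; move/negP: xM; rewrite inE.
apply: integral_density_pushforward => //.
- apply: continuous_measurable_rV_rV; first exact: open_chart_dom.
  by move=> u uU; exact: (chart_cont ch uU).
- apply: continuous_measurable_rV; first exact: open_chart_dom.
  exact: chart_cont_g ch.
- by move=> u _; exact: sqrtr_ge0.
- by move=> A mA AU; exact: (lamP.2 _ _ (chart_param ch) _ mA AU).
- by apply: measurable_F_weight => // x /phiUM[].
Qed.

Let G u : \bar R := ((F (phi u) * `|\det (E u)|^-1)%:E * c)%E.

Let c_fin : c \is a fin_num.
Proof. by rewrite ge0_fin_numE ?measure_ge0//; exact: lebesgue_unit_ball_fin. Qed.

Let measurable_density : measurable_fun U (fun u => F (phi u) * `|\det (E u)|^-1).
Proof.
have oU : open U by exact: open_chart_dom.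
apply: measurable_funM; apply: continuous_measurable_rV => // u uU.
  apply: (@continuous_comp _ _ _ phi F); first exact: (chart_cont ch uU).
  exact: (cF (chart_X ch uU)).
apply: (@continuousV _ _ (fun u => `|\det (E u)|)).
  by rewrite normr_eq0 -unitfE -unitmxE; exact: (chart_E ch uU).
apply: (@continuous_comp _ _ _ (fun u => \det (E u)) (fun y : R => `|y|)).
  exact: (chart_cont_E ch uU).
exact: norm_continuous.
Qed.

(** The determinant identity [chart_det] turns [|\det T| / |\det (E u)|] into the area element times
    the weight. *)
Let G_mass : (`|\det T|%:E * \int[lebesgue_rV R k]_(u in U) G u =
  c * \int[lam]_(x in M) (F x * weight h x)%:E)%E.
Proof.
have E0 u : U u -> 0 <= F (phi u) * `|\det (E u)|^-1.
  by move=> _; rewrite mulr_ge0// invr_ge0.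
rewrite chart_integral.
have -> : (\int[lebesgue_rV R k]_(u in U) G u =
    c * \int[lebesgue_rV R k]_(u in U) (F (phi u) * `|\det (E u)|^-1)%:E)%E.
  rewrite -(fineK c_fin) -ge0_integralZl_EFin//.
  - by apply: eq_integral => u _; rewrite muleC fineK.
  - exact/measurable_EFinP.
  - exact/fine_ge0/measure_ge0.
rewrite muleCA; congr (_ * _)%E; rewrite -ge0_integralZl_EFin//; last exact/measurable_EFinP.
apply: eq_integral => u; rewrite inE => uU.
rewrite -!EFinM; congr (_%:E); rewrite mulrCA (chart_det ch uU) -mulrA; congr (_ * _).
exact: mulrC.
Qed.

(** Dominated convergence again, now in [u]: slice masses are at most [B * 4 ^+ n] on the bounded
    set [U]. The limit [G] is then integrable, and since [c] is positive the surface integral is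
    finite. *)
Theorem chart_tube_limit :
  (\int[lam]_(x in M) (F x * weight h x)%:E < +oo)%E /\
  ((e_ m ^- n)%:E * \int[lebesgue_rV R (k + n)]_(x in tube X h (e_ m)) (F x)%:E)%E
    @[m --> \oo] --> (c * \int[lam]_(x in M) (F x * weight h x)%:E)%E.
Proof.
have c_ge0 : (0 <= c)%E by exact: measure_ge0.
have G_ge0 u : (0 <= G u)%E.
  by rewrite mule_ge0// lee_fin mulr_ge0// invr_ge0.
have mG : measurable_fun U G.
  by apply: emeasurable_funM => //; exact/measurable_EFinP.
have [] // := @dominated_convergence _ _ _ (lebesgue_rV R k) U measurable_U
  (fun m u => slice_mass (e_ m) u) G (fun=> (B * 4 ^+ n)%:E).
- by move=> m; apply: measurable_funTS; exact: measurable_slice_mass.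
- by apply: aeW => u uU; exact: slice_mass_cvg.
- apply/integrableP; split => //.
  rewrite integral_cst//= muleC; apply: lte_mul_pinfty => //.
    by rewrite ge0_fin_numE ?measure_ge0//.
  exact: ltry.
- apply: aeW => u m uU; rewrite gee0_abs//.
  exact: slice_mass_le.
move=> Gint _ Gcvg; split.
  have Goo : (\int[lebesgue_rV R k]_(u in U) G u < +oo)%E.
    have /integrableP[_] := Gint.
    by under eq_integral do rewrite gee0_abs//.
  have : (c * \int[lam]_(x in M) (F x * weight h x)%:E < +oo)%E.
    rewrite -G_mass; apply: lte_mul_pinfty => //.
  have I0 : (0 <= \int[lam]_(x in M) (F x * weight h x)%:E)%E by exact: integral_ge0.
  move: I0; case: (\int[lam]_(x in M) (F x * weight h x)%:E)%E => //=.
    by move=> y _ _; exact: ltry.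
  by move=> _; rewrite gt0_muley// ?ltxx//; exact: lebesgue_unit_ball_gt0.
rewrite -G_mass.
under eq_fun do rewrite integral_tube_mass//.
by apply: cvgeZl => //.
Qed.

End local_limit.

Lemma norm_sub_continuous {R : realType} m (x : 'rV[R]_m) :
  continuous (fun y : 'rV[R]_m => `|y - x|).
Proof.
move=> y; apply: (@continuous_comp _ _ _ (fun y : 'rV[R]_m => y - x) (fun w => `|w|));
  last exact: norm_continuous.
have -> : (fun y : 'rV[R]_m => y - x) = id - (fun=> x) by exact/funext.
by apply: continuousB; [exact: cvg_id|exact: cst_continuous].
Qed.

(** * From charts to functions cut off near a compact set *)

Section cutoff.
Context {R : realType} {k n : nat}.
Variables (X : set 'rV[R]_(k + n)) (h : 'rV[R]_(k + n) -> 'rV[R]_n).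
Variable lam : {measure set 'rV[R]_(k + n) -> \bar R}.
Hypotheses (oX : open X) (hC2 : C2_on X h) (hsub : submersion_on X h).
Hypothesis lamP : is_riemannian_measure k (zero_set X h) lam.

Implicit Types F G : 'rV[R]_(k + n) -> R.

Definition surface_integral (F : 'rV[R]_(k + n) -> R) : \bar R :=
  (\int[lam]_(x in zero_set X h) (F x * weight h x)%:E)%E.

Definition tube_mass (e : R) (F : 'rV[R]_(k + n) -> R) : \bar R :=
  ((e ^- n)%:E * \int[lebesgue_rV R (k + n)]_(x in tube X h e) (F x)%:E)%E.

(* The mass of the e-tube around M, divided by e^n, tends to the volume of the
   unit ball of R^n times the surface integral. *)
Definition tubular (F : 'rV[R]_(k + n) -> R) := [/\ forall x, 0 <= F x,
  measurable_fun setT F, (surface_integral F < +oo)%E &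
  forall e_ : nat -> R, (forall m, 0 < e_ m) -> e_ m @[m --> \oo] --> (0 : R) ->
    tube_mass (e_ m) F @[m --> \oo] -->
    (lebesgue_rV R n (@unit_ball R n) * surface_integral F)%E].

Lemma measurable_weight : measurable_fun (zero_set X h) (weight h).
Proof.
have mX : measurable X by exact: measurable_open_mx.
apply: (@measurable_funS _ _ _ _ X) => //; first by move=> x [].
apply: continuous_measurable_rV => // x Xx.
apply: (weight_continuous oX hC2.1 _ Xx) => y Xy.
exact: (submersion_gram_gt0 hsub Xy).
Qed.

Let mM := measurable_zero_set oX hC2.1.

Lemma measurable_mul_weight (F : 'rV[R]_(k + n) -> R) : measurable_fun (zero_set X h) F ->
  measurable_fun (zero_set X h) (fun x => (F x * weight h x)%:E).
Proof.
by move=> mF; apply/measurable_EFinP; apply: measurable_funM => //; exact: measurable_weight.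
Qed.

Lemma eq_tubular F G : F =1 G -> tubular F -> tubular G.
Proof. by move=> FG; rewrite (_ : F = G)//; exact/funext. Qed.

Lemma tubular0 : tubular (fun=> 0).
Proof.
have S0 : surface_integral (fun=> 0) = 0%E.
  by rewrite /surface_integral integral0_eq// => x _; rewrite mul0r.
split => //; first by rewrite S0 ltry.
move=> e_ _ _; rewrite S0 mule0 (_ : (fun m => _) = cst 0%E); first exact: cvg_cst.
by apply/funext => m; rewrite /tube_mass integral0_eq ?mule0.
Qed.

Lemma surface_integralD F G : (forall x, 0 <= F x) -> (forall x, 0 <= G x) ->
  measurable_fun setT F -> measurable_fun setT G ->
  surface_integral (fun x => F x + G x) = (surface_integral F + surface_integral G)%E.
Proof.
move=> F0 G0 mF mG; rewrite /surface_integral.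
rewrite -ge0_integralD//.
- by apply: eq_integral => x _; rewrite mulrDl EFinD.
- by move=> x _; rewrite lee_fin mulr_ge0// weight_ge0.
- by apply: measurable_mul_weight; exact: measurable_funTS.
- by move=> x _; rewrite lee_fin mulr_ge0// weight_ge0.
- by apply: measurable_mul_weight; exact: measurable_funTS.
Qed.

Lemma tube_massD e F G : 0 < e -> (forall x, 0 <= F x) -> (forall x, 0 <= G x) ->
  measurable_fun setT F -> measurable_fun setT G ->
  tube_mass e (fun x => F x + G x) = (tube_mass e F + tube_mass e G)%E.
Proof.
move=> e0 F0 G0 mF mG; rewrite /tube_mass -ge0_muleDr.
- congr (_ * _)%E; rewrite -ge0_integralD//.
  + exact: (measurable_tube oX hC2.1).
  + by move=> x _; rewrite lee_fin.
  + by apply/measurable_EFinP; exact: measurable_funTS.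
  + by move=> x _; rewrite lee_fin.
  + by apply/measurable_EFinP; exact: measurable_funTS.
- by apply: integral_ge0 => x _; rewrite lee_fin.
- by apply: integral_ge0 => x _; rewrite lee_fin.
Qed.

Lemma tubularD F G : tubular F -> tubular G -> tubular (fun x => F x + G x).
Proof.
move=> [F0 mF IF cF] [G0 mG IG cG]; split.
- by move=> x; rewrite addr_ge0.
- exact: measurable_funD.
- by rewrite surface_integralD// lte_add_pinfty.
- move=> e_ e0 ecvg; rewrite surface_integralD//.
  have S0 H : (forall x, 0 <= H x) -> (0 <= surface_integral H)%E.
    by move=> H0; apply: integral_ge0 => x _; rewrite lee_fin mulr_ge0// weight_ge0.
  rewrite ge0_muleDr ?S0//.
  under eq_fun do rewrite tube_massD//.
  apply: cvgeD; [|exact: cF|exact: cG].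
  by apply: ge0_adde_def; rewrite inE mule_ge0// S0.
Qed.

Lemma tubular_sum (I : eqType) (r : seq I) (F : I -> 'rV[R]_(k + n) -> R) :
  (forall i, i \in r -> tubular (F i)) -> tubular (fun x => \sum_(i <- r) F i x).
Proof.
elim: r => [|i r IHr] tF.
  by apply: eq_tubular tubular0 => x; rewrite big_nil.
have tFi : tubular (F i) by apply: tF; rewrite mem_head.
have tFr : tubular (fun x => \sum_(j <- r) F j x).
  by apply: IHr => j jr; apply: tF; rewrite in_cons jr orbT.
by apply: eq_tubular (tubularD tFi tFr) => x; rewrite big_cons.
Qed.

(** On the zero set a chart applies. Elsewhere [enorm h] stays above half its value at [x0], so the
    surface integral is 0 and small tubes miss the support of [F]. *)
Lemma local_tubular x0 : X x0 -> exists V, [/\ open V, V x0 &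
  forall F B, (forall x, 0 <= F x) -> (forall x, F x <= B) -> measurable_fun setT F ->
    (forall x, X x -> {for x, continuous F}) -> (forall x, ~ V x -> F x = 0) ->
    tubular F].
Proof.
move=> Xx0; have [hx0|hx0] := eqVneq (h x0) 0.
  have [K [S [r [z [V ch]]]]] := submersion_graph_chart oX hC2 hsub (conj Xx0 hx0).
  exists V; split; [exact: chart_openV ch|exact: chart_V ch|].
  move=> F B F0 FB mF cF FV.
  have gram x : X x -> 0 < \det (nabla h x *m (nabla h x)^T).
    by move=> Xx; exact: (submersion_gram_gt0 hsub Xx).
  have L := chart_tube_limit oX hC2.1 ch F0 mF FB cF FV.
  split => //.
    have e0 : forall m, 0 < m.+1%:R^-1 :> R by move=> m; rewrite invr_gt0.
    have ec : m.+1%:R^-1 @[m --> \oo] --> (0 : R) by exact: cvg_harmonic.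
    by have [] := L _ e0 ec _ lamP gram.
  by move=> e_ e0 ec; have [] := L _ e0 ec _ lamP gram.
pose V := X `&` h @^-1` [set y | enorm (h x0) / 2 < enorm y].
have h0 : 0 < enorm (h x0).
  by rewrite (lt_le_trans _ (norm_le_enorm _))// normr_gt0.
exists V; split.
- apply: open_continuous_preimage => //.
    by move=> x Xx; exact/differentiable_continuous/(C1_on_diff hC2.1).
  rewrite (_ : [set y | _] = @enorm R n @^-1` [set t | enorm (h x0) / 2 < t])//.
  by apply: open_comp; [move=> y _; exact: continuous_enorm|exact: open_gt].
- by split => //=; rewrite ltr_pdivrMr// ltr_pMr// ltr1n.
- move=> F B F0 FB mF cF FV.
  have S0 : surface_integral F = 0%E.
    rewrite /surface_integral integral0_eq// => x [_ hx].
    rewrite FV ?mul0r// => -[_ /=]; rewrite hx -(scale0r (0 : 'rV[R]_n)) enormZ normr0 mul0r.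
    by rewrite ltNge divr_ge0// ltW.
  split => //; first by rewrite S0 ltry.
  move=> e_ e0 ec; rewrite S0 mule0.
  have n1 : \forall m \near \oo, e_ m < enorm (h x0) / 2.
    by apply: (cvgr_lt 0 ec); rewrite divr_gt0.
  have n2 : \forall m \near \oo, 0%E = tube_mass (e_ m) F.
    apply: filterS n1 => m em.
    rewrite /tube_mass integral0_eq ?mule0// => x [_ /= hx].
    by rewrite FV// => -[_ /=]; rewrite ltNge (le_trans hx)// ltW.
  by apply: cvg_trans (near_eq_cvg n2) _; exact: cvg_cst.
Qed.

(** A tent of slope [2 / r]: at least 1 within distance [r / 2] of [x], and 0 from distance [r]
    on. *)
Definition bump (x : 'rV[R]_(k + n)) (r : R) (y : 'rV[R]_(k + n)) : R :=
  Num.max 0 (2 - 2 / r * `|y - x|).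

Lemma bump_ge0 x r y : 0 <= bump x r y.
Proof. by rewrite le_max lexx. Qed.

Lemma bump_ge1 x r y : 0 < r -> `|y - x| <= r / 2 -> 1 <= bump x r y.
Proof.
move=> r0 yx; rewrite le_max; apply/orP; right.
have : 2 / r * `|y - x| <= 2 / r * (r / 2) by rewrite ler_wpM2l// divr_ge0// ltW.
have -> : 2 / r * (r / 2) = 1 by field; rewrite gt_eqF.
lra.
Qed.

Lemma bump_eq0 x r y : 0 < r -> r <= `|y - x| -> bump x r y = 0.
Proof.
move=> r0 yx; apply/max_l; rewrite subr_le0.
have : 2 / r * r <= 2 / r * `|y - x| by rewrite ler_wpM2l// divr_ge0// ltW.
by rewrite divfK ?gt_eqF.
Qed.

Lemma bump_continuous x r : continuous (bump x r).
Proof.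
have -> : bump x r = (fun=> 0) \max (fun y => 2 - 2 / r * `|y - x|) by exact/funext.
move=> y; apply: continuous_max; first exact: cst_continuous.
have -> : (fun y => 2 - 2 / r * `|y - x|) = (fun=> 2) - (fun y => 2 / r * `|y - x|) by exact/funext.
apply: continuousB; first exact: cst_continuous.
by apply: (@continuousM _ _ (fun=> 2 / r)); [exact: cst_continuous|exact: norm_sub_continuous].
Qed.

Lemma local_tubular_ball x : X x -> exists r : R, [/\ 0 < r,
  forall y, `|y - x| <= r -> X y &
  forall F (B : R), (forall y, 0 <= F y) -> (forall y, F y <= B) -> measurable_fun setT F ->
    (forall y, X y -> {for y, continuous F}) -> (forall y, r <= `|y - x| -> F y = 0) ->
    tubular F].
Proof.
move=> Xx; have [V [oV Vx tV]] := local_tubular Xx.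
have /nbhs_ballP[d /= d0 dXV] : nbhs x (X `&` V).
  exact: (@filterI _ (nbhs x) (nbhs_filter x) _ _ (open_near oX Xx) (open_near oV Vx)).
have d2 : d / 2 < d by rewrite ltr_pdivrMr// ltr_pMr// ltr1n.
have dP y : `|y - x| <= d / 2 -> (X `&` V) y.
  by move=> yx; apply: dXV; rewrite -ball_normE /= distrC (le_lt_trans yx).
exists (d / 2); split; [by rewrite divr_gt0|by move=> y /dP[]|].
move=> F B F0 FB mF cF Fr; apply: (tV F B) => // y Vy.
by apply: Fr; rewrite leNgt; apply/negP => /ltW/dP[_].
Qed.

(** Half-radius balls cover [K], so the sum [s] of the bumps is at least 1 there and [s / max(s, 1)]
    is the cut-off. Its summands have supports small enough for the local result, and [tubular] is
    stable under finite sums. *)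
Lemma compact_cutoff (K : set 'rV[R]_(k + n)) : compact K -> K `<=` X ->
  exists chi : 'rV[R]_(k + n) -> R,
  [/\ forall y, 0 <= chi y <= 1, forall y, K y -> chi y = 1,
      forall y, ~ X y -> chi y = 0, continuous chi &
      forall f : 'rV[R]_(k + n) -> R, (forall y, X y -> 0 <= f y) ->
        (forall y, X y -> {for y, continuous f}) ->
        tubular (fun y => f y * chi y)].
Proof.
move=> cK KX.
have /choice[rad radP] : forall x, exists r : R, X x -> [/\ 0 < r,
  forall y, `|y - x| <= r -> X y &
  forall F (B : R), (forall y, 0 <= F y) -> (forall y, F y <= B) -> measurable_fun setT F ->
    (forall y, X y -> {for y, continuous F}) -> (forall y, r <= `|y - x| -> F y = 0) ->
    tubular F].
  move=> x; have [Xx|] := pselect (X x); last by exists 0.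
  by have [r rP] := local_tubular_ball Xx; exists r.
have : cover_compact K by rewrite -compact_cover.
move=> /(_ _ K (fun x => ball x (rad x / 2))) [].
- by move=> x _; exact: ball_open.
- move=> x Kx; exists x => //; apply: ballxx.
  by have [r0 _ _] := radP _ (KX _ Kx); rewrite divr_gt0.
move=> D DK KD.
have DX x : x \in D -> X x by move=> /DK; rewrite inE => /KX.
pose s y := \sum_(x <- D) bump x (rad x) y.
have s0 y : 0 <= s y by apply: sumr_ge0 => x _; exact: bump_ge0.
have bump_le x y : x \in D -> bump x (rad x) y <= s y.
  move=> xD; rewrite /s (bigD1_seq x)//= ?fset_uniq// lerDl.
  by apply: sumr_ge0 => *; exact: bump_ge0.
have cs : continuous s by move=> y; apply: continuous_sum_fun => x _; exact: bump_continuous.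
(* The maximum with 1 avoids division by zero and changes nothing where [s] is at least 1. *)
pose t y := Num.max (s y) 1.
have t1 y : 1 <= t y by rewrite le_max lexx orbT.
have t0 y : 0 < t y by exact: lt_le_trans (t1 y).
have st y : s y <= t y by rewrite le_max lexx.
have ct : continuous t.
  have -> : t = s \max (fun=> 1) by exact/funext.
  by move=> y; apply: continuous_max; [exact: cs|exact: cst_continuous].
have ctV : continuous (fun y => (t y)^-1).
  by move=> y; apply: (@continuousV _ _ t); [rewrite gt_eqF|exact: ct].
have bumpX x y : x \in D -> ~ X y -> bump x (rad x) y = 0.
  move=> /DX/radP[r0 rX _] Xy; apply: bump_eq0 => //.
  by rewrite leNgt; apply/negP => /ltW/rX.
exists (fun y => s y / t y); split.
- by move=> y; rewrite divr_ge0 ?s0 ?(ltW (t0 _))//= ler_pdivrMr// mul1r.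
- move=> y /KD[x xD]; rewrite -ball_normE /= => xy.
  have s1 : 1 <= s y.
    apply: le_trans (bump_le _ y xD); apply: bump_ge1.
      by have [] := radP _ (DX _ xD).
    by rewrite distrC ltW.
  by rewrite /t max_l// divff// gt_eqF// (lt_le_trans _ s1).
- move=> y Xy; rewrite /s big_seq big1 ?mul0r// => x xD.
  exact: bumpX.
- by move=> y; apply: (@continuousM _ _ s); [exact: cs|exact: ctV].
move=> f f0 cf.
apply: (@eq_tubular (fun y => \sum_(x <- D) (f y * (bump x (rad x) y * (t y)^-1)))).
  by move=> y; rewrite -mulr_sumr -mulr_suml.
apply: tubular_sum => x xD; have [r0 rX rT] := radP _ (DX _ xD).
have q1 y : bump x (rad x) y * (t y)^-1 <= 1.
  by rewrite ler_pdivrMr// mul1r (le_trans (bump_le _ _ xD)).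
have q0 y : 0 <= bump x (rad x) y * (t y)^-1.
  by rewrite divr_ge0 ?bump_ge0 ?(ltW (t0 _)).
have cq : continuous (fun y => bump x (rad x) y * (t y)^-1).
  move=> y; apply: (@continuousM _ _ (bump x (rad x))); last exact: ctV.
  exact: bump_continuous.
pose A := [set y | `|y - x| <= rad x].
have cA : compact A.
  have -> : A = (fun w => w + x) @` [set w | `|w| <= rad x].
    apply/seteqP; split => [y yx|_ [w /= wr <-]]; last by rewrite /A /= addrK.
    by exists (y - x); rewrite ?subrK.
  apply: continuous_compact; last by apply: compact_norm_le; exact: ltW.
  apply: continuous_subspaceT => w.
  have -> : (fun w : 'rV[R]_(k + n) => w + x) = id + (fun=> x) by exact/funext.
  by apply: continuousD; [exact: cvg_id|exact: cst_continuous].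
have cfA : {within A, continuous f}.
  by apply: continuous_in_subspaceT => y; rewrite inE => /rX Xy; exact: cf.
have Ax : A x by rewrite /A /= subrr normr0 ltW.
(* The local result asks for a bounded function; [f] may be unbounded on [X], but it is bounded on
   the compact ball [A]. *)
have [c /[!inE] Ac cmax] := EVT_max_rV (ex_intro _ x Ax) cA cfA.
have fc0 : 0 <= f c by apply: f0; exact: rX.
have cF y : {for y, continuous (fun y => f y * (bump x (rad x) y * (t y)^-1))}.
  have [Xy|Xy] := pselect (X y).
    by apply: (@continuousM _ _ f); [exact: cf|exact: cq].
  (* Outside [X] nothing is known of [f], but the closed ball of radius [rad x] lies in [X], so the
     bump vanishes near [y]. *)
  apply: (@near_eq_continuous _ _ (fun=> 0)); last exact: cst_continuous.
  have yr : rad x < `|y - x| by rewrite ltNge; apply/negP => /rX.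
  have cn : {for y, continuous (fun y : 'rV[R]_(k + n) => `|y - x|)} by exact: norm_sub_continuous.
  have near_r : \forall y' \near y, rad x < `|y' - x|.
    have og : open [set a : R | rad x < a] by exact: open_gt.
    exact: (cn _ (open_near og yr)).
  apply: (@filterS _ (nbhs y) (nbhs_filter y) _ _ _ near_r) => y' /ltW yr'.
  by rewrite bump_eq0// mul0r mulr0.
apply: (rT _ (f c)).
- move=> y; have [Xy|Xy] := pselect (X y); first by rewrite mulr_ge0// f0.
  by rewrite bumpX// mul0r mulr0.
- move=> y; have [Ay|Ay] := pselect (A y).
    apply: (@le_trans _ _ (f y)); last by apply: cmax; rewrite inE.
    by rewrite ler_piMr// f0//; exact: rX.
  by rewrite bump_eq0 ?mul0r ?mulr0// leNgt; apply/negP => /ltW.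
- by apply: continuous_measurable_rV; [exact: openT|move=> y _; exact: cF].
- by move=> y _; exact: cF.
- by move=> y yr; rewrite bump_eq0// mul0r mulr0.
Qed.

End cutoff.

(** * Probability measures given by a density, and auxiliary facts on integrals and compact sets *)

Section density_prob.
Local Open Scope ereal_scope.
Context d (T : measurableType d) (R : realType) (mu : {measure set T -> \bar R})
  (D : set T) (f : T -> R).

(** The proofs are arguments so that the measure and probability structures can be attached to the
    term itself. *)
Definition density_prob (mD : measurable D) (mf : measurable_fun D f)
    (f0 : forall x, D x -> (0 <= f x)%R) (f1 : \int[mu]_(x in D) (f x)%:E = 1)
    (A : set T) : \bar R := \int[mu]_(x in A `&` D) (f x)%:E.

Hypotheses (mD : measurable D) (mf : measurable_fun D f).
Hypotheses (f0 : forall x, D x -> (0 <= f x)%R) (f1 : \int[mu]_(x in D) (f x)%:E = 1).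

Let P := density_prob mD mf f0 f1.

Let P0 : P set0 = 0.
Proof. by rewrite /P /density_prob set0I integral_set0. Qed.

Let P_ge0 A : 0 <= P A.
Proof. by apply: integral_ge0 => x [_ Dx]; rewrite lee_fin f0. Qed.

Let P_additive : semi_sigma_additive P.
Proof.
move=> F mF tF mUF; rewrite /P /density_prob setI_bigcupl ge0_integral_bigcup//=.
- apply: is_cvg_nneseries_cond => i _ _.
  by apply: integral_ge0 => x [_ Dx]; rewrite lee_fin f0.
- by move=> i; exact: measurableI.
- apply/measurable_EFinP; apply: measurable_funS mf => //.
  by move=> x [i _ []].
- by move=> x [i _ [_ Dx]]; rewrite lee_fin f0.
- by apply: trivIset_setIr.
Qed.

HB.instance Definition _ := isMeasure.Build _ _ _ P P0 P_ge0 P_additive.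

Let P_setT : P setT = 1.
Proof. by rewrite /P /density_prob setTI. Qed.

HB.instance Definition _ := Measure_isProbability.Build _ _ _ P P_setT.

Lemma density_probP : exists Q : probability T R,
  forall A, measurable A -> Q A = \int[mu]_(x in A `&` D) (f x)%:E.
Proof. by exists P. Qed.

End density_prob.

Lemma density_integral d (T : measurableType d) (R : realType)
    (mu nu : {measure set T -> \bar R}) (D E : set T) (s : T -> R) (G : T -> \bar R) :
  measurable D -> measurable E -> D `<=` E -> measurable_fun D s ->
  (forall x, D x -> 0 <= s x) ->
  (forall A, measurable A -> nu A = \int[mu]_(x in A `&` D) (s x)%:E)%E ->
  measurable_fun E G -> (forall x, E x -> 0 <= G x)%E ->
  (\int[nu]_(x in E) G x = \int[mu]_(x in D) (G x * (s x)%:E))%E.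
Proof.
move=> mD mE DE ms s0 nuE mG G0.
apply: (@integral_density_pushforward _ _ _ _ _ mu nu D E id s) => //.
by move=> A mA _; rewrite nuE// setIC.
Qed.

(** [K j] consists of the points of norm at most [j] whose ball of radius [1 / (j + 1)] lies in [X];
    this form also covers an empty complement. *)
Lemma compact_exhaustion (R : realType) m (X : set 'rV[R]_m) : open X ->
  exists K : nat -> set 'rV[R]_m, [/\ forall j, compact (K j), forall j, K j `<=` X,
    {homo K : i j / (i <= j)%N >-> (i `<=` j)} & X `<=` \bigcup_j K j].
Proof.
move=> oX.
pose K j := [set x : 'rV[R]_m | `|x| <= j%:R] `&`
  [set x | forall y, `|y - x| < j.+1%:R^-1 -> X y].
have KX j : K j `<=` X.
  by move=> x [_]; apply; rewrite subrr normr0 invr_gt0.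
exists K; split => //.
- move=> j; apply: (@subclosed_compact _ _ [set x : 'rV[R]_m | `|x| <= j%:R]).
  + apply: closedI.
      apply: compact_closed; first exact: norm_hausdorff.
      exact: compact_norm_le.
    rewrite (_ : [set x | _] = ~` \bigcup_(y in ~` X) ball y j.+1%:R^-1).
      by apply: open_closedC; apply: bigcup_open => y _; exact: ball_open.
    apply/seteqP; split => [x Hx [y /= Xy]|x Hx y yx].
      by rewrite -ball_normE /= => yx; apply: Xy; exact: Hx.
    by apply: contrapT => Xy; apply: Hx; exists y => //; rewrite -ball_normE.
  + exact: compact_norm_le.
  + by move=> x [].
- move=> i j ij x [xi Hx]; split; first by rewrite /= (le_trans xi)// ler_nat.
  by move=> y yx; apply: Hx; rewrite (lt_le_trans yx)// lef_pV2 ?posrE// ler_nat.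
- move=> x Xx.
  have /nbhs_ballP[e /= e0 eX] : nbhs x X by exact: (open_near oX Xx).
  have [N1 HN1] : exists N, `|x| <= N%:R.
    by exists (Num.trunc `|x|).+1; apply/ltW; exact: truncnS_gt.
  have [N2 HN2] : exists N, N.+1%:R^-1 <= e.
    exists (Num.trunc e^-1); rewrite -[leRHS]invrK lef_pV2 ?posrE ?invr_gt0//.
    by apply/ltW; exact: truncnS_gt.
  exists (maxn N1 N2) => //; split.
    by rewrite /= (le_trans HN1)// ler_nat leq_maxl.
  move=> y yx; apply: eX; rewrite -ball_normE /= distrC (lt_le_trans yx)//.
  by rewrite (le_trans _ HN2)// lef_pV2 ?posrE// ler_nat ltnS leq_maxr.
Qed.

(** An inequality between differences, written with sums so that no infinite integral is
    subtracted. *)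
Lemma integral_add_le d (T : measurableType d) (R : realType) (mu : {measure set T -> \bar R})
    (D : set T) (f1 f2 g1 g2 : T -> R) : measurable D ->
  measurable_fun D f1 -> measurable_fun D f2 -> measurable_fun D g1 -> measurable_fun D g2 ->
  (forall x, D x -> [/\ 0 <= f1 x, 0 <= f2 x, 0 <= g1 x & 0 <= g2 x]) ->
  (forall x, D x -> f1 x + f2 x <= g1 x + g2 x) ->
  (\int[mu]_(x in D) (f1 x)%:E + \int[mu]_(x in D) (f2 x)%:E <=
   \int[mu]_(x in D) (g1 x)%:E + \int[mu]_(x in D) (g2 x)%:E)%E.
Proof.
move=> mD mf1 mf2 mg1 mg2 h0 hle.
have E (f : T -> R) : measurable_fun D f -> measurable_fun D (fun x => (f x)%:E).
  by move=> mf; exact/measurable_EFinP.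
rewrite -ge0_integralD//; [|by move=> x /h0[]|exact: E|by move=> x /h0[]|exact: E].
rewrite -ge0_integralD//; [|by move=> x /h0[]|exact: E|by move=> x /h0[]|exact: E].
apply: ge0_le_integral => //.
- by move=> x /h0[? ? _ _]; rewrite -EFinD lee_fin addr_ge0.
- by apply: emeasurable_funD; exact: E.
- by apply: emeasurable_funD; exact: E.
Qed.

Lemma ereal_cvg_le (R : realType) (u v : nat -> \bar R) (l l' : \bar R) :
  u m @[m --> \oo] --> l -> v m @[m --> \oo] --> l' -> (forall m, u m <= v m)%E ->
  (l <= l')%E.
Proof.
move=> ul vl uv.
rewrite -(cvg_lim (@ereal_hausdorff R) ul) -(cvg_lim (@ereal_hausdorff R) vl).
apply: lee_lim; [exact: cvgP ul|exact: cvgP vl|exact: nearW].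
Qed.

(** * Removal of the cut-off by tightness *)

Section tube_limit.
Context {R : realType} {k n : nat}.
Variables (X : set 'rV[R]_(k + n)) (h : 'rV[R]_(k + n) -> 'rV[R]_n).
Variable lam : {measure set 'rV[R]_(k + n) -> \bar R}.
Hypotheses (oX : open X) (hC2 : C2_on X h) (hsub : submersion_on X h).
Hypothesis lamP : is_riemannian_measure k (zero_set X h) lam.
Variable a : 'rV[R]_(k + n) -> R.

Let contX (f : 'rV[R]_(k + n) -> R) := forall x, X x -> {for x, continuous f}.
Let TM e f := @tube_mass R k n X h e f.
Let SI f := @surface_integral R k n X h lam f.
Let M := zero_set X h.

Hypotheses (a0 : forall x, X x -> 0 <= a x) (ca : contX a).
Hypothesis a_int : forall e, 0 < e ->
  (0 < \int[lebesgue_rV R (k + n)]_(x in tube X h e) (a x)%:E < +oo)%E.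
Hypothesis tight : forall eta : R, 0 < eta < 1 -> exists K : set 'rV[R]_(k + n),
  [/\ compact K, K `<=` X & forall e : R, 0 < e ->
   ((1 - eta)%:E * \int[lebesgue_rV R (k + n)]_(x in tube X h e) (a x)%:E <=
     \int[lebesgue_rV R (k + n)]_(x in tube X h e `&` K) (a x)%:E)%E].

Let mM : measurable M := measurable_zero_set oX hC2.1.
Let mtube e : measurable (tube X h e) := measurable_tube oX hC2.1 e.

Let mX f : contX f -> measurable_fun X f.
Proof. by move=> cf; exact: continuous_measurable_rV. Qed.

Let mtubef e f : contX f -> measurable_fun (tube X h e) f.
Proof.
move=> cf; apply: (@measurable_funS _ _ _ _ X); [exact: measurable_open_mx|by move=> x []|].
exact: mX.
Qed.

Let mMf f : contX f -> measurable_fun M f.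
Proof.
move=> cf; apply: (@measurable_funS _ _ _ _ X); [exact: measurable_open_mx|by move=> x []|].
exact: mX.
Qed.

Let mMw f : contX f -> measurable_fun M (fun x => f x * weight h x).
Proof.
move=> cf; apply: measurable_funM; first exact: mMf.
exact: (measurable_weight oX hC2 hsub).
Qed.

Let contXM f g : contX f -> contX g -> contX (fun x => f x * g x).
Proof. by move=> cf cg x Xx; apply: (@continuousM _ _ f g); [exact: cf|exact: cg]. Qed.

Let TM_ge0 e f : 0 < e -> (forall x, X x -> 0 <= f x) -> (0 <= TM e f)%E.
Proof.
move=> e0 f0; rewrite mule_ge0//; first by rewrite lee_fin invr_ge0 exprn_ge0 ?ltW.
by apply: integral_ge0 => x [Xx _]; rewrite lee_fin f0.
Qed.

Let SI_ge0 f : (forall x, X x -> 0 <= f x) -> (0 <= SI f)%E.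
Proof.
move=> f0; apply: integral_ge0 => x [Xx _].
by rewrite lee_fin mulr_ge0 ?f0// weight_ge0.
Qed.

Let TM_add_le e f1 f2 g1 g2 : 0 < e -> contX f1 -> contX f2 -> contX g1 -> contX g2 ->
  (forall x, X x -> [/\ 0 <= f1 x, 0 <= f2 x, 0 <= g1 x & 0 <= g2 x]) ->
  (forall x, X x -> f1 x + f2 x <= g1 x + g2 x) ->
  (TM e f1 + TM e f2 <= TM e g1 + TM e g2)%E.
Proof.
move=> e0 c1 c2 c3 c4 h0 hle.
have I0 f : (forall x, X x -> 0 <= f x) ->
    (0 <= \int[lebesgue_rV R (k + n)]_(x in tube X h e) (f x)%:E)%E.
  by move=> f0; apply: integral_ge0 => x [Xx _]; rewrite lee_fin f0.
rewrite /TM /tube_mass -!ge0_muleDr; try by apply: I0 => x /h0[].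
apply: lee_wpmul2l; first by rewrite lee_fin invr_ge0 exprn_ge0 ?ltW.
apply: integral_add_le => //; try exact: mtubef.
  by move=> x [/h0].
by move=> x [Xx _]; exact: hle.
Qed.

Let SI_add_le f1 f2 g1 g2 : contX f1 -> contX f2 -> contX g1 -> contX g2 ->
  (forall x, X x -> [/\ 0 <= f1 x, 0 <= f2 x, 0 <= g1 x & 0 <= g2 x]) ->
  (forall x, X x -> f1 x + f2 x <= g1 x + g2 x) ->
  (SI f1 + SI f2 <= SI g1 + SI g2)%E.
Proof.
move=> c1 c2 c3 c4 h0 hle.
apply: integral_add_le => //; try exact: mMw.
  by move=> x [Xx _]; have [? ? ? ?] := h0 _ Xx; split; rewrite mulr_ge0// weight_ge0.
by move=> x [Xx _]; rewrite -!mulrDl ler_wpM2r ?weight_ge0// hle.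
Qed.

Let TM_le e f g : 0 < e -> contX f -> contX g -> (forall x, X x -> 0 <= f x) ->
  (forall x, X x -> f x <= g x) -> (TM e f <= TM e g)%E.
Proof.
move=> e0 cf cg f0 fg.
apply: lee_wpmul2l; first by rewrite lee_fin invr_ge0 exprn_ge0 ?ltW.
apply: ge0_le_integral => //.
- by move=> x [Xx _]; rewrite lee_fin f0.
- by apply/measurable_EFinP; exact: mtubef.
- by apply/measurable_EFinP; exact: mtubef.
- by move=> x [Xx _]; rewrite lee_fin fg.
Qed.

Let SI_le f g : contX f -> contX g -> (forall x, X x -> 0 <= f x) ->
  (forall x, X x -> f x <= g x) -> (SI f <= SI g)%E.
Proof.
move=> cf cg f0 fg; apply: ge0_le_integral => //.
- by move=> x [Xx _]; rewrite lee_fin mulr_ge0 ?f0// weight_ge0.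
- by apply/measurable_EFinP; exact: mMw.
- by apply/measurable_EFinP; exact: mMw.
- by move=> x [Xx _]; rewrite lee_fin ler_wpM2r ?weight_ge0// fg.
Qed.

Let TM_fin e : 0 < e -> (TM e a < +oo)%E.
Proof.
move=> e0; have /andP[_ aoo] := a_int e0.
rewrite /TM /tube_mass; apply: lte_mul_pinfty => //.
by rewrite lee_fin invr_ge0 exprn_ge0 ?ltW.
Qed.

Let cut (f chi : 'rV[R]_(k + n) -> R) x : R := f x * chi x.

Let is_cutoff (chi : 'rV[R]_(k + n) -> R) := [/\ forall y, 0 <= chi y <= 1, contX chi &
  forall f : 'rV[R]_(k + n) -> R, (forall y, X y -> 0 <= f y) -> contX f ->
    tubular X h lam (cut f chi)].

Let tight_cutoff eta : 0 < eta < 1 -> exists chi, is_cutoff chi /\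
  forall e, 0 < e -> ((1 - eta)%:E * TM e a <= TM e (cut a chi))%E.
Proof.
move=> eta01; have [K [cK KX KP]] := tight eta01.
have [chi [chi01 chiK chiX cchi tchi]] := compact_cutoff oX hC2 hsub lamP cK KX.
exists chi; split; first by split => // x _; exact: cchi.
move=> e e0; rewrite /TM /tube_mass muleCA.
apply: lee_wpmul2l; first by rewrite lee_fin invr_ge0 exprn_ge0 ?ltW.
apply: (le_trans (KP _ e0)).
have mK : measurable K by exact: compact_measurable_rV.
apply: (@le_trans _ _ (\int[lebesgue_rV R (k + n)]_(x in tube X h e `&` K) (cut a chi x)%:E)%E).
  rewrite le_eqVlt; apply/orP; left; apply/eqP; apply: eq_integral => x.
  by rewrite inE => -[_ Kx]; rewrite /cut chiK// mulr1.
apply: ge0_subset_integral => //; first exact: measurableI.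
- by apply/measurable_EFinP; apply: mtubef; apply: contXM => // x _; exact: cchi.
- move=> x [Xx _]; rewrite lee_fin mulr_ge0 ?a0//.
  by have /andP[] := chi01 x.
Qed.

Let c := lebesgue_rV R n (@unit_ball R n).

Let c_fin : c \is a fin_num.
Proof. by rewrite ge0_fin_numE ?measure_ge0//; exact: lebesgue_unit_ball_fin. Qed.

Let c_gt0 : (0 < c)%E.
Proof. exact: lebesgue_unit_ball_gt0. Qed.

Let cutoff_a_ge0 chi f : is_cutoff chi -> (forall x, X x -> 0 <= f x) ->
  forall x, X x -> 0 <= f x * chi x.
Proof.
by move=> [chi01 _ _] f0 x Xx; have /andP[? _] := chi01 x; rewrite mulr_ge0// f0.
Qed.

Let cutoff_le chi f : is_cutoff chi -> (forall x, X x -> 0 <= f x) ->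
  forall x, X x -> f x * chi x <= f x.
Proof.
by move=> [chi01 _ _] f0 x Xx; have /andP[_ ?] := chi01 x; rewrite ler_piMr// f0.
Qed.

(** The tight inequality survives the limit once [a] on its left is lowered to [a chi'], whose tube
    masses are known to converge; the volume [c] cancels. *)
Let SI_cutoff_le eta chi chi' : 0 < eta < 1 -> is_cutoff chi -> is_cutoff chi' ->
  (forall e, 0 < e -> ((1 - eta)%:E * TM e a <= TM e (cut a chi))%E) ->
  ((1 - eta)%:E * SI (cut a chi') <= SI (cut a chi))%E.
Proof.
move=> /andP[eta0 eta1] chiP chi'P chiT.
have [_ cchi tchi] := chiP; have [_ cchi' tchi'] := chi'P.
have e0 : forall m, 0 < m.+1%:R^-1 :> R by move=> m; rewrite invr_gt0.
have ec : m.+1%:R^-1 @[m --> \oo] --> (0 : R) by exact: cvg_harmonic.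
have [_ _ _ /(_ _ e0 ec) lim1] := tchi _ a0 ca.
have [_ _ fin2 /(_ _ e0 ec) lim2] := tchi' _ a0 ca.
have lim3 : ((1 - eta)%:E * TM m.+1%:R^-1 (cut a chi'))%E @[m --> \oo] -->
    ((1 - eta)%:E * (c * SI (cut a chi')))%E by exact: cvgeZl.
rewrite -(lee_pmul2l c_fin c_gt0) muleCA.
apply: (ereal_cvg_le lim3 lim1) => m.
apply: le_trans (chiT _ (e0 m)); apply: lee_wpmul2l; first by rewrite lee_fin subr_ge0 ltW.
by apply: TM_le => //; [exact: contXM|exact: cutoff_a_ge0|exact: cutoff_le].
Qed.

(** The cut-offs [chi'] equal 1 on the sets of a compact exhaustion, and monotone convergence
    restores [a] on the left. *)
Let SI_tight eta chi : 0 < eta < 1 -> is_cutoff chi ->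
  (forall e, 0 < e -> ((1 - eta)%:E * TM e a <= TM e (cut a chi))%E) ->
  ((1 - eta)%:E * SI a <= SI (cut a chi))%E.
Proof.
move=> eta01 chiP chiT; have /andP[eta0 eta1] := eta01.
have [K [cK KX Kmono XK]] := compact_exhaustion oX.
have mK j : measurable (K j) by exact: compact_measurable_rV.
have -> : SI a = (\int[lam]_(x in \bigcup_j (M `&` K j)) (a x * weight h x)%:E)%E.
  congr integral; rewrite -setI_bigcupr; apply/esym/setIidPl => x [Xx _].
  exact: XK.
have MKM : \bigcup_j (M `&` K j) `<=` M by move=> x [j _ []].
have lim1 : (\int[lam]_(x in M `&` K j) (a x * weight h x)%:E)%E @[j --> \oo] -->
    (\int[lam]_(x in \bigcup_j (M `&` K j)) (a x * weight h x)%:E)%E.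
  apply: ge0_nondecreasing_set_cvg_integral.
  - by move=> i j ij; apply/subsetPset; apply: setIS; exact: Kmono.
  - by move=> j; exact: measurableI.
  - by move=> j; apply/measurable_EFinP; apply: measurable_funS (mMw ca).
  - by move=> j x [[Xx _] _]; rewrite lee_fin mulr_ge0 ?a0// weight_ge0.
have lim2 : ((1 - eta)%:E * \int[lam]_(x in M `&` K j) (a x * weight h x)%:E)%E @[j --> \oo] -->
    ((1 - eta)%:E * \int[lam]_(x in \bigcup_j (M `&` K j)) (a x * weight h x)%:E)%E.
  exact: cvgeZl.
apply: (ereal_cvg_le lim2 (cvg_cst _)) => j.
have [chi' [chi01 chiK chiX cchi' tchi']] := compact_cutoff oX hC2 hsub lamP (cK j) (KX j).
have chi'P : is_cutoff chi' by split => // x _; exact: cchi'.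
have [_ cc' _] := chi'P.
apply: le_trans (SI_cutoff_le eta01 chiP chi'P chiT).
apply: lee_wpmul2l; first by rewrite lee_fin subr_ge0 ltW.
apply: (@le_trans _ _ (\int[lam]_(x in M `&` K j) (cut a chi' x * weight h x)%:E)%E).
  rewrite le_eqVlt; apply/orP; left; apply/eqP; apply: eq_integral => x.
  by rewrite inE => -[_ Kx]; rewrite /cut chiK// mulr1.
apply: ge0_subset_integral => //; first exact: measurableI.
- apply/measurable_EFinP; apply: (@mMw (cut a chi')); exact: contXM.
- move=> x [Xx _]; rewrite lee_fin mulr_ge0 ?weight_ge0//.
  exact: (cutoff_a_ge0 chi'P a0).
Qed.

(** With [eta = 1/2] the surface integral of [a] is at most twice that of a compact cut-off, which
    is finite. *)
Lemma surface_integral_fin : (SI a < +oo)%E.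
Proof.
have h01 : 0 < (1 / 2 : R) < 1 by apply/andP; split; lra.
have [chi [chiP chiT]] := tight_cutoff h01.
have [_ _ tchi] := chiP; have [_ _ fin _] := tchi _ a0 ca.
have := SI_tight h01 chiP chiT => H.
have := le_lt_trans H fin; have := SI_ge0 a0.
case: (SI a) => //= y; first by move=> _ _; exact: ltry.
by rewrite gt0_muley ?ltxx// lte_fin; lra.
Qed.

(** A zero integral would make [a] times the weight vanish almost everywhere on M, but the weight is
    positive on M. *)
Lemma surface_integral_gt0 :
  (0 < lam ([set x | X x /\ (0 < a x)%R] `&` zero_set X h))%E -> (0 < SI a)%E.
Proof.
move=> supp; rewrite lt0e SI_ge0// andbT; apply/eqP => SI0.
have mf : measurable_fun M (fun x => (a x * weight h x)%:E).
  by apply/measurable_EFinP; exact: mMw.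
have abs0 : (\int[lam]_(x in M) `|(a x * weight h x)%:E| = 0)%E.
  rewrite -SI0; apply: eq_integral => x; rewrite inE => -[Xx _].
  by rewrite gee0_abs// lee_fin mulr_ge0 ?a0// weight_ge0.
have /(ae_eq_integral_abs _ mM mf)[N [mN N0 fN]] := abs0.
suff : (lam ([set x | X x /\ (0 < a x)%R] `&` zero_set X h) <= lam N)%E.
  by rewrite N0 leNgt supp.
have mS : measurable ([set x | X x /\ (0 < a x)%R] `&` zero_set X h).
  rewrite (_ : _ `&` _ = M `&` a @^-1` [set r | 0 < r]).
    apply: (mMf ca) => //; rewrite -set_itvoy; exact: measurable_itv.
  by apply/seteqP; split => x; [move=> [[_ ?] ?]|move=> [[? ?] ?]].
apply: le_measure; rewrite ?inE// => x [[Xx ax] Mx]; apply: fN => /= /(_ Mx).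
move/eqP; rewrite gt_eqF// lte_fin mulr_gt0// invr_gt0 sqrtr_gt0.
by apply: submersion_gram_gt0; first exact: hsub.
Qed.

Let TM_finE e f : 0 < e -> contX f -> (forall x, X x -> 0 <= f x) ->
  (forall x, X x -> f x <= a x) -> TM e f = (fine (TM e f))%:E.
Proof.
move=> e0 cf f0 fa; rewrite fineK// ge0_fin_numE; last exact: TM_ge0.
by apply: le_lt_trans (TM_fin e0); exact: TM_le.
Qed.

Let SI_finE f : contX f -> (forall x, X x -> 0 <= f x) ->
  (forall x, X x -> f x <= a x) -> SI f = (fine (SI f))%:E.
Proof.
move=> cf f0 fa; rewrite fineK// ge0_fin_numE; last exact: SI_ge0.
by apply: le_lt_trans surface_integral_fin; exact: SI_le.
Qed.

Let cE : c = (fine c)%:E.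
Proof. by rewrite fineK. Qed.

Let tubular_fine e_ f : (forall m, 0 < e_ m) -> e_ m @[m --> \oo] --> (0 : R) ->
  contX f -> (forall x, X x -> 0 <= f x) -> (forall x, X x -> f x <= a x) ->
  tubular X h lam f -> fine (TM (e_ m) f) @[m --> \oo] --> fine c * fine (SI f).
Proof.
move=> e0 ec cf f0 fa [_ _ _ /(_ _ e0 ec)].
by rewrite -/c -/(SI f) cE SI_finE// -EFinM => /fine_cvgP[].
Qed.

Let tube_mass_bounded e_ : (forall m, 0 < e_ m) -> e_ m @[m --> \oo] --> (0 : R) ->
  exists2 B : R, 0 < B & \forall m \near \oo, fine (TM (e_ m) a) <= B.
Proof.
move=> e0 ec; have h01 : 0 < (1 / 2 : R) < 1 by apply/andP; split; lra.
have [chi [chiP chiT]] := tight_cutoff h01.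
have [_ cchi tchi] := chiP.
have ccut : contX (cut a chi) by exact: contXM.
have cut0 : forall x, X x -> 0 <= cut a chi x by exact: cutoff_a_ge0.
have cuta : forall x, X x -> cut a chi x <= a x by exact: cutoff_le.
have lim := tubular_fine e0 ec ccut cut0 cuta (tchi _ a0 ca).
set L := fine c * fine (SI (cut a chi)) in lim.
have L0 : 0 <= L by rewrite mulr_ge0// fine_ge0 ?SI_ge0// ltW.
(* The 2 is [1 / (1 - eta)] for [eta = 1/2], and [L] is the limit of the cut-off masses. *)
exists (2 * (L + 1)); first by lra.
have : \forall m \near \oo, fine (TM (e_ m) (cut a chi)) < L + 1.
  by apply: (cvgr_lt _ lim); rewrite ltrDl.
apply: filterS => m; have := chiT _ (e0 m).
rewrite (TM_finE (e0 m) ca)// (TM_finE (e0 m) ccut)// -EFinM lee_fin /=.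
by move=> H1 H2; lra.
Qed.

(** Cutting off [a g] costs at most [eta] times the tube mass of [a] on one side and [eta] times its
    surface integral on the other; in between, the cut-off function has the known limit. *)
Lemma tube_mass_cvg g e_ : contX g -> (forall x, X x -> 0 <= g x <= 1) ->
  (forall m, 0 < e_ m) -> e_ m @[m --> \oo] --> (0 : R) ->
  fine (TM (e_ m) (fun x => a x * g x)) @[m --> \oo] -->
    fine c * fine (SI (fun x => a x * g x)).
Proof.
move=> cg g01 e0 ec.
have [B B0 TB] := tube_mass_bounded e0 ec.
pose A := fine c * fine (SI a).
have A0 : 0 <= A by rewrite mulr_ge0// fine_ge0 ?SI_ge0// ltW.
apply/cvgrPdist_le => d d0.
(* [B] bounds the tube masses and [A] is the limit expected for [a]; dividing [d / 3] by a number
   above [A], [B] and [d] meets all three conditions. *)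
have [eta [eta01 etaB etaA]] : exists eta : R,
    [/\ 0 < eta < 1, eta * B <= d / 3 & eta * A <= d / 3].
  pose s := B + A + d + 1.
  have s0 : 0 < s by rewrite /s; lra.
  exists (d / 3 / s); split.
  - rewrite divr_gt0 ?divr_gt0//= ltr_pdivrMr// mul1r /s; lra.
  - by rewrite mulrAC ler_pdivrMr// ler_wpM2l// ?divr_ge0 ?(ltW d0)// /s; lra.
  - by rewrite mulrAC ler_pdivrMr// ler_wpM2l// ?divr_ge0 ?(ltW d0)// /s; lra.
have /andP[eta0 eta1] := eta01.
have [chi [chiP chiT]] := tight_cutoff eta01.
have [chi01 cchi tchi] := chiP.
pose ag := cut a g; pose agc := cut ag chi; pose ac := cut a chi.
have cag : contX ag by exact: contXM.
have cagc : contX agc by exact: contXM.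
have cac : contX ac by exact: contXM.
have ag0 x : X x -> 0 <= ag x.
  by move=> Xx; have /andP[? _] := g01 _ Xx; rewrite mulr_ge0 ?a0.
have aga x : X x -> ag x <= a x.
  by move=> Xx; have /andP[_ ?] := g01 _ Xx; rewrite ler_piMr ?a0.
have agc0 x : X x -> 0 <= agc x by move=> Xx; exact: (cutoff_a_ge0 chiP ag0).
have agcag x : X x -> agc x <= ag x by move=> Xx; exact: (cutoff_le chiP ag0).
have agca x : X x -> agc x <= a x by move=> Xx; exact: le_trans (agcag x Xx) (aga x Xx).
have ac0 x : X x -> 0 <= ac x by move=> Xx; exact: (cutoff_a_ge0 chiP a0).
have aca x : X x -> ac x <= a x by move=> Xx; exact: (cutoff_le chiP a0).
(* (1 - g) (1 - chi) >= 0 *)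
have mix x : X x -> ag x + ac x <= agc x + a x.
  move=> Xx; have /andP[_ g1] := g01 _ Xx; have /andP[_ chi1] := chi01 x.
  rewrite -subr_ge0 (_ : _ - _ = a x * ((1 - g x) * (1 - chi x))).
    by rewrite !mulr_ge0 ?a0// subr_ge0.
  by rewrite /agc /ac /ag /cut; ring.
have mix0 x : X x -> [/\ 0 <= ag x, 0 <= ac x, 0 <= agc x & 0 <= a x].
  by move=> Xx; split; [exact: ag0|exact: ac0|exact: agc0|exact: a0].
have lim := tubular_fine e0 ec cagc agc0 agca (tchi _ ag0 cag).
have c0 : 0 < fine c by rewrite fine_gt0// c_gt0 -ge0_fin_numE ?measure_ge0.
have SI1 : fine (SI agc) <= fine (SI ag).
  by rewrite -lee_fin -!SI_finE//; exact: SI_le.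
have SI2 : fine (SI ag) <= fine (SI agc) + eta * fine (SI a).
  have := SI_add_le cag cac cagc ca mix0 mix; have := SI_tight eta01 chiP chiT.
  rewrite (SI_finE cag)// (SI_finE cagc)// (SI_finE ca)// (SI_finE cac)//.
  by rewrite -EFinM -!EFinD !lee_fin /= => H1 H2; lra.
near=> m.
have T1 : fine (TM (e_ m) agc) <= fine (TM (e_ m) ag).
  by rewrite -lee_fin -!TM_finE//; exact: TM_le.
have T2 : fine (TM (e_ m) ag) <= fine (TM (e_ m) agc) + eta * fine (TM (e_ m) a).
  have := TM_add_le (e0 m) cag cac cagc ca mix0 mix; have := chiT _ (e0 m).
  rewrite (TM_finE (e0 m) cag)// (TM_finE (e0 m) cagc)// (TM_finE (e0 m) ca)//.
  rewrite (TM_finE (e0 m) cac)// -EFinM -!EFinD !lee_fin /= => H1 H2; lra.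
have T3 : fine (TM (e_ m) a) <= B by near: m.
have T4 : `|fine c * fine (SI agc) - fine (TM (e_ m) agc)| <= d / 3.
  by near: m; apply: (cvgrPdist_le _ _).1 lim _ _; rewrite divr_gt0.
have T5 : eta * fine (TM (e_ m) a) <= d / 3.
  by apply: le_trans etaB; rewrite ler_pM2l.
have S1 : fine c * fine (SI agc) <= fine c * fine (SI ag) by rewrite ler_pM2l.
have S2 : fine c * fine (SI ag) <= fine c * fine (SI agc) + eta * A.
  by rewrite /A mulrCA -mulrDr ler_pM2l.
rewrite -[fun x => _]/ag ler_norml; move: T4; rewrite ler_norml => /andP[? ?].
apply/andP; split; lra.
Unshelve. all: by end_near.
Qed.

End tube_limit.

(** It holds at infinite [x] too, where [fine] is 0 on both sides. *)
Lemma fineZ (R : realType) (r : R) (x : \bar R) : 0 < r -> fine (r%:E * x) = r * fine x.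
Proof.
case: x => [x| |] r0 //=; first by rewrite gt0_muley ?lte_fin//= mulr0.
by rewrite gt0_muleNy ?lte_fin//= mulr0.
Qed.

(** [nu] is carried by [D], with density [s / Z]; by [fineZ] the constant leaves the integral
    without a finiteness condition. *)
Lemma Rintegral_density d (T : measurableType d) (R : realType)
    (mu nu : {measure set T -> \bar R}) (D E : set T) (s G : T -> R) (Z : R) :
  measurable D -> measurable E -> D `<=` E -> measurable_fun D s ->
  (forall x, D x -> 0 <= s x) -> 0 < Z ->
  (forall A, measurable A -> nu A = \int[mu]_(x in A `&` D) (s x / Z)%:E)%E ->
  measurable_fun E G -> (forall x, E x -> 0 <= G x) ->
  \int[nu]_(x in E) G x = fine (\int[mu]_(x in D) (s x * G x)%:E)%E / Z.
Proof.
move=> mD mE DE ms s0 Z0 nuE mG G0.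
have sZ0 x : D x -> 0 <= s x / Z by move=> Dx; rewrite divr_ge0 ?s0// ltW.
have msZ : measurable_fun D (fun x => s x / Z) by exact: measurable_funM.
have := @density_integral _ _ _ mu nu D E _ (fun x => (G x)%:E) mD mE DE msZ sZ0 nuE.
rewrite /Rintegral => ->; last 2 first.
- exact/measurable_EFinP.
- by move=> x Ex; rewrite lee_fin G0.
rewrite mulrC -fineZ ?invr_gt0// -ge0_integralZl_EFin//; last 3 first.
- by move=> x Dx; rewrite lee_fin mulr_ge0 ?s0// G0//; exact: DE.
- apply/measurable_EFinP; apply: measurable_funM => //.
  exact: measurable_funS mG.
- by rewrite invr_ge0 ltW.
by congr fine; apply: eq_integral => x _; rewrite -!EFinM; congr EFin; ring.
Qed.

Lemma Rintegral_affine d (T : measurableType d) (R : realType) (Q : probability T R)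
    (E : set T) (g : T -> R) (b c : R) : measurable E -> Q E = 1%E ->
  measurable_fun E g -> (forall x, E x -> 0 <= g x <= 1) ->
  \int[Q]_(x in E) (b * g x - c) = b * \int[Q]_(x in E) g x - c.
Proof.
move=> mE QE mg g01.
have ig : Q.-integrable E (EFin \o g).
  apply: measurable_bounded_integrable => //; first by rewrite -ge0_fin_numE// fin_num_measure.
  exists 1; split => // M M1 x Ex /=; have /andP[g0 g1] := g01 _ Ex.
  by rewrite ger0_norm// (le_trans g1)// ltW.
have ic : Q.-integrable E (EFin \o cst c).
  by apply: finite_measure_integrable_cst.
have ibg : Q.-integrable E (EFin \o (fun x => b * g x)).
  exact: (integrableZl mE b ig).
rewrite RintegralB// RintegralZl//; congr (_ - _).
rewrite Rintegral_cst// (_ : fine _ = 1) ?mulr1//.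
exact: (congr1 fine QE).
Qed.

(** * The probability on the zero set and weak convergence to it *)

Section weak_limit.
Context {R : realType} {k n : nat}.
Variables (X : set 'rV[R]_(k + n)) (h : 'rV[R]_(k + n) -> 'rV[R]_n).
Variable lam : {measure set 'rV[R]_(k + n) -> \bar R}.
Hypotheses (oX : open X) (hC2 : C2_on X h) (hsub : submersion_on X h).
Hypothesis lamP : is_riemannian_measure k (zero_set X h) lam.
Variable a : 'rV[R]_(k + n) -> R.
Hypotheses (a0 : forall x, X x -> 0 <= a x) (ca : {within X, continuous a}).
Hypothesis a_supp : (0 < lam ([set x | X x /\ (0 < a x)%R] `&` zero_set X h))%E.
Hypothesis a_int : forall e, 0 < e ->
  (0 < \int[lebesgue_rV R (k + n)]_(x in tube X h e) (a x)%:E < +oo)%E.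
Variable P : R -> probability 'rV[R]_(k + n) R.
Hypothesis P_density : forall e : R, 0 < e ->
  has_density_on X (lebesgue_rV R (k + n))
    (fun x => a x * \1_(tube X h e) x / \int[lebesgue_rV R (k + n)]_(w in tube X h e) a w)
    (P e).
Hypothesis P_tight : tight_on X P.

Let M := zero_set X h.
Let mu := lebesgue_rV R (k + n).
Let Z e := \int[mu]_(w in tube X h e) a w.
Let W := \int[lam]_(w in M) (a w * weight h w).

Let mX : measurable X := measurable_open_mx oX.
Let mM : measurable M := measurable_zero_set oX hC2.1.
Let mtube e : measurable (tube X h e) := measurable_tube oX hC2.1 e.

Let within_for (f : 'rV[R]_(k + n) -> R) : {within X, continuous f} ->
  forall x, X x -> {for x, continuous f}.
Proof. by rewrite (continuous_open_subspace _ oX) => cf x Xx; apply: cf; rewrite inE. Qed.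

Let mXf (f : 'rV[R]_(k + n) -> R) : {within X, continuous f} -> measurable_fun X f.
Proof. by move=> cf; apply: continuous_measurable_rV => //; exact: within_for. Qed.

Let Z_gt0 e : 0 < e -> 0 < Z e.
Proof. by move=> e0; rewrite /Z /Rintegral fine_gt0// a_int. Qed.

Let P_tube e A : 0 < e -> measurable A ->
  P e A = (\int[mu]_(x in A `&` tube X h e) (a x / Z e)%:E)%E.
Proof.
move=> e0 mA; rewrite P_density//.
rewrite (_ : A `&` tube X h e = (A `&` X) `&` tube X h e); last first.
  by rewrite -setIA; congr (_ `&` _); apply/esym/setIidPr => x [].
apply: esym; apply: etrans (integral_mkcondr _ _ _ _) _; apply: eq_integral => x _.
rewrite patchE indicE; case: ifPn => _ /=; first by rewrite mulr1.
by rewrite mulr0 mul0r.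
Qed.

Let P_X e : 0 < e -> P e X = 1%E.
Proof.
move=> e0; rewrite -(probability_setT (P e)) !P_density// setIid setTI.
by [].
Qed.

(** Tightness of the measures [P e], multiplied through by the normalizing constant [Z e]. *)
Let tight (eta : R) : 0 < eta < 1 -> exists K : set 'rV[R]_(k + n),
  [/\ compact K, K `<=` X & forall e : R, 0 < e ->
   ((1 - eta)%:E * \int[mu]_(x in tube X h e) (a x)%:E <=
     \int[mu]_(x in tube X h e `&` K) (a x)%:E)%E].
Proof.
move=> /andP[eta0 eta1]; have [K [cK KX PK]] := P_tight eta0.
have mK : measurable K by exact: compact_measurable_rV.
exists K; split => // e e0; have Z0 := Z_gt0 e0.
have ZE : (\int[mu]_(x in tube X h e) (a x)%:E)%E = (Z e)%:E.
  by rewrite fineK// gt0_fin_numE; have /andP[] := a_int e0.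
have := PK _ e0; rewrite P_tube// setIC.
have -> : (\int[mu]_(x in tube X h e `&` K) (a x / Z e)%:E =
    (Z e)^-1%:E * \int[mu]_(x in tube X h e `&` K) (a x)%:E)%E.
  rewrite -ge0_integralZl_EFin//.
  - by apply: eq_integral => x _; rewrite -EFinM mulrC.
  - exact: measurableI.
  - by move=> x [[Xx _] _]; rewrite lee_fin a0.
  - apply/measurable_EFinP; apply: measurable_funS (mXf ca) => //.
    by move=> x [[]].
  - by rewrite invr_ge0 ltW.
move=> /(@lee_wpmul2l _ (Z e)%:E); rewrite lee_fin => /(_ (ltW Z0)).
have ZV : ((Z e)%:E * (Z e)^-1%:E)%E = 1%E by rewrite -EFinM divff ?gt_eqF.
by rewrite muleA ZV mul1e ZE muleC.
Qed.

Let SI_fin := surface_integral_fin oX hC2 hsub lamP a0 (within_for ca) tight.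
Let SI_gt0 := surface_integral_gt0 oX hC2 hsub a0 (within_for ca) a_supp.

Let W_gt0 : 0 < W.
Proof. by rewrite /W /Rintegral fine_gt0// SI_gt0 SI_fin. Qed.

Let WE : (\int[lam]_(w in M) (a w * weight h w)%:E)%E = W%:E.
Proof. by rewrite fineK// gt0_fin_numE. Qed.

Let maw : measurable_fun M (fun x => a x * weight h x).
Proof.
apply: measurable_funM; last exact: (measurable_weight oX hC2 hsub).
by apply: measurable_funS (mXf ca) => // x [].
Qed.

Let aw_ge0 x : M x -> 0 <= a x * weight h x.
Proof. by move=> [Xx _]; rewrite mulr_ge0 ?a0// weight_ge0. Qed.

Lemma surface_probability : exists P0 : probability 'rV[R]_(k + n) R,
  has_density_on M lam (fun x => a x * weight h x / W) P0.
Proof.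
apply: density_probP => //.
- exact: measurable_funM.
- by move=> x Mx; rewrite divr_ge0 ?aw_ge0// ltW.
transitivity (\int[lam]_(x in M) (W^-1%:E * (a x * weight h x)%:E))%E.
  by apply: eq_integral => x _; rewrite -EFinM mulrC.
rewrite ge0_integralZl_EFin//; last 2 first.
- exact/measurable_EFinP.
- by rewrite invr_ge0 ltW.
by rewrite WE -EFinM mulVf ?gt_eqF.
Qed.

Variable P0 : probability 'rV[R]_(k + n) R.
Hypothesis P0_density : has_density_on M lam (fun x => a x * weight h x / W) P0.

Lemma surface_probability_support : P0 M = 1%E.
Proof. by rewrite -(probability_setT P0) !P0_density// setIid setTI. Qed.

Let P0_X : P0 X = 1%E.
Proof.
rewrite -(probability_setT P0) !P0_density// setTI; congr integral.
by apply/setIidPr => x [].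
Qed.

(** The expectation is the quotient of the tube masses of [a g] and [a]. The powers of [e] cancel
    before the limit, the volume of the unit ball after it. *)
Let weak_limit01 (g : 'rV[R]_(k + n) -> R) (e_ : nat -> R) : {within X, continuous g} -> (forall x, X x -> 0 <= g x <= 1) ->
  (forall m, 0 < e_ m) -> e_ m @[m --> \oo] --> (0 : R) ->
  \int[P (e_ m)]_(x in X) g x @[m --> \oo] --> \int[P0]_(x in X) g x.
Proof.
move=> cg g01 e0 ec; have g0 x : X x -> 0 <= g x by move=> /g01/andP[].
have lim (f : 'rV[R]_(k + n) -> R) : (forall x, X x -> {for x, continuous f}) ->
    (forall x, X x -> 0 <= f x <= 1) -> _ :=
  fun cf f01 => tube_mass_cvg oX hC2 hsub lamP a0 (within_for ca) a_int tight cf f01 e0 ec.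
have lim1 := lim g (within_for cg) g01.
have lim2 := lim (fun=> 1) (fun x _ => @cst_continuous _ _ _ _)
  (fun x _ => introT andP (conj ler01 (lexx _))).
have a1 : (fun x => a x * 1) = a by apply/funext => x; rewrite mulr1.
rewrite a1 in lim2.
have mXa := mXf ca.
have -> : (fun m => \int[P (e_ m)]_(x in X) g x) = (fun m =>
    fine (tube_mass X h (e_ m) (fun x => a x * g x)) / fine (tube_mass X h (e_ m) a)).
  apply/funext => m; have en0 : 0 < e_ m ^- n by rewrite invr_gt0 exprn_gt0.
  rewrite (@Rintegral_density _ _ _ mu _ (tube X h (e_ m)) _ a _ (Z (e_ m)))//.
  - by rewrite /tube_mass !fineZ// -mulf_div divff ?gt_eqF// mul1r.
  - by move=> x [].
  - by apply: measurable_funS mXa => // x [].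
  - by move=> x [Xx _]; exact: a0.
  - exact: Z_gt0.
  - by move=> A mA; exact: P_tube.
  - exact: mXf.
have -> : \int[P0]_(x in X) g x =
    (fine (lebesgue_rV R n (@unit_ball R n)) *
      fine (surface_integral X h lam (fun x => a x * g x))) /
    (fine (lebesgue_rV R n (@unit_ball R n)) * fine (surface_integral X h lam a)).
  rewrite (@Rintegral_density _ _ _ lam _ M _ (fun x => a x * weight h x) _ W)//.
  - rewrite -mulf_div divff ?mul1r; last first.
      by rewrite gt_eqF// fine_gt0// lebesgue_unit_ball_gt0 lebesgue_unit_ball_fin.
    congr (fine _ / _); apply: eq_integral => x _; congr EFin; ring.
  - by move=> x [].
  - exact: mXf.
apply: cvgM => //; apply: cvgV => //.
rewrite mulf_neq0// gt_eqF// fine_gt0//.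
by rewrite lebesgue_unit_ball_gt0 lebesgue_unit_ball_fin.
Qed.

Lemma surface_probability_weak_limit : weakly_converges_on X P P0.
Proof.
move=> g cg [c gc]; apply/cvg_at_rightP => e_ [e0 ec].
(* The bound [c] may be 0, or even negative when [X] is empty; [b] is positive, and
   [(g + b) / (2 b)] takes values in [[0, 1]] on [X]. All the measures give [X] mass 1, so the
   affine change passes through the integrals. *)
pose b := `|c| + 1; have b0 : 0 < b by rewrite ltr_wpDl.
have gb x : X x -> - b <= g x <= b.
  move=> Xx; rewrite -ler_norml (le_trans (gc _ Xx))// (le_trans (ler_norm c))//.
  by rewrite lerDl.
pose g' x := (g x + b) / (2 * b).
have g'01 x : X x -> 0 <= g' x <= 1.
  move=> /gb/andP[g1 g2]; rewrite divr_ge0//=; [|lra|lra].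
  rewrite ler_pdivrMr; lra.
have gE : g = fun x => 2 * b * g' x - b.
  by apply/funext => x; rewrite /g'; field; rewrite gt_eqF.
have cg' : {within X, continuous g'}.
  rewrite (continuous_open_subspace _ oX) => x; rewrite inE => Xx.
  apply: (@continuousM _ _ (fun y => g y + b) (fun=> (2 * b)^-1)).
    by apply: (@continuousD _ _ _ g (fun=> b)); [exact: within_for|exact: cst_continuous].
  exact: cst_continuous.
have E (Q : probability 'rV[R]_(k + n) R) : Q X = 1%E ->
    \int[Q]_(x in X) g x = 2 * b * \int[Q]_(x in X) g' x - b.
  by move=> QX; rewrite [in LHS]gE Rintegral_affine//; exact: mXf.
rewrite E//; under eq_fun do rewrite E ?P_X//.
apply: cvgB; last exact: cvg_cst.
by apply: cvgM; [exact: cvg_cst|exact: weak_limit01].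
Qed.

End weak_limit.

Theorem theorem1 (R : realType) (n d : nat) (X : set 'rV[R]_d)
    (h : 'rV[R]_d -> 'rV[R]_n) (a : 'rV[R]_d -> R)
    (lamM : {measure set 'rV[R]_d -> \bar R})
    (P : R -> probability 'rV[R]_d R)
    (n_gt0 : (0 < n)%N) (n_lt_d : (n < d)%N) (openX : open X)
    (a_ge0 : forall x, X x -> 0 <= a x)
    (h_C2 : C2_on X h) (h_sub : submersion_on X h)
    (lamMP : is_riemannian_measure (d - n) (zero_set X h) lamM)
    (a_cont : {within X, continuous a})
    (a_supp : (0 < lamM ([set x | X x /\ (0 < a x)%R] `&` zero_set X h))%E)
    (a_int : forall e : R, 0 < e ->
      (0 < \int[lebesgue_rV R d]_(x in tube X h e) (a x)%:E < +oo)%E)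
    (P_density : forall e : R, 0 < e ->
      has_density_on X (lebesgue_rV R d)
        (fun x => a x * \1_(tube X h e) x /
                  \int[lebesgue_rV R d]_(w in tube X h e) a w)
        (P e))
    (P_tight : tight_on X P) :
  exists P0 : probability 'rV[R]_d R,
    [/\ P0 (zero_set X h) = 1%E,
        has_density_on (zero_set X h) lamM
          (fun x => a x * (Num.sqrt (\det (nabla h x *m (nabla h x)^T)))^-1 /
             \int[lamM]_(w in zero_set X h)
               (a w * (Num.sqrt (\det (nabla h w *m (nabla h w)^T)))^-1))
          P0 &
        weakly_converges_on X P P0].
Proof.
have dE : d = (d - n + n)%N by rewrite subnK// ltnW.
(* The dimension [d - n] is generalized to [k], so that [d] can be replaced by [k + n], the form
   used by the chart construction. *)
move: lamMP; move: dE; move: (d - n)%N => k dE lamMP'.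
clear n_lt_d; subst d.
have [P0 P0_density] := surface_probability openX h_C2 h_sub lamMP' a_ge0 a_cont a_supp a_int
  P_density P_tight.
exists P0; split; last exact: (surface_probability_weak_limit openX h_C2 h_sub lamMP' a_ge0
  a_cont a_supp a_int P_density P_tight P0_density).
- exact: (surface_probability_support openX h_C2 P0_density).
- exact: P0_density.
Qed.
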